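(* Let $T>0$, $d\ge 3$ and $p,q,s,\tilde s\in[1,\infty)$, let $p',s'$ be the Hölder conjugate exponents of $p,s$ respectively, and assume $p>1$ and $$\frac1p+\frac1q>1-\frac{p-1}{4(p+1)p},\qquad \tilde s\le \frac{s}{\,s/s'+(1+2\beta)/(1+4\beta)\,},\qquad\text{where }\beta=\frac{(p-1)(d-1)}{4p(p+1)}.$$ Then there exists a divergence-free vector field $$\boldsymbol u\in L^{\tilde s}(0,T;W^{1,q}(\mathbb T^d))\cap L^{s'}(0,T;L^{p'}(\mathbb T^d))$$ such that uniqueness of weak solutions to the transport equation $$\partial_t\rho+\boldsymbol u\cdot\nabla\rho=0,\qquad \rho|_{t=0}=\rho_0,$$ fails in the class $\rho\in L^s(0,T;L^p(\mathbb T^d))$.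
   Context: $\mathbb T^d=\mathbb R^d/\mathbb Z^d$. Divergence-free means $\operatorname{div}\boldsymbol u=0$ in the sense of distributions (in $x$). If $s=1$ then $s'=\infty$ and $s/s'=0$. Weak solution: for a divergence-free $\boldsymbol u:[0,T]\times\mathbb T^d\to\mathbb R^d$, a function $\rho:[0,T]\times\mathbb T^d\to\mathbb R$ is a weak solution with initial datum $\rho_0$ if $$\int_0^T\!\!\int_{\mathbb T^d}\rho(\partial_t\phi+\boldsymbol u\cdot\nabla\phi)\,dx\,dt=-\int_{\mathbb T^d}\rho_0\,\phi(0,x)\,dx\quad\text{for all }\phi\in C_c^\infty([0,T)\times\mathbb T^d).$$ Equivalently, the left-hand side vanishes for all $\phi\in C_c^\infty((0,T)\times\mathbb T^d)$, and $\rho$ is continuous in time in the distributional sense with $\lim_{t\to0^+}\rho(t)=\rho_0$ in the distributional sense. ''Uniqueness fails in a class'' means that, for this $\boldsymbol u$, there is an initial datum $\rho_0$ admitting at least two distinct weak solutions in that class. *)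

(* Defs.v *)
From HB Require Import structures.
From mathcomp Require Import all_boot all_order all_algebra.
From mathcomp Require Import all_classical all_reals all_analysis.

Set Implicit Arguments.
Unset Strict Implicit.
Unset Printing Implicit Defensive.

Import Order.TTheory GRing.Theory Num.Theory.
Import numFieldNormedType.Exports.

Local Open Scope classical_set_scope.
Local Open Scope ring_scope.

(* A function on T^d = R^d / Z^d is represented by a
   function on R^d = 'rV[R]_d that is 1-periodic in each coordinate, and is
   integrated over the fundamental domain [0, 1]^d. *)

(* The product sigma-algebra, i.e. the Borel sets of R^n. *)
Section measurable_rV.
Context {R : realType} {n : nat}.

Let coord (i : 'I_n) (x : 'rV[R]_n) : R := x 0 i.

Let rV_set0 : g_sigma_preimage coord set0.
Proof. exact: sigma_algebra0. Qed.

Let rV_setC A : g_sigma_preimage coord A -> g_sigma_preimage coord (~` A).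
Proof. exact: sigma_algebraC. Qed.

Let rV_bigcup (F : _^nat) : (forall i, g_sigma_preimage coord (F i)) ->
  g_sigma_preimage coord (\bigcup_i F i).
Proof. exact: sigma_algebra_bigcup. Qed.

HB.instance Definition _ := @isMeasurable.Build
  (measure_tuple_display default_measure_display)
  'rV[R]_n (g_sigma_preimage coord) rV_set0 rV_setC rV_bigcup.

End measurable_rV.

Section measurable_rV_fun.
Context {R : realType} {n : nat}.

Lemma measurable_rV_coord (i : 'I_n) :
  measurable_fun [set: 'rV[R]_n] (fun x : 'rV[R]_n => x 0 i : R).
Proof.
move=> _ Y mY; rewrite setTI; apply: sub_sigma_algebra => /=.
rewrite -bigcup_seq/=; exists i => /=; first by rewrite mem_index_enum.
by exists Y => //; rewrite setTI.
Qed.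

Lemma measurable_fun_rV d (T : measurableType d) (f : T -> 'rV[R]_n) :
  (forall i, measurable_fun [set: T] (fun x => f x 0 i : R)) ->
  measurable_fun [set: T] f.
Proof.
move=> mf; suff: (g_sigma_preimage (fun i x => f x 0 i : R)) `<=` measurable.
  rewrite (g_sigma_preimage_comp (fun (i : 'I_n) (x : 'rV[R]_n) => x 0 i : R)).
  by move=> fS _ A mA; apply: fS; exists A.
apply: smallest_sub; first exact: sigma_algebra_measurable.
rewrite -bigcup_seq; apply: bigcup_sub => i _.
by move=> A [B mB <-]; exact: mf.
Qed.

End measurable_rV_fun.

Section rV_cons.
Context {R : realType} {n : nat}.

Definition rV_cons (z : measurableTypeR R * 'rV[R]_n) : 'rV[R]_n.+1 :=
  row_mx (const_mx z.1 : 'rV[R]_1) z.2.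

Lemma measurable_rV_cons : measurable_fun setT rV_cons.
Proof.
apply: measurable_fun_rV => i; rewrite /rV_cons.
case: (fintype.splitP (i : 'I_(1 + n))) => j ij.
- rewrite (_ : (fun _ => _) = fst); first exact: measurable_fst.
  apply/funext => z; rewrite (_ : i = lshift n j); last exact: val_inj.
  by rewrite (row_mxEl (const_mx z.1 : 'rV[R]_1)) mxE.
- rewrite (_ : (fun _ => _) = (fun x : 'rV[R]_n => x 0 j : R) \o snd).
    by apply: measurableT_comp => //; exact: measurable_rV_coord.
  apply/funext => z; rewrite (_ : i = rshift 1 j); last exact: val_inj.
  by rewrite (row_mxEr (const_mx z.1 : 'rV[R]_1)).
Qed.

HB.instance Definition _ :=
  isMeasurableFun.Build _ _ _ _ rV_cons measurable_rV_cons.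

End rV_cons.

(* Lebesgue measure on [0, 1]^d as an iterated product: the image of
   (Lebesgue measure on [0, 1]) \x (torus n) under (t, x) |-> (t, x_1, .., x_n). *)
Fixpoint torus {R : realType} (d : nat) : probability 'rV[R]_d R :=
  match d with
  | 0 => \d_(0 : 'rV[R]_0)
  | n.+1 => distribution (uniform_prob (@ltr01 R) \x torus n)%E (@rV_cons R n)
  end.

Definition lebT {R : realType} (T : R) : {measure set (measurableTypeR R) -> \bar R} :=
  mrestr lebesgue_measure (measurable_itv `]0, T[).

Section smooth.
Context {R : realType} {V : normedModType R}.

Fixpoint iter_derive (vs : seq V) (f : V -> R) : V -> R :=
  if vs is v :: vs' then 'D_v (iter_derive vs' f) else f.

Definition smooth (f : V -> R) : Prop := forall vs : seq V,
  continuous (iter_derive vs f) /\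
  forall x v, derivable (iter_derive vs f) x v.

End smooth.

Section torus_functions.
Context {R : realType} {d : nat}.
Implicit Types f g psi : 'rV[R]_d -> R.

Definition basis_vec (i : 'I_d) : 'rV[R]_d := delta_mx 0 i.

Definition periodic {W : Type} (f : 'rV[R]_d -> W) : Prop :=
  forall x i, f (x + basis_vec i) = f x.

Definition torus_test psi : Prop := smooth psi /\ periodic psi.

Definition partial (i : 'I_d) psi : 'rV[R]_d -> R := 'D_(basis_vec i) psi.

(* g = \partial_i f in the sense of distributions on T^d. *)
Definition weak_partial (i : 'I_d) f g : Prop := forall psi, torus_test psi ->
  \int[torus d]_x (f x * partial i psi x) = - \int[torus d]_x (g x * psi x).

Definition torus_L1 f : Prop :=
  periodic f /\ (torus d).-integrable setT (EFin \o f).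

End torus_functions.

Section time_dependent.
Context {R : realType} {d : nat} (T : R).
Implicit Types (f rho : R * 'rV[R]_d -> R) (u : R * 'rV[R]_d -> 'rV[R]_d).

Definition mixed_norm (s p : \bar R) f : \bar R :=
  Lnorm (lebT T) s (fun t => Lnorm (torus d) p (fun x => (f (t, x))%:E)).

(* f \in L^s(0, T; L^p(T^d)).  Strong measurability of t |-> f (t, .) is joint
   measurability of f. *)
Definition L_Lp (s p : \bar R) f : Prop :=
  [/\ measurable_fun (`]0, T[%classic `*` setT) f,
      forall t, periodic (fun x => f (t, x))
    & (mixed_norm s p f < +oo)%E].

(* f \in L^s(0, T; W^{1,q}(T^d)): f and its weak spatial derivatives lie in
   L^s(0, T; L^q(T^d)). *)
Definition L_W1q (s q : \bar R) f : Prop :=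
  L_Lp s q f /\
  forall i : 'I_d, exists2 g, L_Lp s q g &
    {ae lebT T, forall t,
      weak_partial i (fun x => f (t, x)) (fun x => g (t, x))}.

Definition component u (i : 'I_d) : R * 'rV[R]_d -> R := fun z => u z 0 i.

Definition divergence_free u : Prop := {ae lebT T, forall t,
  forall psi, torus_test psi ->
    \int[torus d]_x (\sum_(i < d) u (t, x) 0 i * partial i psi x) = 0}.

(* phi \in C_c^\infty([0, T) x T^d), as the restriction to t >= 0 of a smooth
   function on R x T^d. *)
Definition spacetime_test (phi : R * 'rV[R]_d -> R) : Prop :=
  [/\ smooth phi,
      forall t, periodic (fun x => phi (t, x))
    & exists2 T', T' < T & forall t x, T' <= t -> phi (t, x) = 0].

Definition time_derive (phi : R * 'rV[R]_d -> R) : R * 'rV[R]_d -> R :=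
  'D_(1, 0) phi.

Definition space_derive (i : 'I_d) (phi : R * 'rV[R]_d -> R) :
    R * 'rV[R]_d -> R :=
  'D_(0, basis_vec i) phi.

(* For rho in L^s(L^p) and u in L^{s'}(L^{p'}) the integrand is integrable, so
   that the totalized integrals below are the actual ones. *)
Definition weak_solution u (rho0 : 'rV[R]_d -> R) rho : Prop :=
  forall phi, spacetime_test phi ->
    \int[lebT T]_t \int[torus d]_x
      (rho (t, x) * (time_derive phi (t, x) +
         \sum_(i < d) u (t, x) 0 i * space_derive i phi (t, x))) =
    - \int[torus d]_x (rho0 x * phi (0, x)).

Definition uniqueness_fails u (class : (R * 'rV[R]_d -> R) -> Prop) : Prop :=
  exists (rho0 : 'rV[R]_d -> R) rho1 rho2,
    [/\ torus_L1 rho0,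
        class rho1 /\ weak_solution u rho0 rho1,
        class rho2 /\ weak_solution u rho0 rho2
      & ~ {ae (lebT T \x torus d)%E, forall z, rho1 z = rho2 z}].

End time_dependent.

(* Main.v *)
Require Import Defs.
From HB Require Import structures.
From mathcomp Require Import all_boot all_order all_algebra.
From mathcomp Require Import all_classical all_reals all_analysis.
From mathcomp Require Import measurable_realfun ess_sup_inf.
From mathcomp Require Import ring lra.

(** A state is transported exactly by two kinds of moves: shears
    [x |-> x - h psi(x) e_i] with [psi] constant along [e_i], which are flows of
    divergence-free fields, and jumps that add a slot
    [a (1_(B + l e_i) - 1_B)], with [B] a dyadic box of side [l] in direction
    [e_i].  A jump violates the weak formulation by at most a constant times
    its flux [|a| vol(B) l^(1/p)].

    Each jump can be replaced, within the time allotted to it, by shears and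
    jumps of much smaller slots with the same net effect and at most half the
    total flux.  If [B] is a thin tube, cut the slot into [G] slots of length
    [del = l / G]: shear by [-del] along the tube, push the [G] boxes sideways
    out of the support of the shear by jumps across the tube, shear by [+del],
    push them back.  The background is only sheared back and forth, so it plays
    no role.  Other slots are first concentrated into thin tubes.  The norms of
    the shears, integrated over time, are bounded by the flux under the
    assumption on the exponents.

    Starting from a single jump from 0 to a nonzero slot and iterating, the
    total flux decreases geometrically while the fields become stationary
    outside a set of times of measure tending to 0.  The limit is a field with a
    weak solution that vanishes at time 0 but not later; the zero function is
    another solution. *)

Import Order.TTheory GRing.Theory Num.Theory.
Import numFieldNormedType.Exports.
Local Open Scope classical_set_scope.
Local Open Scope ring_scope.
Local Notation periodic := Defs.periodic.

(** * Measure theory on the torus *)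

(** The power [1/p] in the flux comes from a mismatch of lengths: a shear field fills a whole closed
    tube of the torus, while the state it moves occupies only a length of order [l]. A tube of
    cross-section [r^m], [m = d - 1], carrying [G] boxes of the given mass has L^p norm of order
    [X = mass G (l r^m)^(-1/p')]; the field that moves it by [l / G] in time [tau] has L^p' norm of
    order [(l / (G tau)) r^(m/p')]. The product times [tau] is [mass l^(1/p)], whatever [r] and [G]
    are. Taking [tau = mass l^(1/p) / X^s] balances it between L^s and L^s'. The free parameter is
    [G], of order [r^(-gam)]. The sideways jumps have length [r], hence a flux of order
    [G mass r^(1/p)], small for thin tubes when [gam < 1/p]. A larger [G] raises [X] and so leaves
    more room for the gradient, of order [(1/r) (l / (G tau)) r^(m/q)], which must stay below
    [X^(s/st)]. As [r] tends to 0 this is a sign condition on one exponent, and the assumptions of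
    the theorem make it hold for [gam] slightly below [1/p]. *)

Definition bounded_measurable {d} {T : measurableType d} {R : realType} (f : T -> R) : Prop :=
  measurable_fun setT f /\ exists M : R, forall x, `|f x| <= M.

Section bounded_measurable_theory.
Context {d} {T : measurableType d} {R : realType}.
Implicit Types f g : T -> R.

Lemma bounded_measurable_cst (c : R) : bounded_measurable (fun _ : T => c).
Proof. by split; [exact: measurable_cst | exists `|c|]. Qed.

Lemma bounded_measurableD {f g} : bounded_measurable f -> bounded_measurable g ->
  bounded_measurable (fun x => f x + g x).
Proof.
move=> [mf [A fA]] [mg [B gB]]; split; first exact: measurable_funD.
by exists (A + B) => x; rewrite (le_trans (ler_normD _ _))// lerD.
Qed.

Lemma bounded_measurableM {f g} : bounded_measurable f -> bounded_measurable g ->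
  bounded_measurable (fun x => f x * g x).
Proof.
move=> [mf [A fA]] [mg [B gB]]; split; first exact: measurable_funM.
by exists (A * B) => x; rewrite normrM ler_pM.
Qed.

Lemma bounded_measurableN {f} : bounded_measurable f ->
  bounded_measurable (fun x => - f x).
Proof.
move=> [mf [A fA]]; split; first exact: measurableT_comp.
by exists A => x; rewrite normrN.
Qed.

Lemma bounded_measurableB {f g} : bounded_measurable f -> bounded_measurable g ->
  bounded_measurable (fun x => f x - g x).
Proof. by move=> bf bg; exact: bounded_measurableD bf (bounded_measurableN bg). Qed.

Lemma bounded_measurable_sum {I : Type} (r : seq I) (F : I -> T -> R) :
  (forall i, bounded_measurable (F i)) ->
  bounded_measurable (fun x => \sum_(i <- r) F i x).
Proof.
move=> bF; elim: r => [|i r IH].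
  under eq_fun do rewrite big_nil; exact: bounded_measurable_cst.
by under eq_fun do rewrite big_cons; exact: bounded_measurableD.
Qed.

Lemma bounded_measurable_prod {I : Type} (r : seq I) (F : I -> T -> R) :
  (forall i, bounded_measurable (F i)) ->
  bounded_measurable (fun x => \prod_(i <- r) F i x).
Proof.
move=> bF; elim: r => [|i r IH].
  under eq_fun do rewrite big_nil; exact: bounded_measurable_cst.
by under eq_fun do rewrite big_cons; exact: bounded_measurableM.
Qed.

Lemma bounded_measurable_comp {d'} {T' : measurableType d'} {f} {h : T' -> T} :
  bounded_measurable f -> measurable_fun setT h -> bounded_measurable (f \o h).
Proof.
move=> [mf [A fA]] mh; split; first exact: measurableT_comp.
by exists A => x; exact: fA.
Qed.

Context (mu : {measure set T -> \bar R}).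

Lemma bounded_measurable_integrableS {D f} : measurable D -> (mu D < +oo)%E ->
  bounded_measurable f -> mu.-integrable D (EFin \o f).
Proof.
move=> mD fD [mf [M fM]]; apply: measurable_bounded_integrable => //.
  exact: measurable_funTS.
exists M; split; first exact: num_real.
by move=> y My x _ /=; rewrite (le_trans (fM x))// ltW.
Qed.

Lemma bounded_measurable_integrable (P : probability T R) {f} :
  bounded_measurable f -> P.-integrable setT (EFin \o f).
Proof.
move=> bf; have [mf [M fM]] := bf; apply: measurable_bounded_integrable => //.
  by rewrite (@le_lt_trans _ _ 1%E)// ?ltry// probability_le1.
exists M; split; first exact: num_real.
by move=> y My x _ /=; rewrite (le_trans (fM x))// ltW.
Qed.

End bounded_measurable_theory.



(** * Translations of the circle *)

Section unit_interval.
Context {R : realType}.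
Local Notation U := (uniform_prob (@ltr01 R)).
Local Notation leb := (@lebesgue_measure R).

Definition fracp (x : R) : R := x - (Num.floor x)%:~R.

Lemma fracp_itv x : 0 <= fracp x < 1.
Proof.
have := floor_itv x; rewrite intrD => /andP[a b].
by rewrite /fracp subr_ge0 a/= ltrBlDl addrC addrC.
Qed.

Lemma fracpDz x (z : int) : fracp (x + z%:~R) = fracp x.
Proof. by rewrite /fracp floorDrz ?intr_int// intrKfloor intrD opprD addrACA subrr addr0. Qed.

Lemma fracp_id x : 0 <= x < 1 -> fracp x = x.
Proof.
move=> x01; rewrite /fracp (_ : Num.floor x = 0) ?subr0//.
by apply: floor_def; rewrite add0r.
Qed.

Lemma periodic1z {W : Type} (f : R -> W) : (forall x, f (x + 1) = f x) ->
  forall x (z : int), f (x + z%:~R) = f x.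
Proof.
move=> f1; have fn x (n : nat) : f (x + n%:R) = f x.
  elim: n x => [x|n IH x]; first by rewrite addr0.
  by rewrite -addn1 natrD addrA f1.
move=> x [n|n]; first exact: fn.
by rewrite NegzE mulrNz -[LHS](fn _ n.+1) -pmulrn subrK.
Qed.

Lemma integral_shift (g : R -> \bar R) (c : R) : measurable_fun setT g ->
  (forall x, (0 <= g x)%E) ->
  (\int[leb]_x g (x + c)%R = \int[leb]_x g x)%E.
Proof.
move=> mg g0.
have mc : measurable_fun setT ((fun x => x + c) : R -> R).
  by apply: measurable_funD.
pose mu0 := [the measure _ R of pushforward leb
     (fun x : measurableTypeR R => (x + c) : measurableTypeR R)].
pose mu := mu0 mc.
have E A : measurable A -> leb A = mu A.
  apply: lebesgue_measure_unique => X [[a b] /= _ <-].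
  rewrite /mu/= /pushforward (_ : _ @^-1` _ = `]a - c, b - c]%classic).
    by rewrite !lebesgue_measure_itv/= !lte_fin ltrBlDr subrK -!EFinD; congr (if _ then (_ %:E) else _); ring.
  by apply/seteqP; split => x /=; rewrite !in_itv/= ltrBlDr lerBrDr.
rewrite [RHS](eq_measure_integral mu)/=; last by move=> A mA _; exact: E.
by rewrite ge0_integral_pushforward//= ?preimage_setT.
Qed.

Lemma ge0_integral_U (f : R -> \bar R) : measurable_fun setT f ->
  (forall x, (0 <= f x)%E) ->
  (\int[U]_x f x = \int[leb]_(x in `[0%R, 1%R[) f x)%E.
Proof.
move=> mf f0; rewrite integral_uniform// subr0 invr1 mul1e.
by rewrite integral_itv_bndo_bndc//; exact: measurable_funTS.
Qed.

(** After reduction of [c] to its fractional part [e], the window [e, 1 + e) is cut at 1 and the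
    piece beyond 1 is moved back by periodicity. *)
Lemma ge0_integral_U_shift (f : R -> \bar R) (c : R) :
  measurable_fun setT f -> (forall x, (0 <= f x)%E) ->
  (forall x, f (x + 1) = f x) ->
  (\int[U]_x f (x + c)%R = \int[U]_x f x)%E.
Proof.
move=> mf f0 f1.
have /andP[c0 c1] := fracp_itv c.
transitivity (\int[U]_x f (x + fracp c)%R)%E.
  apply: eq_integral => x _.
  by rewrite -[RHS](periodic1z f f1 _ (Num.floor c)) /fracp addrA subrK.
have mD (e : R) : measurable_fun setT (fun x : R => f (x + e)).
  by apply: measurableT_comp => //; exact: measurable_funD.
rewrite !ge0_integral_U//; set e := fracp c in c0 c1 *.
have -> : (\int[leb]_(x in `[0%R, 1%R[) f ((x : R) + e)%R =
           \int[leb]_(x in `[e, (1 + e)%R[) f x)%E.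
  rewrite [LHS]integral_mkcond [RHS]integral_mkcond -[RHS](integral_shift _ e).
  - apply: eq_integral => x _; rewrite /patch.
    by rewrite !mem_setE !in_itv/= lerDr [x + e]addrC -[e + x]addrC ltrD2r.
  - by apply/measurable_restrict => //; exact: measurable_funTS.
  - by move=> x; rewrite /patch; case: ifP.
have U1 : `[e, 1 + e[%classic = `[e, 1[%classic `|` `[1, 1 + e[%classic.
  by rewrite -itv_bndbnd_setU// bnd_simp ?(ltW c1) // lerDl.
have U2 : `[0%R, 1[%classic = `[0%R, e[%classic `|` `[e, 1[%classic.
  by rewrite -itv_bndbnd_setU// bnd_simp ?(ltW c1).
have D (a b b' : R) : [disjoint `[a, b[%classic & `[b, b'[%classic].
  apply/disj_setPS => x /=; rewrite !in_itv/= => -[/andP[_ xb] /andP[bx _]].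
  by move: (lt_le_trans xb bx); rewrite ltxx.
rewrite U1 U2 !ge0_integral_setU//=; try by apply: measurable_funTS.
rewrite addeC; congr (_ + _)%E.
rewrite [LHS]integral_mkcond [RHS]integral_mkcond -[LHS](integral_shift _ 1).
- apply: eq_integral => x _; rewrite /patch f1.
  by rewrite !mem_setE !in_itv/= lerDr [1 + e]addrC ltrD2r.
- by apply/measurable_restrict => //; exact: measurable_funTS.
- by move=> x; rewrite /patch; case: ifP.
Qed.

End unit_interval.

(** * Integration over the torus along one coordinate *)

Section torus_fibers.
Context {R : realType}.
Local Notation U := (uniform_prob (@ltr01 R)).

Definition setk {d} (i : 'I_d) (t : R) (x : 'rV[R]_d) : 'rV[R]_d :=
  \row_l (if l == i then t else x 0 l).

Lemma setkE d (i : 'I_d) t x l :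
  setk i t x 0 l = if l == i then t else x 0 l.
Proof. by rewrite mxE. Qed.

Lemma setkD d (i : 'I_d) t c x :
  setk i t x + c *: basis_vec i = setk i (t + c) x.
Proof.
apply/rowP => l; rewrite !mxE eqxx/=.
by case: eqP => _; rewrite ?(mulr1, mulr0, addr0).
Qed.

Lemma setk_id d (i : 'I_d) (x : 'rV[R]_d) : setk i (x 0 i) x = x.
Proof. by apply/rowP => l; rewrite mxE; case: eqP => // ->. Qed.

Lemma measurable_setk d (i : 'I_d) :
  measurable_fun setT (fun z : measurableTypeR R * 'rV[R]_d => setk i z.1 z.2).
Proof.
apply: measurable_fun_rV => l; under eq_fun do rewrite setkE.
case: eqP => _; first exact: measurable_fst.
by apply: measurableT_comp (measurable_rV_coord l) _; exact: measurable_snd.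
Qed.

Lemma measurable_setk1 d (i : 'I_d) x :
  measurable_fun setT (fun t : measurableTypeR R => setk i t x).
Proof.
apply: measurable_fun_rV => l; under eq_fun do rewrite setkE.
by case: eqP => _; [exact: measurable_id | exact: measurable_cst].
Qed.

Lemma rV_cons0 n t (x : 'rV[R]_n) : rV_cons (t, x) 0 ord0 = t.
Proof.
rewrite /rV_cons (_ : ord0 = lshift n (ord0 : 'I_1)); last exact: val_inj.
by rewrite (row_mxEl (const_mx _ : 'rV[R]_1)) mxE.
Qed.

Lemma rV_consS n t (x : 'rV[R]_n) (l : 'I_n) :
  rV_cons (t, x) 0 (lift ord0 l) = x 0 l.
Proof.
rewrite /rV_cons (_ : lift ord0 l = rshift 1 l); last exact: val_inj.
by rewrite (row_mxEr (const_mx _ : 'rV[R]_1)).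
Qed.

Lemma ge0_integral_torusS n (F : 'rV[R]_n.+1 -> \bar R) :
  measurable_fun setT F -> (forall x, (0 <= F x)%E) ->
  (\int[torus n.+1]_x F x = \int[U]_t \int[torus n]_x F (rV_cons (t, x)))%E.
Proof.
move=> mF F0; rewrite /= ge0_integral_distribution//.
rewrite fubini_tonelli1//.
  by apply: measurableT_comp => //; exact: measurable_rV_cons.
by move=> z; exact: F0.
Qed.

(** The measure [torus d] is built by peeling off the first coordinate only. Averaging over an
    arbitrary coordinate [i] is reduced to Fubini at the first one by induction on the dimension. *)
Lemma ge0_integral_torus_resample d (i : 'I_d) (F : 'rV[R]_d -> \bar R) :
  measurable_fun setT F -> (forall x, (0 <= F x)%E) ->
  (\int[torus d]_x F x = \int[torus d]_x \int[U]_t F (setk i t x))%E.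
Proof.
elim: d i F => [[]//|n IH] i F mF F0.
have mG : measurable_fun setT (fun x => \int[U]_t F (setk i t x))%E.
  apply: (@measurable_fun_fubini_tonelli_G _ _ _ _ _ U
    (fun z : measurableTypeR R * 'rV[R]_n.+1 => F (setk i z.1 z.2))) => //.
  by apply: measurableT_comp => //; exact: measurable_setk.
have G0 x : (0 <= \int[U]_t F (setk i t x))%E by apply: integral_ge0 => t _; exact: F0.
rewrite (ge0_integral_torusS n F mF F0) (ge0_integral_torusS n _ mG G0).
case: (unliftP ord0 i) => [j|] ->.
  apply: eq_integral => a _; pose Fa y := F (rV_cons (a, y)).
  have mFa : measurable_fun setT Fa.
    apply: (measurableT_comp mF).
    by apply: measurableT_comp; [exact: measurable_rV_cons | exact: measurable_pair1].
  rewrite (IH j Fa mFa (fun y => F0 (rV_cons (a, y)))).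
  apply: eq_integral => x _; apply: eq_integral => t _; congr F.
  apply/rowP => l; rewrite [RHS]setkE; case: (unliftP ord0 l) => [k|] ->.
    by rewrite !rV_consS setkE (inj_eq (@lift_inj _ _)).
  by rewrite !rV_cons0.
have E (a t : R) x : setk ord0 t (rV_cons (a, x)) = rV_cons (t, x) :> 'rV[R]_n.+1.
  apply/rowP => l; rewrite setkE; case: (unliftP ord0 l) => [k|] -> /=.
    by rewrite !rV_consS.
  by rewrite rV_cons0.
under [RHS]eq_integral do under eq_integral do under eq_integral do rewrite E.
rewrite integral_cst//= probability_setT mule1.
apply: (fubini_tonelli (fun z : measurableTypeR R * 'rV[R]_n => F (rV_cons z))) => //.
by apply: measurableT_comp => //; exact: measurable_rV_cons.
Qed.

Lemma ge0_integral_torus_fiber d (i : 'I_d) (F G : 'rV[R]_d -> \bar R) :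
  measurable_fun setT F -> (forall x, (0 <= F x)%E) ->
  measurable_fun setT G -> (forall x, (0 <= G x)%E) ->
  (forall x, \int[U]_t F (setk i t x) = \int[U]_t G (setk i t x))%E ->
  (\int[torus d]_x F x = \int[torus d]_x G x)%E.
Proof.
move=> mF F0 mG G0 FG; rewrite (ge0_integral_torus_resample d i F mF F0).
rewrite [RHS](ge0_integral_torus_resample d i G mG G0).
by apply: eq_integral => x _; exact: FG.
Qed.

(** The bound [M] makes [H + M] nonnegative, so that the fibre comparison for nonnegative functions
    applies to [H + M] and the constant [M]. *)
Lemma integral_torus_fiber0 d (i : 'I_d) (H : 'rV[R]_d -> R) :
  bounded_measurable H -> (forall x, \int[U]_t H (setk i t x) = 0) ->
  \int[torus d]_x H x = 0.
Proof.
move=> bH H0; have [mH [M HM]] := bH.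
have ge0 x : 0 <= H x + M.
  by rewrite -lerBlDr sub0r; have := HM x; rewrite ler_norml => /andP[].
have I1 h : bounded_measurable h -> U.-integrable setT (EFin \o h).
  exact: bounded_measurable_integrable.
have I2 h : bounded_measurable h -> (torus d).-integrable setT (EFin \o h).
  exact: bounded_measurable_integrable.
have E : (\int[torus d]_x (H x + M)%:E = \int[torus d]_x M%:E)%E.
  have bM : bounded_measurable (fun x => H x + M).
    exact: bounded_measurableD bH (bounded_measurable_cst M).
  apply: (ge0_integral_torus_fiber d i) => //.
  - by apply/measurable_EFinP; case: bM.
  - move=> x; rewrite lee_fin; apply: le_trans (HM x); exact: normr_ge0.
  - move=> x; have bHx : bounded_measurable (fun t : measurableTypeR R => H (setk i t x)).
      exact: (bounded_measurable_comp bH (measurable_setk1 d i x)).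
    under eq_integral do rewrite EFinD.
    rewrite integralD//=; [|exact: I1|exact/I1/bounded_measurable_cst].
    rewrite -[X in (X + _)%E]fineK; last exact/integrable_fin_num/I1.
    by have := H0 x; rewrite /Rintegral => ->; rewrite add0e.
move: E; under eq_integral do rewrite EFinD.
rewrite integralD//=; [|exact: I2|exact/I2/bounded_measurable_cst].
rewrite integral_cst//= probability_setT mule1 /Rintegral.
by rewrite -[X in (X + _)%E]fineK; [rewrite -EFinD => -[] /eqP; rewrite -subr_eq0 addrK => /eqP|exact/integrable_fin_num/I2].
Qed.

Lemma periodicZ d {W : Type} (F : 'rV[R]_d -> W) (i : 'I_d) : periodic F ->
  forall x (z : int), F (x + z%:~R *: basis_vec i) = F x.
Proof.
move=> pF x z; have := periodic1z (fun t : R => F (x + t *: basis_vec i)).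
move=> /(_ _ 0 z); rewrite add0r scale0r addr0; apply => t.
by rewrite scalerDl scale1r addrA pF.
Qed.

(** On each line in direction [i] the displacement [c] is constant, so a shear acts there as a
    translation of the circle. This is why every transport step preserves measure. *)
Lemma ge0_integral_torus_shear d (i : 'I_d) (c : 'rV[R]_d -> R)
    (F : 'rV[R]_d -> \bar R) :
  measurable_fun setT c -> (forall t x, c (setk i t x) = c x) ->
  measurable_fun setT F -> (forall x, (0 <= F x)%E) -> periodic F ->
  (\int[torus d]_x F (x + c x *: basis_vec i)%R = \int[torus d]_x F x)%E.
Proof.
move=> mc ci mF F0 pF; apply: (ge0_integral_torus_fiber d i) => //.
  apply: measurableT_comp => //; apply: measurable_fun_rV => l.
  under eq_fun do rewrite 3!mxE; apply: measurable_funD; first exact: measurable_rV_coord.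
  exact: measurable_funM.
move=> x; have := ge0_integral_U_shift (fun t => F (setk i t x)) (c x).
under [in X in _ -> X]eq_integral do rewrite setkD ci.
apply => // [|t]; last by rewrite -setkD scale1r pF.
by apply: measurableT_comp => //; exact: measurable_setk1.
Qed.

Lemma integral_torus_shear d (i : 'I_d) (c : 'rV[R]_d -> R) (F : 'rV[R]_d -> R) :
  measurable_fun setT c -> (forall t x, c (setk i t x) = c x) ->
  measurable_fun setT F -> periodic F ->
  \int[torus d]_x F (x + c x *: basis_vec i) = \int[torus d]_x F x.
Proof.
move=> mc ci mF pF; rewrite /Rintegral; congr fine.
have mEF : measurable_fun setT (EFin \o F) by exact/measurable_EFinP.
rewrite [LHS]integralE [RHS]integralE; congr (_ - _)%E.
  rewrite -[RHS](ge0_integral_torus_shear d i c (EFin \o F)^\+%E)//.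
    by apply: eq_integral => x _; rewrite unlock.
    exact: measurable_funepos.
  by move=> x j; rewrite unlock/= pF.
rewrite -[RHS](ge0_integral_torus_shear d i c (EFin \o F)^\-%E)//.
  by apply: eq_integral => x _; rewrite unlock.
  exact: measurable_funeneg.
by move=> x j; rewrite unlock/= pF.
Qed.

Lemma ge0_integral_torus_prod d (g : 'I_d -> R -> R) (G : 'I_d -> R) :
  (forall l, measurable_fun setT (g l)) -> (forall l t, 0 <= g l t) ->
  (forall l, \int[U]_t (g l t)%:E = (G l)%:E)%E ->
  (\int[torus d]_x (\prod_l g l (x 0 l))%:E = (\prod_l G l)%:E)%E.
Proof.
elim: d g G => [|n IH] g G mg g0 gG.
  rewrite big_ord0; under eq_integral do rewrite big_ord0.
  by rewrite integral_cst//= diracT mule1.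
rewrite ge0_integral_torusS; first last.
- by move=> x; rewrite lee_fin; apply: prodr_ge0.
- apply/measurable_EFinP; apply: measurable_prod => l _.
  by apply: measurableT_comp => //; exact: measurable_rV_coord.
transitivity (\int[U]_t ((g ord0 t)%:E * (\prod_(l < n) G (lift ord0 l))%:E))%E.
  apply: eq_integral => t _.
  under eq_integral do rewrite big_ord_recl rV_cons0.
  under eq_integral do under eq_bigr do rewrite rV_consS.
  under eq_integral do rewrite EFinM.
  rewrite ge0_integralZl//=.
  - by rewrite (IH (fun l => g (lift ord0 l)) (fun l => G (lift ord0 l))).
  - apply/measurable_EFinP; apply: measurable_prod => l _.
    by apply: measurableT_comp => //; exact: measurable_rV_coord.
  - by move=> x _; rewrite lee_fin; apply: prodr_ge0.
  - by rewrite lee_fin; exact: g0.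
rewrite ge0_integralZr//=.
- by rewrite gG big_ord_recl EFinM.
- by apply/measurable_EFinP; exact: mg.
- by move=> t _; rewrite lee_fin; exact: g0.
- rewrite lee_fin; apply: prodr_ge0 => l _; rewrite -lee_fin -gG.
  by apply: integral_ge0 => t _; rewrite lee_fin; exact: g0.
Qed.

End torus_fibers.

(** * Calculus along lines *)

Section lines.
Context {R : realType} {W : normedModType R}.
Implicit Types (f : W -> R) (a v w : W).

Lemma is_derive_line f a v (t : R) : derivable f (a + t *: v) v ->
  is_derive t 1 (fun s : R => f (a + s *: v)) ('D_v f (a + t *: v)).
Proof.
move=> df; have E : (fun h : R => h^-1 *: (((fun s : R => f (a + s *: v)) \o shift t) (h *: 1)
      - f (a + t *: v))) =
    (fun h : R => h^-1 *: ((f \o shift (a + t *: v)) (h *: v) - f (a + t *: v))).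
  apply/funext => h /=; congr (_ *: (f _ - _)).
  by rewrite [h *: 1]mulr1 scalerDl addrCA addrA.
by constructor; rewrite /derivable /derive E.
Qed.

Lemma mean_value_unordered (F dF : R -> R) (b : R) :
  (forall t : R, is_derive t 1 F (dF t)) ->
  exists2 c, `|c| <= `|b| & F b - F 0 = dF c * b.
Proof.
move=> dFP; have cF : continuous F.
  by move=> t; apply: differentiable_continuous; apply/derivable1_diffP; have [] := dFP t.
have [b0|b0] := leP 0 b.
  have [|c] := MVT_segment b0 (fun x _ => dFP x).
    by apply: continuous_subspaceT => x; exact: cF.
  rewrite in_itv/= subr0 => /andP[c0 cb] ->; exists c => //.
  by rewrite !ger0_norm.
have [|c] := MVT_segment (ltW b0) (fun x _ => dFP x).
  by apply: continuous_subspaceT => x; exact: cF.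
rewrite in_itv/= sub0r => /andP[bc c0] E; exists c.
  by rewrite !ler0_norm ?lerN2// ltW.
by rewrite -opprB E mulrN opprK.
Qed.

(** [smooth] speaks of directional derivatives, so the chain rule in two directions is obtained by
    hand: the increment along [w] is expressed by the mean value theorem through ['D_w f] at an
    intermediate point [th h], and continuity of ['D_w f] gives the limit. *)
Lemma is_derive_line2 f a v w (c t : R) :
  (forall x, derivable f x v) -> (forall x, derivable f x w) ->
  continuous ('D_w f) ->
  let p := a + t *: v + (c * t) *: w in
  is_derive t 1 (fun s : R => f (a + s *: v + (c * s) *: w))
    ('D_v f p + c * 'D_w f p).
Proof.
move=> dv dw cw p; set g := fun s : R => _.
have [th thP] : {th : R -> R | forall h : R, `|th h| <= `|c * h| /\
    f (p + h *: v + (c * h) *: w) - f (p + h *: v) =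
    'D_w f (p + h *: v + th h *: w) * (c * h)}.
  suff /choice[th H] : forall h : R, exists th : R, `|th| <= `|c * h| /\
      f (p + h *: v + (c * h) *: w) - f (p + h *: v) =
      'D_w f (p + h *: v + th *: w) * (c * h) by exists th.
  move=> h; have [s|th thP E] := @mean_value_unordered
    (fun s => f (p + h *: v + s *: w)) (fun s => 'D_w f (p + h *: v + s *: w)) (c * h).
    exact: is_derive_line.
  by exists th; split => //; rewrite -E scale0r addr0.
have E : {near 0^', (fun h : R => h^-1 *: ((f \o shift p) (h *: v) - f p)
      + c * 'D_w f (p + h *: v + th h *: w)) =1
    (fun h : R => h^-1 *: ((g \o shift t) (h *: 1) - g t))}.
  near=> h; have h0 : h != 0 by near: h; exact: nbhs_dnbhs_neq.
  rewrite /= [h *: 1]mulr1 /g.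
  have -> : a + (h + t) *: v + (c * (h + t)) *: w = p + h *: v + (c * h) *: w.
    rewrite /p mulrDr !scalerDl -!addrA; congr (_ + _).
    rewrite [LHS]addrCA; congr (_ + _); rewrite addrCA; congr (_ + _); rewrite addrC.
    done.
  have [_] := thP h; move/(canRL (subrK _)) => ->.
  rewrite -addrA [h *: v + p]addrC [LHS]addrC -[RHS]/(h^-1 * _) -[h^-1 *: _]/(h^-1 * _) -/p.
  by field.
have L : (fun h : R => h^-1 *: ((g \o shift t) (h *: 1) - g t)) @ 0^' -->
    'D_v f p + c * 'D_w f p.
  apply: cvg_trans (near_eq_cvg E) _.
  apply: cvgD; first exact: dv.
  apply: cvgM; first exact: cvg_cst.
  apply: (@cvg_comp _ _ _ (fun h : R => p + h *: v + th h *: w) ('D_w f) _ (nbhs p)); last exact: cw.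
  suff : (fun h : R => p + h *: v + th h *: w) h @[h --> 0^'] --> p + 0 *: v + 0 *: w.
    by rewrite !scale0r !addr0.
  apply: cvgD; first apply: cvgD; first exact: cvg_cst.
    by apply: cvgZr_tmp; exact: nbhs_dnbhs.
  apply: cvgZr_tmp.
  have c0 : `|c * h| @[h --> 0^'] --> (0 : R).
    suff : `|c * h| @[h --> 0^'] --> `|c * 0| by rewrite mulr0 normr0.
    apply: cvg_norm; apply: cvgM; first exact: cvg_cst.
    exact: nbhs_dnbhs.
  apply/norm_cvg0P; apply: (squeeze_cvgr _ (cvg_cst 0) c0).
  by near=> h; rewrite normr_ge0/=; have [] := thP h.
constructor; first by apply/cvg_ex; eexists; exact: L.
exact: cvg_lim.
Unshelve. all: by end_near. Qed.

End lines.

Section FTC.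
Context {R : realType}.
Local Notation U := (uniform_prob (@ltr01 R)).
Local Notation leb := (@lebesgue_measure R).

Lemma Rintegral_derive (F f : R -> R) (a b : R) : a <= b ->
  (forall t : R, is_derive t 1 F (f t)) -> continuous f ->
  \int[leb]_(t in `[a, b]) f t = F b - F a.
Proof.
rewrite le_eqVlt => /predU1P[<- _ _|ab dF cf].
  by rewrite set_itv1 Rintegral_set1 subrr.
have cF : continuous F.
  by move=> t; apply: differentiable_continuous; apply/derivable1_diffP; have [] := dF t.
rewrite /Rintegral (@continuous_FTC2 _ f F)//.
- by apply: continuous_subspaceT => x; exact: cf.
- split; first by move=> x _; have [] := dF x.
  + by apply: cvg_at_right_filter; exact: cF.
  + by apply: cvg_at_left_filter; exact: cF.
- by move=> x _; rewrite derive1E; have [] := dF x.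
Qed.

Lemma Rintegral_U (f : R -> R) : measurable_fun setT f ->
  \int[U]_t f t = \int[leb]_(t in `[0, 1]) f t.
Proof.
move=> mf; rewrite /Rintegral; congr fine.
have mEf : measurable_fun setT (EFin \o f) by exact/measurable_EFinP.
rewrite [LHS]integralE [RHS]integralE; congr (_ - _)%E.
- rewrite integral_uniform// ?subr0 ?invr1 ?mul1e//; exact: measurable_funepos.
- rewrite integral_uniform// ?subr0 ?invr1 ?mul1e//; exact: measurable_funeneg.
Qed.

End FTC.

(** * Measurability of continuous functions *)

Section continuous_measurability.
Context {R : realType}.

Definition grid (n : nat) (t : R) : R := (Num.floor (t * n.+1%:R))%:~R / n.+1%:R.

Lemma grid_near n t : `|t - grid n t| <= n.+1%:R^-1.
Proof.
have n0 : (0 : R) < n.+1%:R by rewrite ltr0n.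
have := floor_itv (t * n.+1%:R); rewrite intrD => /andP[a b].
rewrite ler_norml; apply/andP; split.
  apply: (@le_trans _ _ 0); first by rewrite oppr_le0 invr_ge0 ltW.
  by rewrite subr_ge0 /grid ler_pdivrMr.
by rewrite lerBlDr /grid -[X in X + _]mul1r -mulrDl ler_pdivlMr// addrC ltW.
Qed.

Lemma measurable_floor_eq {d} {T : measurableType d} (h : T -> R) (k : int) (c : R) :
  measurable_fun setT h -> measurable [set z | Num.floor (h z * c) = k].
Proof.
move=> mh; rewrite (_ : [set z | _] = (fun z => h z * c) @^-1` `[k%:~R, (k + 1)%:~R[%classic).
  rewrite -[X in measurable X]setTI.
  have mhc : measurable_fun setT (fun z => h z * c) by exact: measurable_funM.
  by apply: mhc => //; exact: measurable_itv.
apply/seteqP; split => z /=; rewrite in_itv/= => H.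
  by rewrite -H floor_itv.
exact: floor_def.
Qed.

(** The sigma-algebra on row vectors is defined by the coordinates. Rounding the argument to the
    grid of mesh 1 / (n + 1) gives functions with countably many values on measurable cells, and
    they converge to [f] by continuity. *)
Lemma continuous_measurable_RrV d (f : R * 'rV[R]_d -> R) : continuous f ->
  measurable_fun setT (f : measurableTypeR R * 'rV[R]_d -> R).
Proof.
move=> cf; pose e n (z : R * 'rV[R]_d) : R * 'rV[R]_d :=
  (grid n z.1, \row_l grid n (z.2 0 l)).
apply: (@measurable_fun_cvg _ _ _ setT (fun n z => f (e n z))) => [n _ Y mY|z _].
  pose k (z : measurableTypeR R * 'rV[R]_d) : int * {ffun 'I_d -> int} :=
    (Num.floor (z.1 * n.+1%:R), [ffun l => Num.floor (z.2 0 l * n.+1%:R)]).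
  pose ev (w : int * {ffun 'I_d -> int}) : R * 'rV[R]_d :=
    (w.1%:~R / n.+1%:R, \row_l ((w.2 l)%:~R / n.+1%:R)).
  have ek z : e n z = ev (k z).
    by congr pair; apply/rowP => l; rewrite !mxE /= ffunE.
  rewrite setTI (_ : _ @^-1` Y = \bigcup_(w in [set w | Y (f (ev w))]) [set z | k z = w]).
    rewrite bigcup_mkcond; apply: countable_bigcupT_measurable => // w.
    case: ifP => // _.
    rewrite (_ : [set z | _] = [set z : measurableTypeR R * 'rV[R]_d | Num.floor (z.1 * n.+1%:R) = w.1] `&`
      \bigcap_(l in [set: 'I_d]) [set z : measurableTypeR R * 'rV[R]_d | Num.floor (z.2 0 l * n.+1%:R) = w.2 l]).
      apply: measurableI.
        by apply: measurable_floor_eq; exact: measurable_fst.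
      apply: fin_bigcap_measurable => // l _; apply: measurable_floor_eq.
      by apply: measurableT_comp (measurable_rV_coord l) _; exact: measurable_snd.
    apply/seteqP; split => [z <-|z [z1 z2]] /=.
      by split => // l _ /=; rewrite ffunE.
    case: w z1 z2 => w1 w2 /= z1 z2; congr pair; first exact: z1.
    by apply/ffunP => l; rewrite ffunE; exact: z2.
  apply/seteqP; split => [z /= Yz|z [w /= Yw kw]].
    by exists (k z) => //=; rewrite -ek.
  by rewrite /preimage/= ek kw.
apply: (cvg_comp (e ^~ z) f); last exact: cf.
apply/cvg_ballP => eps eps0.
have [N _ HN] := near_infty_natSinv_lt (PosNum eps0).
near=> n; have ne : n.+1%:R^-1 < eps by apply: HN; near: n; exact: nbhs_infty_ge.
split => /=; first by rewrite /ball/= (le_lt_trans (grid_near _ _)).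
split => // i j; rewrite [i]ord1 mxE /ball/=.
by rewrite (le_lt_trans (grid_near _ _)).
Unshelve. all: by end_near. Qed.

Lemma continuous_measurable_rV d (f : 'rV[R]_d -> R) : continuous f ->
  measurable_fun setT f.
Proof.
move=> cf; have mf : measurable_fun setT
    ((f \o snd) : measurableTypeR R * 'rV[R]_d -> R).
  apply: continuous_measurable_RrV => z.
  by apply: continuous_comp; [exact: cvg_snd | exact: cf].
exact: (measurableT_comp mf (measurable_pair1 (0 : measurableTypeR R))).
Qed.

Lemma continuous_measurable_R (f : R -> R) : continuous f -> measurable_fun setT f.
Proof. exact: continuous_measurable_fun. Qed.

End continuous_measurability.

Section periodic_functions.
Context {R : realType}.

Lemma periodic_fracp d {W : Type} (F : 'rV[R]_d -> W) : periodic F ->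
  forall x : 'rV[R]_d, F (\row_l fracp (x 0 l)) = F x.
Proof.
move=> pF x.
have H (r : seq 'I_d) y : F (y + \sum_(l <- r) (Num.floor (x 0 l))%:~R *: basis_vec l) = F y.
  elim: r y => [|l r IH] y; first by rewrite big_nil addr0.
  by rewrite big_cons addrA IH periodicZ.
rewrite -(H (index_enum _)); congr F; apply/rowP => l.
rewrite !mxE summxE (bigD1 l)//= big1 ?addr0 => [|j jl].
  by rewrite !mxE !eqxx mulr1 /fracp subrK.
by rewrite !mxE eqxx/= eq_sym (negbTE jl) mulr0.
Qed.

(** Periodicity brings [x] into the unit cube, and the product of the cube with [a, b] is
    compact. *)
Lemma continuous_periodic_bounded d (g : R * 'rV[R]_d -> R) (a b : R) :
  continuous g -> (forall t, periodic (fun x => g (t, x))) ->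
  exists2 M : R, 0 <= M & forall t x, a <= t <= b -> `|g (t, x)| <= M.
Proof.
move=> cg pg.
pose K := `[a, b]%classic `*` [set v : 'rV[R]_d | forall i, `[0, 1]%classic (v ord0 i)].
have cK : compact K.
  apply: compact_setX; first exact: segment_compact.
  apply: (@rV_compact R d (fun=> `[0, 1]%classic : set R)) => _.
  exact: segment_compact.
have : compact (g @` K).
  by apply: continuous_compact cK; apply: continuous_subspaceT => z; exact: cg.
move/compact_bounded => [M [Mr HM]].
exists (`|M| + 1) => [|t x tab]; first by rewrite addr_ge0.
rewrite -(periodic_fracp _ (fun x => g (t, x)) (pg t)).
apply: HM; first by rewrite (le_lt_trans (ler_norm _))// ltrDl.
exists (t, \row_l fracp (x 0 l)) => //; split => /=; first by rewrite in_itv.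
by move=> l; rewrite mxE in_itv/=; have /andP[-> /ltW ->] := fracp_itv (x 0 l).
Qed.

End periodic_functions.

Section test_functions.
Context {R : realType} {d : nat}.
Implicit Types (phi : R * 'rV[R]_d -> R) (psi : 'rV[R]_d -> R).

Lemma derive_periodic {V : normedModType R} (f : V -> R) (v e : V) :
  (forall x, f (x + e) = f x) -> forall x, 'D_v f (x + e) = 'D_v f x.
Proof.
move=> fe x; rewrite /derive.
suff -> : (fun h : R => h^-1 *: ((f \o shift (x + e)) (h *: v) - f (x + e))) =
    (fun h : R => h^-1 *: ((f \o shift x) (h *: v) - f x)) by [].
by apply/funext => h /=; rewrite addrA !fe.
Qed.

Lemma smooth_derive_continuous {V : normedModType R} (f : V -> R) v :
  smooth f -> continuous ('D_v f).
Proof. by move=> sf; have [] := sf [:: v]. Qed.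

Lemma smooth_continuous {V : normedModType R} (f : V -> R) :
  smooth f -> continuous f.
Proof. by move=> sf; have [] := sf [::]. Qed.

Lemma smooth_derivable {V : normedModType R} (f : V -> R) :
  smooth f -> forall x v, derivable f x v.
Proof. by move=> sf x v; have [_] := sf [::]; apply. Qed.

Lemma spacetime_periodic phi : (forall t, periodic (fun x => phi (t, x))) ->
  forall v t, periodic (fun x => 'D_v phi (t, x)).
Proof.
move=> pphi v t x i.
have := @derive_periodic _ phi v (0, basis_vec i) _ (t, x).
have -> : (t, x) + (0, basis_vec i) = (t, x + basis_vec i).
  by congr pair; rewrite /= ?addr0.
apply => -[s y]; rewrite -(pphi s y i); congr phi.
by congr pair; rewrite /= ?addr0.
Qed.

Lemma partial_periodic psi (i : 'I_d) : periodic psi -> periodic (partial i psi).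
Proof. by move=> ppsi x l; apply: derive_periodic => y; exact: ppsi. Qed.

Lemma is_derive_spacetime_line phi (i : 'I_d) (t0 c t : R) (x : 'rV[R]_d) :
  smooth phi ->
  is_derive t 1 (fun s : R => phi (t0 + s, x + (c * s) *: basis_vec i))
    (time_derive phi (t0 + t, x + (c * t) *: basis_vec i) +
     c * space_derive i phi (t0 + t, x + (c * t) *: basis_vec i)).
Proof.
move=> sphi.
have E s : (t0, x) + s *: (1, 0) + (c * s) *: (0, basis_vec i) =
    (t0 + s, x + (c * s) *: basis_vec i) :> R * 'rV[R]_d.
  congr pair => /=; first by rewrite scaler0 addr0 [s *: 1]mulr1.
  by rewrite scaler0 addr0.
rewrite -E (_ : (fun s : R => _) =
    (fun s : R => phi ((t0, x) + s *: (1, 0) + (c * s) *: (0, basis_vec i)))).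
  apply: is_derive_line2; try by move=> y; exact: smooth_derivable.
  exact: smooth_derive_continuous.
by apply/funext => s; rewrite E.
Qed.

End test_functions.

(** * Periodic cutoffs and boxes *)

Section cutoff.
Context {R : realType}.

(** A quadratic bound on the error treats piecewise polynomials such as [possq] uniformly, including
    the points where two pieces meet. *)
Lemma is_derive_quadratic (F : R -> R) (y D C : R) :
  (forall h, `|F (y + h) - F y - D * h| <= C * h ^+ 2) -> is_derive y 1 F D.
Proof.
move=> H.
have L : (fun h : R => h^-1 *: ((F \o shift y) (h *: 1) - F y)) @ 0^' --> D.
  apply/cvgrPdist_le => e e0; near=> h.
  have h0 : h != 0 by near: h; exact: nbhs_dnbhs_neq.
  rewrite /= [h *: 1]mulr1 [h + y]addrC.
  have -> : D - h^-1 *: (F (y + h) - F y) = - (h^-1 * (F (y + h) - F y - D * h)).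
    by rewrite -[h^-1 *: _]/(h^-1 * _); field.
  rewrite normrN normrM normfV ler_pdivrMl ?normr_gt0//.
  apply: le_trans (H h) _.
  rewrite -(real_normK (num_real h)) expr2 mulrCA ler_wpM2l// mulrC.
  have : `|h| <= e / (`|C| + 1).
    near: h; apply: dnbhs0_le; rewrite divr_gt0// ltr_pwDr//.
  rewrite ler_pdivlMr ?ltr_pwDr// => he.
  apply: le_trans he; rewrite ler_wpM2l// (le_trans (ler_norm _))// lerDl//.
constructor; first by apply/cvg_ex; eexists; exact: L.
exact: cvg_lim.
Unshelve. all: by end_near. Qed.

(** The square of the positive part is C^1, enough for a profile with a continuous first derivative,
    and it keeps the bounds on the cutoff polynomial inequalities. *)
Definition possq (y : R) : R := Num.max y 0 ^+ 2.

Lemma is_derive_possq (y : R) : is_derive y 1 possq (2 * Num.max y 0).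
Proof.
apply: (@is_derive_quadratic _ _ _ 1) => h; rewrite /possq mul1r ler_norml.
by case: (lerP y 0) => y0; case: (lerP (y + h) 0) => yh; apply/andP; split; nra.
Qed.

Lemma continuous_pos : continuous (fun y : R => Num.max y 0).
Proof. by move=> y; apply: continuous_max => //; exact: cst_continuous. Qed.

(* y (y - 1) / 2 is nonpositive on [0, 1] and at least 1 outside (-1, 2). *)
Definition beta (y : R) : R := possq (1 - possq (y * (y - 1) / 2)).

Definition dbeta (y : R) : R :=
  - 2 * Num.max (1 - possq (y * (y - 1) / 2)) 0 *
  Num.max (y * (y - 1) / 2) 0 * (2 * y - 1).

Lemma is_derive_beta (y : R) : is_derive y 1 beta (dbeta y).
Proof.
have d1 : is_derive y 1 (fun y : R => y * (y - 1) / 2) (y - 1 / 2).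
  apply: (@is_derive_quadratic _ _ _ 1) => h.
  have -> : (y + h) * (y + h - 1) / 2 - y * (y - 1) / 2 - (y - 1 / 2) * h = h ^+ 2 / 2 by field.
  by rewrite mul1r ger0_norm; nra.
have d2 := is_derive1_comp (is_derive_possq _) d1.
have d3 : is_derive y 1 (fun y : R => 1 - possq (y * (y - 1) / 2))
   (- (2 * Num.max (y * (y - 1) / 2) 0 * (y - 1 / 2))).
  have := is_deriveB (is_derive_cst (1 : R) y 1) d2.
  by rewrite sub0r.
have := is_derive1_comp (is_derive_possq _) d3.
by move=> /is_derive_eq; apply; rewrite /dbeta; field.
Qed.

Lemma continuous_possq : continuous possq.
Proof.
move=> y; apply: differentiable_continuous; apply/derivable1_diffP.
by have [] := is_derive_possq y.
Qed.

Lemma continuous_beta : continuous beta.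
Proof.
move=> y; apply: differentiable_continuous; apply/derivable1_diffP.
by have [] := is_derive_beta y.
Qed.

Lemma continuous_dbeta : continuous dbeta.
Proof.
have c1 : continuous (fun y : R => y * (y - 1) / 2).
  move=> y; apply: cvgM; last exact: cvg_cst.
  apply: cvgM; first exact: cvg_id.
  by apply: cvgB; [exact: cvg_id | exact: cvg_cst].
move=> y; apply: cvgM; last first.
  by apply: cvgB; [apply: cvgM; [exact: cvg_cst|exact: cvg_id] | exact: cvg_cst].
apply: cvgM.
  apply: cvgM; first exact: cvg_cst.
  apply: (@continuous_comp _ _ _ (fun y : R => 1 - possq (y * (y - 1) / 2)) (fun z : R => Num.max z 0)).
    apply: cvgB; first exact: cvg_cst.
    apply: (@continuous_comp _ _ _ (fun y : R => y * (y - 1) / 2) possq); first exact: c1.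
    exact: continuous_possq.
  exact: continuous_pos.
apply: (@continuous_comp _ _ _ (fun y : R => y * (y - 1) / 2) (fun z : R => Num.max z 0)); first exact: c1.
exact: continuous_pos.
Qed.

Lemma beta_ge0 y : 0 <= beta y. Proof. exact: sqr_ge0. Qed.

Lemma beta_le1 y : beta y <= 1.
Proof.
rewrite /beta /possq; set z := Num.max (y * _ / 2) 0 ^+ 2.
have z0 : 0 <= z by exact: sqr_ge0.
by case: (lerP (1 - z) 0) => h; nra.
Qed.

Lemma beta1 y : 0 <= y <= 1 -> beta y = 1.
Proof.
move=> /andP[y0 y1]; have h : y * (y - 1) / 2 <= 0 by nra.
by rewrite /beta /possq (max_idPr h) expr0n/= subr0 (max_idPl ler01) expr1n.
Qed.

Lemma beta_outside y : y <= -1 \/ 2 <= y ->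
  Num.max (1 - possq (y * (y - 1) / 2)) 0 = 0.
Proof.
move=> yo; apply/max_idPr; rewrite /possq.
have h : 1 <= y * (y - 1) / 2 by case: yo => yo; nra.
rewrite max_l; nra.
Qed.

Lemma beta0 y : y <= -1 \/ 2 <= y -> beta y = 0.
Proof. by move/beta_outside; rewrite /beta /possq => ->; rewrite expr0n. Qed.

Lemma dbeta0 y : y <= -1 \/ 2 <= y -> dbeta y = 0.
Proof. by move/beta_outside; rewrite /dbeta => ->; rewrite mulr0 !mul0r. Qed.

(** On [-1, 2] the factor [2 y - 1] is at most 3 in size and the two truncated factors lie in
    [0, 1], whence 6 = 2 * 3. *)
Lemma dbeta_le y : `|dbeta y| <= 6.
Proof.
have [y1|y1] := lerP y (-1); first by rewrite dbeta0 ?normr0//; left.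
have [y2|y2] := lerP 2 y; first by rewrite dbeta0 ?normr0//; right.
rewrite /dbeta /possq; set z := y * (y - 1) / 2.
have z1 : z <= 1 by rewrite /z; nra.
have a : 0 <= Num.max z 0 <= 1 by rewrite le_max lexx orbT ge_max z1 ler01.
have b : 0 <= Num.max (1 - Num.max z 0 ^+ 2) 0 <= 1.
  by rewrite le_max lexx orbT ge_max ler01 andbT; nra.
set p := Num.max z 0 in a b *; set q := Num.max _ 0 in b *.
have pq : 0 <= q * p <= 1 by nra.
have -> : - 2 * q * p * (2 * y - 1) = - 2 * (2 * y - 1) * (q * p) by ring.
move: (q * p) pq => w /andP[w0 w1].
by rewrite ler_norml; apply/andP; split; nra.
Qed.

Section rescale.
Context (r : R) (r0 : 0 < r) (r8 : r <= 1 / 8).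

(* z - floor (z + 1/2) is the representative of z mod 1 in [-1/2, 1/2). *)
Definition periodize (g : R -> R) (z : R) : R :=
  g ((z - (Num.floor (z + 1 / 2))%:~R) / r).

Lemma periodize_periodic g z : periodize g (z + 1) = periodize g z.
Proof.
rewrite /periodize (_ : z + 1 + 1 / 2 = z + 1 / 2 + 1%:~R); last by rewrite mulr1z; ring.
rewrite floorDrz ?intr_int// intrKfloor intrD mulr1z; congr (g (_ / _)); ring.
Qed.

(** Since [2 r <= 1 / 4], the rescaled [g] vanishes at distance 1/4 or more from 0. If [k] is not
    the nearest integer to [z], both sides are therefore 0. Near a given point one fixed [k] can
    thus be used, which makes [periodize g] locally a single rescaled copy of [g]. *)
Lemma periodizeE (g : R -> R) (z : R) (k : int) : (forall y, 2 <= `|y| -> g y = 0) ->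
  `|z - k%:~R| <= 3 / 4 -> periodize g z = g ((z - k%:~R) / r).
Proof.
move=> g0; rewrite /periodize; have := floor_itv (z + 1 / 2).
move: (Num.floor _) => j; rewrite intrD mulr1z => /andP[j1 j2] zk.
have [->//|jk] := eqVneq j k.
have far (x : R) : 1 / 4 <= `|x| -> g (x / r) = 0.
  have r4 : 2 * r <= 1 / 4 by have := r8; lra.
  move=> x4; apply: g0; rewrite normrM normfV [ `|r| ]gtr0_norm// ler_pdivlMr//.
  exact: le_trans r4 x4.
move: zk; rewrite ler_norml => /andP[k1 k2].
have [jk1|jk1] : j + 1 <= k \/ k + 1 <= j.
  by case: (ltgtP j k) jk => // + _; rewrite -lezD1; [left|right].
- have jk2 : j%:~R + 1 <= k%:~R :> R by rewrite -(mulr1z (1 : R)) -intrD ler_int.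
  rewrite !far//; first by rewrite ler0_norm; lra.
  by rewrite ger0_norm; lra.
- have jk2 : k%:~R + 1 <= j%:~R :> R by rewrite -(mulr1z (1 : R)) -intrD ler_int.
  rewrite !far//; first by rewrite ger0_norm; lra.
  by rewrite ler0_norm; lra.
Qed.

Lemma periodize_near (g : R -> R) (z0 : R) : (forall y, 2 <= `|y| -> g y = 0) ->
  \forall z \near z0, g ((z - (Num.floor (z0 + 1 / 2))%:~R) / r) = periodize g z.
Proof.
move=> g0; have e4 : 0 < (1 / 4 : R) by lra.
near=> z; apply/esym/periodizeE => //.
have zz0 : `|z0 - z| < 1 / 4 by near: z; exact: cvgr_dist_lt.
have := floor_itv (z0 + 1 / 2); rewrite intrD mulr1z => /andP[j1 j2].
move: zz0; rewrite ltr_norml ler_norml => /andP[a b]; apply/andP; split; lra.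
Unshelve. all: by end_near. Qed.

Lemma continuous_periodize (g : R -> R) : (forall y, 2 <= `|y| -> g y = 0) ->
  continuous g -> continuous (periodize g).
Proof.
move=> g0 cg z0; rewrite /continuous_at.
have := periodize_near g z0 g0 => near0.
rewrite -(nbhs_singleton near0); apply: cvg_trans (near_eq_cvg near0) _.
apply: (@continuous_comp _ _ _ (fun z : R => (z - (Num.floor (z0 + 1 / 2))%:~R) / r) g); last exact: cg.
apply: cvgM; last exact: cvg_cst.
by apply: cvgB; [exact: cvg_id | exact: cvg_cst].
Qed.

Definition cutoff := periodize beta.
Definition dcutoff z := periodize dbeta z / r.

Lemma beta_supp y : 2 <= `|y| -> beta y = 0.
Proof.
rewrite real_ler_normr ?num_real// => /orP[] h; apply: beta0; [right|left] => //; lra.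
Qed.

Lemma dbeta_supp y : 2 <= `|y| -> dbeta y = 0.
Proof.
rewrite real_ler_normr ?num_real// => /orP[] h; apply: dbeta0; [right|left] => //; lra.
Qed.

Lemma cutoff_periodic z : cutoff (z + 1) = cutoff z.
Proof. exact: periodize_periodic. Qed.

Lemma dcutoff_periodic z : dcutoff (z + 1) = dcutoff z.
Proof. by rewrite /dcutoff periodize_periodic. Qed.

Lemma continuous_cutoff : continuous cutoff.
Proof. exact: continuous_periodize beta_supp continuous_beta. Qed.

Lemma continuous_dcutoff : continuous dcutoff.
Proof.
move=> z; apply: cvgM; last exact: cvg_cst.
exact: continuous_periodize dbeta_supp continuous_dbeta z.
Qed.

Lemma is_derive_cutoff (z : R) : is_derive z 1 cutoff (dcutoff z).
Proof.
set k : R := (Num.floor (z + 1 / 2))%:~R.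
have d1 : is_derive z 1 (fun z : R => (z - k) / r) r^-1.
  apply: (@is_derive_quadratic _ _ _ 0) => h.
  by rewrite (_ : _ - _ = 0) ?normr0 ?mul0r//; field; rewrite gt_eqF.
have := is_derive1_comp (is_derive_beta _) d1.
rewrite -/(periodize dbeta z) -/(dcutoff z) => d2.
by apply: near_eq_is_derive d2; exact: periodize_near beta_supp.
Qed.

Lemma cutoff_ge0 z : 0 <= cutoff z. Proof. exact: beta_ge0. Qed.
Lemma cutoff_le1 z : cutoff z <= 1. Proof. exact: beta_le1. Qed.

Lemma dcutoff_le z : `|dcutoff z| <= 6 / r.
Proof. by rewrite /dcutoff normrM normfV [ `|r| ]gtr0_norm// ler_pM2r ?invr_gt0// dbeta_le. Qed.

Lemma cutoff1 z : fracp z < r -> cutoff z = 1.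
Proof.
have /andP[f0 f1] := fracp_itv z; have r8' := r8; move=> fr.
rewrite /cutoff (periodizeE _ _ (Num.floor z) beta_supp) -/(fracp z); last by rewrite ger0_norm; lra.
apply: beta1; apply/andP; split; first by rewrite divr_ge0// ltW.
by rewrite ler_pdivrMr// mul1r ltW.
Qed.

(** Modulo 1 the rescaled function lives on [-r, 2 r]; adding [r] moves this interval to [0, 3 r],
    where [fracp] can test it. *)
Lemma periodize_supp g z : (forall y, y <= -1 \/ 2 <= y -> g y = 0) ->
  3 * r <= fracp (z + r) -> periodize g z = 0.
Proof.
have [r0' r8'] := (r0, r8).
move=> g0 fr; apply: contrapT => b0.
rewrite /periodize in b0; move: b0; set k := Num.floor (z + 1 / 2) => b0.
have [y1|y1] := lerP ((z - k%:~R) / r) (-1); first by apply: b0; rewrite g0//; left.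
have [y2|y2] := lerP 2 ((z - k%:~R) / r); first by apply: b0; rewrite g0//; right.
move: y1 y2; rewrite ltr_pdivlMr// ltr_pdivrMr// => y1 y2.
move: fr; rewrite -(fracpDz _ (- k)) intrN fracp_id; first by lra.
by apply/andP; split; lra.
Qed.

Lemma cutoff0 z : 3 * r <= fracp (z + r) -> cutoff z = 0.
Proof. exact: periodize_supp beta0. Qed.

Lemma dcutoff0 z : 3 * r <= fracp (z + r) -> dcutoff z = 0.
Proof. by move=> h; rewrite /dcutoff (periodize_supp _ _ dbeta0 h) mul0r. Qed.

End rescale.
End cutoff.

(** * Boxes on the torus and their norms *)

Section boxes.
Context {R : realType}.
Local Notation U := (uniform_prob (@ltr01 R)).

Lemma measurable_fracp : measurable_fun setT (@fracp R).
Proof.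
apply: measurable_funB => // _ Y mY; rewrite setTI.
rewrite (_ : _ @^-1` Y = \bigcup_(k in [set k : int | Y k%:~R]) [set x : R | Num.floor (x * 1) = k]).
  rewrite bigcup_mkcond; apply: countable_bigcupT_measurable => // k.
  by case: ifP => // _; exact: measurable_floor_eq.
apply/seteqP; split => [x /= Yx|x [k /= Yk]]; last by rewrite mulr1 /preimage/= => ->.
by exists (Num.floor x) => //=; rewrite mulr1.
Qed.

Lemma measurable_lt_indicator {d} {T : measurableType d} (f : T -> R) (w : R) :
  measurable_fun setT f -> measurable_fun setT (fun x => (f x < w)%R%:R : R).
Proof.
move=> mf; have mb := measurable_fun_ltr mf (measurable_cst w).
have := measurable_fun_ifT mb (measurable_cst (1 : R)) (measurable_cst (0 : R)).
by apply: eq_measurable_fun => x _ /=; case: ifP.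
Qed.

Lemma integral_U_fracp (a w : R) : 0 <= w <= 1 ->
  (\int[U]_t ((fracp (t - a) < w)%R%:R)%:E = w%:E)%E.
Proof.
move=> /andP[w0 w1].
have mf : measurable_fun setT (fun t : R => ((fracp t < w)%R%:R)%:E : \bar R).
  by apply/measurable_EFinP; apply: measurable_lt_indicator; exact: measurable_fracp.
have := ge0_integral_U_shift (fun t : R => ((fracp t < w)%R%:R)%:E) (- a) mf.
move=> -> //; last by move=> x; rewrite -[x + 1]/(x + 1%:~R) fracpDz.
rewrite ge0_integral_U//.
transitivity (\int[@lebesgue_measure R]_(x in `[0%R, 1%R[) (\1_(`[0%R, w[%classic) x)%:E)%E.
  apply: eq_integral => x; rewrite inE/= in_itv/= => /andP[x0 x1].
  by rewrite fracp_id ?x0// indicE mem_setE in_itv/= x0.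
rewrite integral_indic//= (_ : _ `&` _ = `[0%R, w[%classic).
  by rewrite lebesgue_measure_itv/= lte_fin; case: ltgtP w0 => // [w0 _|<-]; rewrite ?sube0.
apply/seteqP; split => x /=; rewrite !in_itv/=; first by case.
by move=> /andP[x0 xw]; rewrite x0 xw (lt_le_trans xw w1).
Qed.

Context {d : nat}.
Implicit Types (lo x c : 'rV[R]_d) (w : 'I_d -> R).

(** Testing [fracp] of the offset makes the box half-open and lets it wrap around the torus; a width
    1 leaves the coordinate free. *)
Definition inbox lo w x : bool := [forall l, fracp (x 0 l - lo 0 l) < w l].
Definition ib lo w x : R := (inbox lo w x)%:R.

Lemma ibE lo w x : ib lo w x = \prod_l ((fracp (x 0 l - lo 0 l) < w l)%R)%:R.
Proof.
rewrite /ib /inbox; case: (boolP [forall l, _]) => [/forallP H|].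
  by rewrite big1// => l _; rewrite H.
by move=> /forallPn[l /negbTE H]; rewrite (bigD1 l)//= H mul0r.
Qed.

Lemma ib_ge0 lo w x : 0 <= ib lo w x. Proof. exact: ler0n. Qed.
Lemma bounded_measurable_fracp_lt (l : 'I_d) (a w : R) :
  bounded_measurable (fun x : 'rV[R]_d => (fracp (x 0 l - a) < w)%R%:R : R).
Proof.
split; last by exists 1 => x; case: (_ < _); rewrite ?normr0 ?normr1.
apply: measurable_lt_indicator; apply: measurableT_comp; first exact: measurable_fracp.
by apply: measurable_funB => //; exact: measurable_rV_coord.
Qed.

Lemma bounded_measurable_ib lo w : bounded_measurable (ib lo w).
Proof.
rewrite (_ : ib lo w = fun x => \prod_l ((fracp (x 0 l - lo 0 l) < w l)%R)%:R); last first.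
  by apply/funext => x; exact: ibE.
by apply: bounded_measurable_prod => l; exact: bounded_measurable_fracp_lt.
Qed.

Lemma ib_shift lo w x c : ib lo w (x + c) = ib (lo - c) w x.
Proof.
by rewrite !ibE; apply: eq_bigr => l _; rewrite !mxE opprB addrA addrAC.
Qed.

Lemma periodic_ib lo w : periodic (ib lo w).
Proof.
move=> x i; rewrite !ibE; apply: eq_bigr => l _; rewrite !mxE eqxx/=.
case: eqP => _; last by rewrite addr0.
by rewrite (addrAC (x 0 l)) (fracpDz _ 1).
Qed.

Lemma integral_ib lo w : (forall l, 0 <= w l <= 1) ->
  (\int[torus d]_x (ib lo w x)%:E = (\prod_l w l)%:E)%E.
Proof.
move=> w01; under eq_integral do rewrite ibE.
apply: (ge0_integral_torus_prod d (fun l t => ((fracp (t - lo 0 l) < w l)%R)%:R)) => [l|//|l].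
  apply: measurable_lt_indicator.
  by apply: measurableT_comp; [exact: measurable_fracp|exact: measurable_funB].
exact: integral_U_fracp.
Qed.

Lemma Rintegral_ib lo w : (forall l, 0 <= w l <= 1) ->
  \int[torus d]_x ib lo w x = \prod_l w l.
Proof. by move=> w01; rewrite /Rintegral integral_ib. Qed.

Lemma Lnorm_le_ib (f : 'rV[R]_d -> R) lo w (C p : R) : 0 < p -> 0 <= C ->
  (forall l, 0 <= w l <= 1) -> measurable_fun setT f ->
  (forall x, `|f x| <= C * ib lo w x) ->
  (Lnorm (torus d) p%:E (fun x => (f x)%:E) <= (C * (\prod_l w l) `^ p^-1)%:E)%E.
Proof.
move=> p0 C0 w01 mf fC; rewrite unlock.
have v0 : 0 <= \prod_l w l by apply: prodr_ge0 => l _; have /andP[] := w01 l.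
have -> : (C * (\prod_l w l) `^ p^-1)%:E = ((C `^ p * \prod_l w l)%:E `^ p^-1)%E.
  rewrite poweR_EFin powRM ?powR_ge0// -powRrM mulfV ?gt_eqF// powRr1//.
apply: gt0_ler_poweR; first by rewrite invr_ge0 ltW.
- by rewrite in_itv/= leey andbT; apply: integral_ge0 => x _; rewrite lee_fin powR_ge0.
- by rewrite in_itv/= leey andbT lee_fin mulr_ge0// powR_ge0.
rewrite EFinM -(integral_ib lo w w01) -ge0_integralZl//; last first.
- by rewrite lee_fin powR_ge0.
- by move=> x _; rewrite lee_fin ib_ge0.
- by apply/measurable_EFinP; case: (bounded_measurable_ib lo w).
apply: ge0_le_integral => //=.
- apply/measurable_EFinP; apply: (measurableT_comp (measurable_powR p)).
  exact: measurableT_comp.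
- apply/measurable_EFinP; apply: measurable_funM => //.
  by case: (bounded_measurable_ib lo w).
move=> x _; rewrite lee_fin.
have := fC x; rewrite /ib; case: inbox; rewrite ?mulr1 ?mulr0 => H.
  by apply: ge0_ler_powR; rewrite ?nnegrE// ltW.
have -> : f x = 0 by apply/eqP; rewrite -normr_le0.
by rewrite normr0 powR0// gt_eqF.
Qed.

Lemma Lnorm_le_cst (f : 'rV[R]_d -> R) (C p : R) : 0 < p -> 0 <= C ->
  measurable_fun setT f -> (forall x, `|f x| <= C) ->
  (Lnorm (torus d) p%:E (fun x => (f x)%:E) <= C%:E)%E.
Proof.
move=> p0 C0 mf fC.
have := @Lnorm_le_ib f 0 (fun=> 1) C p p0 C0 _ mf.
rewrite big1// powR1 mulr1; apply => [l|x]; first by rewrite ler01 lexx.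
rewrite ibE big1 ?mulr1// => l _.
by have /andP[_ ->] := fracp_itv (x 0 l - (0 : 'rV[R]_d) 0 l).
Qed.

End boxes.

(** * The shear profile and its weak derivatives *)

Section weak_derivatives.
Context {R : realType} {d : nat}.
Local Notation U := (uniform_prob (@ltr01 R)).
Implicit Types (x c : 'rV[R]_d).

Lemma bounded_measurable_periodic (f : 'rV[R]_d -> R) : continuous f -> periodic f ->
  bounded_measurable f.
Proof.
move=> cf pf; split; first exact: continuous_measurable_rV.
have [||M _ HM] := @continuous_periodic_bounded R d (f \o snd) 0 0.
- by move=> z; apply: continuous_comp; [exact: cvg_snd | exact: cf].
- by move=> t x i /=; exact: pf.
by exists M => x; apply: (HM 0 x); rewrite lexx.
Qed.

(** On each circle in direction [l] the derivative of the periodic function [f * psi] integrates to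
    0; the fibre lemma turns this into integration by parts on the torus. *)
Lemma weak_partial_fiber (l : 'I_d) (f g : 'rV[R]_d -> R) :
  bounded_measurable f -> bounded_measurable g -> periodic f ->
  (forall x (t : R), is_derive t 1 (fun s : R => f (setk l s x)) (g (setk l t x))) ->
  (forall x, continuous (fun t => g (setk l t x))) ->
  weak_partial l f g.
Proof.
move=> bf bg pf fg cg psi [sp pp].
have cp := smooth_continuous _ sp.
have cdp : continuous (partial l psi) := smooth_derive_continuous _ _ sp.
have bp := bounded_measurable_periodic psi cp pp.
have bdp := bounded_measurable_periodic _ cdp (partial_periodic psi l pp).
have b1 := bounded_measurableM bf bdp; have b2 := bounded_measurableM bg bp.
have sE x (t : R) : setk l t x = setk l 0 x + t *: basis_vec l by rewrite setkD add0r.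
have cs x : continuous (fun t : R => setk l t x).
  move=> t; under eq_fun do rewrite sE; rewrite sE.
  apply: cvgD; first exact: cvg_cst.
  by apply: cvgZr_tmp; exact: cvg_id.
have H0 : \int[torus d]_x (f x * partial l psi x + g x * psi x) = 0.
  apply: (integral_torus_fiber0 d l); first exact: bounded_measurableD.
  move=> x.
  have cf : continuous (fun t : R => f (setk l t x)).
    move=> t; apply: differentiable_continuous; apply/derivable1_diffP.
    by have [] := fg x t.
  have cpx (h : 'rV[R]_d -> R) : continuous h -> continuous (fun t : R => h (setk l t x)).
    by move=> ch t; apply: (continuous_comp (f := fun t : R => setk l t x)); [exact: cs|exact: ch].
  have cH : continuous (fun t : R => f (setk l t x) * partial l psi (setk l t x) +
      g (setk l t x) * psi (setk l t x)).
    move=> t; apply: cvgD; apply: cvgM.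
    - exact: cf.
    - exact: cpx.
    - exact: cg.
    - exact: cpx.
  rewrite Rintegral_U; last exact: continuous_measurable_R.
  have dF (t : R) : is_derive t 1 (fun t : R => f (setk l t x) * psi (setk l t x))
     (f (setk l t x) * partial l psi (setk l t x) + g (setk l t x) * psi (setk l t x)).
    have dpsi : is_derive t 1 (fun t : R => psi (setk l t x)) (partial l psi (setk l t x)).
      under eq_fun do rewrite sE; rewrite (sE x t) /partial.
      by apply: (@is_derive_line _ _ psi); exact: smooth_derivable.
    apply: is_derive_eq (is_deriveM (fg x t) dpsi) _.
    by rewrite -[_ *: _ + _ *: _]/(_ * _ + _ * _) [g _ * _]mulrC.
  rewrite (Rintegral_derive _ _ _ _ ler01 dF cH).
  by rewrite -[1]add0r -!setkD scale1r pf pp subrr.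
move: H0; rewrite RintegralD//; [|exact: bounded_measurable_integrable..].
by move/eqP; rewrite addr_eq0 => /eqP.
Qed.

Lemma prodr_le1 (I : Type) (s : seq I) (P : pred I) (F : I -> R) :
  (forall j, P j -> 0 <= F j <= 1) -> \prod_(j <- s | P j) F j <= 1.
Proof.
move=> h; rewrite -[leRHS](@big1_eq _ 1 *%R _ s P); exact: ler_prod.
Qed.

Section shear_profile.
Context (i : 'I_d) (c : 'rV[R]_d) (r : R) (r0 : 0 < r) (r8 : r <= 1 / 8).

(** Independence of the coordinate [i] makes [psi e_i] divergence-free, with a shear as its flow.
    The profile is 1 on the tube of width [r] at corner [c] and vanishes off the concentric tube of
    width [3 r]. *)
Definition psi x : R := \prod_l (if l == i then 1 else cutoff r (x 0 l - c 0 l)).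

(** For [k = i] the factor at [l == i] becomes 0: the profile has no derivative along its own
    tube. *)
Definition dpsi (k : 'I_d) x : R :=
  \prod_l (if l == i then (k != i)%:R else
           if l == k then dcutoff r (x 0 l - c 0 l) else cutoff r (x 0 l - c 0 l)).

Definition psi_supp : 'rV[R]_d -> R :=
  ib (c - const_mx r) (fun l => if l == i then 1 else 3 * r).

Lemma bounded_measurable_coord (l : 'I_d) (g : R -> R) (a : R) :
  continuous g -> (exists M, forall z, `|g z| <= M) ->
  bounded_measurable (fun x => g (x 0 l - a)).
Proof.
move=> cg gM; apply: (bounded_measurable_comp (f := g) (h := fun x => x 0 l - a)).
  by split => //; exact: continuous_measurable_R.
by apply: measurable_funB => //; exact: measurable_rV_coord.
Qed.

Lemma cutoff_bounded : exists M, forall z, `|cutoff r z| <= M.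
Proof. by exists 1 => z; rewrite ger0_norm ?cutoff_ge0 ?cutoff_le1. Qed.

Lemma dcutoff_bounded : exists M, forall z, `|dcutoff r z| <= M.
Proof. by exists (6 / r) => z; exact: dcutoff_le. Qed.

Lemma bounded_measurable_psi : bounded_measurable psi.
Proof.
apply: bounded_measurable_prod => l; case: eqP => _; first exact: bounded_measurable_cst.
by apply: bounded_measurable_coord; [exact: continuous_cutoff|exact: cutoff_bounded].
Qed.

Lemma bounded_measurable_dpsi k : bounded_measurable (dpsi k).
Proof.
apply: bounded_measurable_prod => l; case: eqP => _; first exact: bounded_measurable_cst.
case: eqP => _; apply: bounded_measurable_coord.
- exact: continuous_dcutoff.
- exact: dcutoff_bounded.
- exact: continuous_cutoff.
- exact: cutoff_bounded.
Qed.

Lemma psi_ge0 x : 0 <= psi x.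
Proof. by apply: prodr_ge0 => l _; case: eqP => // _; exact: cutoff_ge0. Qed.

Lemma psi_le1 x : psi x <= 1.
Proof.
apply: prodr_le1 => l _; case: eqP => _; first by rewrite ler01 lexx.
by rewrite cutoff_ge0 cutoff_le1.
Qed.

Lemma psi_setk t x : psi (setk i t x) = psi x.
Proof. by apply: eq_bigr => l _; case: eqP => // /eqP/negbTE il; rewrite setkE il. Qed.

Lemma psi_shift t x : psi (x + t *: basis_vec i) = psi x.
Proof. by rewrite -[in LHS](setk_id _ i x) setkD psi_setk. Qed.

Lemma periodic_psi : periodic psi.
Proof.
move=> x k; apply: eq_bigr => l _; rewrite !mxE eqxx/=; case: ifP => // _.
by case: (l == k); rewrite ?addr0// mulr1n (addrAC (x 0 l)) cutoff_periodic.
Qed.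

Lemma periodic_dpsi l : periodic (dpsi l).
Proof.
move=> x k; apply: eq_bigr => j _; rewrite !mxE eqxx/=; case: ifP => // _.
case: (j == k); rewrite ?addr0// mulr1n (addrAC (x 0 j)).
by rewrite cutoff_periodic dcutoff_periodic.
Qed.

Lemma outside_supp x : ~~ inbox (c - const_mx r) (fun l => if l == i then 1 else 3 * r) x ->
  exists2 l, l != i & 3 * r <= fracp (x 0 l - c 0 l + r).
Proof.
move=> /forallPn[l]; rewrite !mxE -leNgt.
rewrite (_ : x 0 l - (c 0 l - r) = x 0 l - c 0 l + r); last by ring.
case: eqP => [_|/eqP li H]; last by exists l.
by have /andP[_ /lt_le_trans H] := fracp_itv (x 0 l - c 0 l + r) => /H; rewrite ltxx.
Qed.

Lemma psi_le_supp x : `|psi x| <= psi_supp x.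
Proof.
rewrite /psi_supp /ib; case: (boolP (inbox _ _ _)) => [_|].
  by rewrite ger0_norm ?psi_ge0 ?psi_le1.
move=> /outside_supp[l li h]; rewrite /psi (bigD1 l)//= (negbTE li) cutoff0//.
by rewrite mul0r normr0.
Qed.

Lemma dpsi_le_supp k x : `|dpsi k x| <= 6 / r * psi_supp x.
Proof.
have r1 : 1 <= 6 / r by have [r0' r8'] := (r0, r8); rewrite ler_pdivlMr// mul1r; lra.
rewrite /psi_supp /ib; case: (boolP (inbox _ _ _)) => [_|].
  rewrite mulr1 normr_prod.
  have [->|ki] := eqVneq k i.
    rewrite (bigD1 i)//= !eqxx/= normr0 mul0r; exact: le_trans r1.
  rewrite (bigD1 k)//= (negbTE ki) eqxx -[leRHS]mulr1.
  apply: ler_pM => //; first exact: prodr_ge0.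
    exact: dcutoff_le.
  apply: prodr_le1 => l lk; rewrite normr_ge0/= (negbTE lk).
  by case: ifP => _; rewrite ?normr1// ger0_norm ?cutoff_ge0 ?cutoff_le1.
move=> /outside_supp[l li h]; rewrite mulr0 /dpsi (bigD1 l)//= (negbTE li).
by rewrite cutoff0// dcutoff0//; case: ifP => _; rewrite mul0r normr0.
Qed.

Lemma weak_partial_psi k : weak_partial k psi (dpsi k).
Proof.
apply: weak_partial_fiber.
- exact: bounded_measurable_psi.
- exact: bounded_measurable_dpsi.
- exact: periodic_psi.
- move=> x t; have [->|ki] := eqVneq k i.
    rewrite (_ : dpsi i _ = 0); last by rewrite /dpsi (bigD1 i)//= !eqxx mul0r.
    under eq_fun do rewrite psi_setk; exact: is_derive_cst.
  pose K : R := \prod_(l | l != k) (if l == i then 1 else cutoff r (x 0 l - c 0 l)).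
  have EK s : psi (setk k s x) = K * cutoff r (s - c 0 k).
    rewrite /psi (bigD1 k)//= (negbTE ki) setkE eqxx mulrC; congr (_ * _).
    by apply: eq_bigr => l lk; rewrite setkE (negbTE lk).
  under eq_fun do rewrite EK.
  have -> : dpsi k (setk k t x) = K * dcutoff r (t - c 0 k).
    rewrite /dpsi (bigD1 k)//= (negbTE ki) setkE eqxx mulrC; congr (_ * _).
    by apply: eq_bigr => l lk; rewrite setkE (negbTE lk).
  have d1 : is_derive t 1 (fun s : R => s - c 0 k) 1.
    apply: (@is_derive_quadratic _ _ _ _ 0) => h.
    by rewrite (_ : _ - _ = 0) ?normr0 ?mul0r//; ring.
  have := is_deriveZ K (is_derive1_comp (is_derive_cutoff r r0 r8 _) d1).
  by rewrite mulr1.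
- move=> x; have [->|ki] := eqVneq k i.
    rewrite (_ : (fun t => _) = cst 0); first exact: cst_continuous.
    by apply/funext => t; rewrite /dpsi (bigD1 i)//= !eqxx mul0r.
  pose K : R := \prod_(l | l != k) (if l == i then 1 else cutoff r (x 0 l - c 0 l)).
  rewrite (_ : (fun t => _) = fun t => K * dcutoff r (t - c 0 k)); last first.
    apply/funext => t.
    rewrite /dpsi (bigD1 k)//= (negbTE ki) setkE eqxx mulrC; congr (_ * _).
    by apply: eq_bigr => l lk; rewrite setkE (negbTE lk).
  move=> t; apply: cvgM; first exact: cvg_cst.
  apply: (continuous_comp (f := fun t : R => t - c 0 k)); last exact: continuous_dcutoff.
  by apply: cvgB; [exact: cvg_id | exact: cvg_cst].
Qed.

Lemma dpsi_dir x : dpsi i x = 0.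
Proof. by rewrite /dpsi (bigD1 i)//= !eqxx mul0r. Qed.

End shear_profile.
End weak_derivatives.

(** * Transport by shears *)

Section product_integrals.
Context {R : realType} {d : nat}.
Local Notation leb := (@lebesgue_measure R).
Local Notation tor := (@torus R d).
Implicit Types (H : measurableTypeR R * 'rV[R]_d -> R).

Lemma bounded_measurable_Rintegral H : bounded_measurable H ->
  bounded_measurable (fun t : measurableTypeR R => \int[tor]_x H (t, x)).
Proof.
move=> [mH [M HM]].
have bHt t : bounded_measurable (fun x => H (t, x)).
  split; last by exists M => x; exact: HM.
  exact: (measurableT_comp mH (measurable_pair1 t)).
split; last first.
  exists M => t; apply: le_trans (le_normr_Rintegral _ _) _ => //.
    exact: bounded_measurable_integrable.
  apply: le_trans (_ : \int[tor]_x M <= _); last first.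
    rewrite Rintegral_cst//= probability_setT mulr1//.
  apply: le_Rintegral => //.
  - apply: bounded_measurable_integrable; split.
      by apply: measurableT_comp => //; case: (bHt t).
    by exists M => x; rewrite normr_id HM.
  - exact/bounded_measurable_integrable/bounded_measurable_cst.
(* Measurability of fibre integrals is available for nonnegative integrands, hence the shift by [M],
   subtracted again in [E]. *)
have mF := @measurable_fun_fubini_tonelli_F _ _ _ _ R tor
  (fun z : measurableTypeR R * 'rV[R]_d => (H z + M)%:E).
have E : (fun t : measurableTypeR R => \int[tor]_x H (t, x)) =
    (fun t => fine (fubini_F tor (fun z => (H z + M)%:E) t) - M).
  apply/funext => t; rewrite /fubini_F.
  have -> : fine (\int[tor]_y (H (t, y) + M)%:E) = \int[tor]_y (H (t, y) + M) by [].
  rewrite RintegralD//; [|exact: bounded_measurable_integrable|].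
    by rewrite Rintegral_cst//= probability_setT mulr1 addrK.
  exact/bounded_measurable_integrable/bounded_measurable_cst.
rewrite E; apply: measurable_funB => //; apply: measurableT_comp => //.
apply: mF; first by apply/measurable_EFinP; exact: measurable_funD.
by move=> z; rewrite lee_fin -lerBlDr sub0r; have := HM z; rewrite ler_norml => /andP[].
Qed.

Lemma Rintegral_swap H (a b : R) : bounded_measurable H ->
  \int[leb]_(t in `[a, b]) \int[tor]_x H (t, x) =
  \int[tor]_x \int[leb]_(t in `[a, b]) H (t, x).
Proof.
move=> bH; have [mH [M HM]] := bH.
pose D : set (measurableTypeR R) := `[a, b]%classic.
have mD : measurable D by exact: measurable_itv.
have Dfin : (leb D < +oo)%E.
  by rewrite /D lebesgue_measure_itv/=; case: ifP => _; rewrite ?ltry// -EFinB ltry.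
have bHt t : bounded_measurable (fun x => H (t, x)).
  split; last by exists M => x; exact: HM.
  exact: (measurableT_comp mH (measurable_pair1 t)).
have bHx x : bounded_measurable (fun t : measurableTypeR R => H (t, x)).
  split; last by exists M => t; exact: HM.
  exact: (measurableT_comp mH (measurable_pair2 x)).
have bK : bounded_measurable (fun z : measurableTypeR R * 'rV[R]_d => H z * \1_D z.1).
  apply: bounded_measurableM => //; split.
    have mI : measurable_fun setT (\1_D : measurableTypeR R -> R) by exact: measurable_indic.
    exact: (measurableT_comp mI measurable_fst).
  by exists 1 => z; rewrite indicE; case: (_ \in _); rewrite ?normr1 ?normr0.
have iK : (leb \x tor)%E.-integrable setT (fun z : measurableTypeR R * 'rV[R]_d => (H z * \1_D z.1)%:E).
  apply/integrable12ltyP; first by apply/measurable_EFinP; case: bK.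
  apply: (@le_lt_trans _ _ (\int[leb]_t (`|M| * \1_D t)%:E)%E).
    apply: ge0_le_integral => //.
    - by move=> t _; apply: integral_ge0 => x _; rewrite lee_fin.
    - apply: (@measurable_fun_fubini_tonelli_F _ _ _ _ R tor
        (fun z : measurableTypeR R * 'rV[R]_d => `|(H z * \1_D z.1)%:E|)%E) => //.
      by apply: measurableT_comp => //; apply/measurable_EFinP; case: bK.
    - apply/measurable_EFinP; apply: measurable_funM => //; exact: measurable_indic.
    - move=> t _; apply: (@le_trans _ _ (\int[tor]_x (`|M| * \1_D t)%:E)%E); last first.
        by rewrite integral_cst//= probability_setT mule1.
      apply: ge0_le_integral => //.
      + apply: measurableT_comp => //; apply/measurable_EFinP.
        by case: bK => mK _; exact: (measurableT_comp mK (measurable_pair1 t)).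
      + by move=> x _; rewrite lee_fin normrM [X in _ * X]ger0_norm// ler_wpM2r// (le_trans (HM _))// ler_norm.
  under eq_integral do rewrite EFinM.
  rewrite ge0_integralZl//; last by apply/measurable_EFinP; exact: measurable_indic.
  by rewrite integral_indic// setIT lte_mul_pinfty.
have := Fubini (m1 := leb) (m2 := tor) iK; rewrite /= => F.
have L t : (\int[tor]_x (H (t, x) * \1_D t)%:E)%E = (\int[tor]_x H (t, x) * \1_D t)%:E.
  under eq_integral do rewrite EFinM.
  rewrite integralZr//; last exact: bounded_measurable_integrable.
  rewrite EFinM /Rintegral fineK//; apply: integrable_fin_num => //.
  exact: bounded_measurable_integrable.
have Rr x : (\int[leb]_t (H (t, x) * \1_D t)%:E)%E = (\int[leb]_(t in D) H (t, x))%:E.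
  rewrite /Rintegral fineK; last first.
    apply: integrable_fin_num => //.
    exact: bounded_measurable_integrableS.
  by rewrite [RHS]integral_mkcond epatch_indic; apply: eq_integral => t _; rewrite EFinM.
rewrite [LHS]/Rintegral [LHS]/= integral_mkcond epatch_indic.
under eq_integral do rewrite -[X in (X * _)%E]/((\int[tor]_x H (_, x))%:E) -EFinM -L.
by rewrite F; under eq_integral do rewrite Rr.
Qed.

End product_integrals.

Section transport.
Context {R : realType} {d : nat}.
Local Notation leb := (@lebesgue_measure R).
Local Notation tor := (@torus R d).

Lemma measurable_shear {d'} {T : measurableType d'} (i : 'I_d) (h : T -> 'rV[R]_d) (a : T -> R) :
  measurable_fun setT h -> measurable_fun setT a ->
  measurable_fun setT (fun z => h z + a z *: basis_vec i).
Proof.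
move=> mh ma; apply: measurable_fun_rV => l; under eq_fun do rewrite 3!mxE.
apply: measurable_funD; last exact: measurable_funM.
exact: (measurableT_comp (measurable_rV_coord l) mh).
Qed.

Context (i : 'I_d) (f g : 'rV[R]_d -> R) (phi : R * 'rV[R]_d -> R).
Hypotheses (bf : bounded_measurable f) (pf : periodic f).
Hypotheses (bg : bounded_measurable g) (pg : periodic g).
Hypothesis gi : forall t x, g (setk i t x) = g x.
Hypotheses (sphi : smooth phi) (pphi : forall t, periodic (fun x => phi (t, x))).

Let g_shift t x : g (x + t *: basis_vec i) = g x.
Proof. by rewrite -[in LHS](setk_id _ i x) setkD gi. Qed.

Lemma Rintegral_shear (a : R) (F : 'rV[R]_d -> R) : measurable_fun setT F -> periodic F ->
  \int[tor]_x F (x + (a * g x) *: basis_vec i) = \int[tor]_x F x.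
Proof.
move=> mF pF; apply: (integral_torus_shear _ i (fun x => a * g x) F) => // [|t x].
  by apply: measurable_funM => //; case: bg.
by rewrite gi.
Qed.

Definition material_derivative (z : R * 'rV[R]_d) : R :=
  time_derive phi z + g z.2 * space_derive i phi z.

(** The time density of the weak formulation while [f], given at time [t0], is carried by the
    stationary field [g e_i]. *)
Definition transport_rate (t0 t : R) : R :=
  \int[tor]_x (f (x - ((t - t0) * g x) *: basis_vec i) * material_derivative (t, x)).

Let mf : measurable_fun setT f. Proof. by case: bf. Qed.
Let mg : measurable_fun setT g. Proof. by case: bg. Qed.

Let cdt : continuous (time_derive phi).
Proof. exact: smooth_derive_continuous. Qed.
Let cdx : continuous (space_derive i phi).
Proof. exact: smooth_derive_continuous. Qed.

Lemma periodic_material_derivative t : periodic (fun x => material_derivative (t, x)).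
Proof.
move=> x k; rewrite /material_derivative/= pg.
by rewrite /time_derive /space_derive !(spacetime_periodic phi pphi).
Qed.

Lemma measurable_material_derivative :
  measurable_fun setT (material_derivative : measurableTypeR R * 'rV[R]_d -> R).
Proof.
apply: measurable_funD; first exact: continuous_measurable_RrV.
apply: measurable_funM; last exact: continuous_measurable_RrV.
exact: (measurableT_comp mg measurable_snd).
Qed.

(** The shear preserves measure and [g] is constant along it, so the motion can be shifted from [f],
    which is merely measurable, to the smooth test function. *)
Lemma transport_rateE (t0 t : R) : transport_rate t0 t =
  \int[tor]_x (f x * material_derivative (t, x + ((t - t0) * g x) *: basis_vec i)).
Proof.
rewrite /transport_rate.
rewrite -(Rintegral_shear (t - t0) (fun x => f (x - ((t - t0) * g x) *: basis_vec i) * material_derivative (t, x))).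
- by apply: eq_Rintegral => x _ /=; rewrite g_shift addrK.
- apply: measurable_funM.
    apply: (measurableT_comp mf); under eq_fun do rewrite -scaleNr.
    apply: measurable_shear => //; apply: measurableT_comp => //.
    exact: measurable_funM.
  exact: (measurableT_comp measurable_material_derivative (measurable_pair1 (t : measurableTypeR R))).
- by move=> x k; rewrite pg addrAC pf periodic_material_derivative.
Qed.

(** Once the motion is on the test function, the integrand at a fixed starting point is the time
    derivative of [f y * phi] along the trajectory of [y]. Exchanging the integrals leaves the
    fundamental theorem of calculus on each trajectory. *)
Lemma transport_identity (t0 tau : R) : 0 <= tau ->
  leb.-integrable `[t0, t0 + tau] (EFin \o transport_rate t0) /\
  \int[leb]_(t in `[t0, t0 + tau]) transport_rate t0 t =
    \int[tor]_x (f (x - (tau * g x) *: basis_vec i) * phi (t0 + tau, x)) -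
    \int[tor]_x (f x * phi (t0, x)).
Proof.
move=> tau0.
pose D : set (measurableTypeR R) := `[t0, t0 + tau]%classic.
have mD : measurable D by exact: measurable_itv.
have Dfin : (leb D < +oo)%E.
  by rewrite /D lebesgue_measure_itv/=; case: ifP => _; rewrite ?ltry// -EFinB ltry.
have mDi : measurable_fun setT (\1_D : measurableTypeR R -> R) by exact: measurable_indic.
pose S (z : measurableTypeR R * 'rV[R]_d) : measurableTypeR R * 'rV[R]_d :=
  (z.1, z.2 + ((z.1 - t0) * g z.2) *: basis_vec i).
have mS : measurable_fun setT S.
  apply/measurable_fun_pairP; split; first exact: measurable_fst.
  apply: measurable_shear; first exact: measurable_snd.
  apply: measurable_funM; last exact: (measurableT_comp mg measurable_snd).
  by apply: measurable_funB => //; exact: measurable_fst.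
(* The indicator confines [H] to the times at which the derivatives of [phi] have a common bound, so
   that [H] is bounded everywhere. *)
pose H (z : measurableTypeR R * 'rV[R]_d) : R := f z.2 * (material_derivative (S z) * \1_D z.1).
have bH : bounded_measurable H.
  apply: bounded_measurableM; first exact: (bounded_measurable_comp bf measurable_snd).
  split.
    apply: measurable_funM; first exact: (measurableT_comp measurable_material_derivative mS).
    exact: (measurableT_comp mDi measurable_fst).
  have [_ [M HM]] := bg.
  have [A A0 HA] := continuous_periodic_bounded _ _ t0 (t0 + tau) cdt (spacetime_periodic phi pphi _).
  have [B B0 HB] := continuous_periodic_bounded _ _ t0 (t0 + tau) cdx (spacetime_periodic phi pphi _).
  have M0 : 0 <= M by exact: le_trans (HM 0).
  exists (A + M * B) => -[t x]; rewrite indicE /= mem_setE in_itv/=.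
  case: (boolP (_ && _)) => tD; last by rewrite mulr0 normr0 addr_ge0// mulr_ge0.
  rewrite mulr1 (le_trans (ler_normD _ _))// lerD ?HA// normrM ler_pM//.
  exact: HB.
have GE (t : R) : t \in D -> transport_rate t0 t = \int[tor]_x H (t, x).
  by move=> tD; rewrite transport_rateE; apply: eq_Rintegral => x _; rewrite /H/= indicE tD mulr1.
split.
  apply: (eq_integrable mD (fun t : measurableTypeR R => (\int[tor]_x H (t, x))%:E)).
    by move=> t tD /=; rewrite GE.
  by apply: bounded_measurable_integrableS => //; exact: bounded_measurable_Rintegral.
transitivity (\int[leb]_(t in `[t0, (t0 + tau)]) \int[tor]_x H (t, x)).
  exact: eq_Rintegral.
rewrite (Rintegral_swap H t0 (t0 + tau) bH).
have E y : \int[leb]_(t in `[t0, (t0 + tau)]) H (t, y) =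
    f y * phi (t0 + tau, y + (tau * g y) *: basis_vec i) - f y * phi (t0, y).
  (* [x'] is the position at time 0 of the straight trajectory that is at [y] at time [t0]. *)
  pose x' := y - (g y * t0) *: basis_vec i.
  have x'E t : x' + (g y * t) *: basis_vec i = y + ((t - t0) * g y) *: basis_vec i.
    by rewrite /x' -addrA; congr (_ + _); rewrite -scaleNr -scalerDl; congr (_ *: _); ring.
  pose h t := f y * (time_derive phi (0 + t, x' + (g y * t) *: basis_vec i) +
       g y * space_derive i phi (0 + t, x' + (g y * t) *: basis_vec i)).
  have dF (t : R) : is_derive t 1 (fun t : R => f y * phi (0 + t, x' + (g y * t) *: basis_vec i)) (h t).
    exact: (is_deriveZ (f y) (is_derive_spacetime_line phi i 0 (g y) t x' sphi)).
  have cpath : continuous (fun t : R => (0 + t, x' + (g y * t) *: basis_vec i)).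
    have c1 : continuous (fun t : R => 0 + t).
      by move=> t; apply: cvgD; [exact: cvg_cst | exact: cvg_id].
    have c2 : continuous (fun t : R => x' + (g y * t) *: basis_vec i).
      move=> t; apply: cvgD; first exact: cvg_cst.
      by apply: cvgZr_tmp; apply: cvgM; [exact: cvg_cst | exact: cvg_id].
    by move=> t; exact: (cvg_pair (c1 t) (c2 t)).
  have ch : continuous h.
    move=> t; apply: cvgM; first exact: cvg_cst.
    apply: cvgD.
      by apply: (continuous_comp (g := time_derive phi)); [exact: cpath|exact: cdt].
    apply: cvgM; first exact: cvg_cst.
    by apply: (continuous_comp (g := space_derive i phi)); [exact: cpath|exact: cdx].
  transitivity (\int[leb]_(t in `[t0, (t0 + tau)]) h t).
    apply: eq_Rintegral => t tD.
    by rewrite /H /h indicE tD mulr1 /material_derivative/= g_shift add0r x'E.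
  have le0 : t0 <= t0 + tau by rewrite lerDl.
  rewrite (Rintegral_derive _ _ _ _ le0 dF ch) !x'E !add0r subrr mul0r scale0r addr0.
  by rewrite addrAC subrr add0r.
under eq_Rintegral do rewrite E.
have cphi := smooth_continuous _ sphi.
have mphi : measurable_fun setT (phi : measurableTypeR R * 'rV[R]_d -> R).
  exact: continuous_measurable_RrV.
have bphi t : bounded_measurable (fun x => phi (t, x)).
  split; first exact: (measurableT_comp mphi (measurable_pair1 (t : measurableTypeR R))).
  have [A A0 HA] := continuous_periodic_bounded _ _ t t cphi pphi.
  by exists A => x; apply: HA; rewrite lexx.
have mSt a : measurable_fun setT (fun x : 'rV[R]_d => x + (a * g x) *: basis_vec i).
  apply: measurable_shear => //; exact: measurable_funM.
rewrite RintegralB//; first last.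
- by apply: bounded_measurable_integrable; exact: bounded_measurableM.
- apply: bounded_measurable_integrable; apply: bounded_measurableM => //.
  exact: (bounded_measurable_comp (bphi _) (mSt tau)).
congr (_ - _).
rewrite -[RHS](Rintegral_shear tau (fun x => f (x - (tau * g x) *: basis_vec i) * phi (t0 + tau, x))).
- by apply: eq_Rintegral => x _; rewrite g_shift addrK.
- apply: measurable_funM; last by case: (bphi (t0 + tau)).
  apply: (measurableT_comp mf); under eq_fun do rewrite -scaleNr -mulNr.
  exact: mSt.
- by move=> x k; rewrite pg addrAC pf pphi.
Qed.

End transport.

(** * Programs of jumps and shears *)

Section programs.
Context {R : realType} {d : nat}.
Local Notation leb := (@lebesgue_measure R).
Local Notation tor := (@torus R d).
Implicit Types (f : 'rV[R]_d -> R) (x : 'rV[R]_d).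

(* The slot [S] stands for the jump that moves the amplitude [amp S] from a
   dyadic box of side [2 ^- lev S l] in direction [l] to its neighbour in
   direction [dir S]. *)
Record slot := Slot {
  amp : R; corner : 'rV[R]_d; lev : 'I_d -> nat; dir : 'I_d }.

Definition side (n : 'I_d -> nat) (l : 'I_d) : R := 2^-1 ^+ n l.

Definition vol (n : 'I_d -> nat) : R := \prod_l side n l.

Definition len (S : slot) : R := side (lev S) (dir S).

Definition slot_fun (S : slot) x : R :=
  amp S * (ib (corner S) (side (lev S)) (x - len S *: basis_vec (dir S)) -
           ib (corner S) (side (lev S)) x).

Definition mass (S : slot) : R := `|amp S| * vol (lev S).

(* [Jump S B]: the state jumps by [slot_fun S] and then rests, [B] bounds it
   before and after; [Shear i c r h Q]: the state is transported by the field
   [h * psi i c r] in direction [i], during a unit of the time allotted;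
   [Q] bounds the norms to the appropriate powers. *)
Inductive instr :=
  | Jump of slot & R
  | Shear of 'I_d & 'rV[R]_d & R & R & R.

Definition step : Type := R * instr.
Implicit Types (a : step) (P : seq step).

Definition direction a : 'I_d :=
  match a.2 with Jump J _ => dir J | Shear i _ _ _ _ => i end.

Definition speed a x : R :=
  match a.2 with Jump _ _ => 0 | Shear i c r h _ => h / a.1 * psi i c r x end.

Definition kick a f x : R :=
  match a.2 with Jump J _ => f x + slot_fun J x | Shear _ _ _ _ _ => f x end.

Definition rho1 a f (t : R) x : R :=
  kick a f (x - (t * speed a x) *: basis_vec (direction a)).

Definition vel1 (k : 'I_d) a f (t : R) x : R :=
  if k == direction a then speed a x else 0.

Definition dvel1 (k l : 'I_d) a f (t : R) x : R :=
  match a.2 with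
  | Jump _ _ => 0
  | Shear i c r h _ => if k == i then h / a.1 * dpsi i c r l x else 0
  end.

Definition bound1 a f (t : R) x : R :=
  match a.2 with Jump _ _ => 0 | Shear _ _ _ _ Q => Q end.

Definition rest1 a f (t : R) x : R :=
  match a.2 with Jump _ _ => 1 | Shear _ _ _ _ _ => 0 end.

Definition exec1 a f : 'rV[R]_d -> R := rho1 a f a.1.

Definition exec P f := foldl (fun g a => exec1 a g) f P.

Definition duration P : R := \sum_(a <- P) a.1.

(** State, velocity, derivative, bound and rest indicator are all read off from one-step functions
    [h] of a common type, at the step active at time [t]. Two programs can thus be said to agree at
    a time for every [h] at once. After the end the value is 0. *)
Fixpoint piece (h : step -> ('rV[R]_d -> R) -> R -> 'rV[R]_d -> R) P f t x : R :=
  if P is a :: P' then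
    if t < a.1 then h a f t x else piece h P' (exec1 a f) (t - a.1) x
  else 0.

Definition wf1 a : Prop := 0 < a.1 /\
  match a.2 with
  | Jump _ B => 0 <= B
  | Shear _ _ r _ Q => [/\ 0 < r, r <= 1 / 8 & 0 <= Q]
  end.

Fixpoint wf P : Prop := if P is a :: P' then wf1 a /\ wf P' else True.

Definition state f : Prop := bounded_measurable f /\ periodic f.

Lemma duration_cons a P : duration (a :: P) = a.1 + duration P.
Proof. by rewrite /duration big_cons. Qed.

Lemma duration_cat P1 P2 : duration (P1 ++ P2) = duration P1 + duration P2.
Proof. by rewrite /duration big_cat. Qed.

Lemma exec_cat P1 P2 f : exec (P1 ++ P2) f = exec P2 (exec P1 f).
Proof. by rewrite /exec foldl_cat. Qed.

Lemma side_gt0 n l : 0 < side n l. Proof. by rewrite exprn_gt0// invr_gt0. Qed.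

Lemma side_le1 n l : side n l <= 1.
Proof. by rewrite exprn_ile1// ?invr_ge0// invf_le1// ler1n. Qed.

Lemma side01 n l : 0 <= side n l <= 1.
Proof. by rewrite side_le1 ltW// side_gt0. Qed.

Lemma vol_gt0 n : 0 < vol n. Proof. by apply: prodr_gt0 => l _; exact: side_gt0. Qed.

Lemma mass_ge0 S : 0 <= mass S.
Proof. by rewrite mulr_ge0// ltW// vol_gt0. Qed.

Lemma state_slot_fun S : state (slot_fun S).
Proof.
split.
  apply: bounded_measurableM; first exact: bounded_measurable_cst.
  apply: bounded_measurableB; last exact: bounded_measurable_ib.
  apply: (bounded_measurable_comp (bounded_measurable_ib _ _)).
  under eq_fun do rewrite -scaleNr.
  by apply: measurable_shear => //; exact: measurable_id.
by move=> x k; rewrite /slot_fun addrAC !periodic_ib.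
Qed.

Lemma state_kick a f : state f -> state (kick a f).
Proof.
move=> sf; rewrite /kick; case: a.2 => // S B.
have [bf pf] := sf; have [bs ps] := state_slot_fun S.
by split; [exact: bounded_measurableD | move=> x k; rewrite pf ps].
Qed.

Lemma speed_spec a : wf1 a -> [/\ bounded_measurable (speed a), periodic (speed a) &
  forall t x, speed a (setk (direction a) t x) = speed a x].
Proof.
rewrite /wf1 /speed /direction; case: a.2 => [S B _|i c r h Q [a0 [r0 r8 _]]].
  by split => //; exact: bounded_measurable_cst.
split => [|x k|t x].
- apply: bounded_measurableM; first exact: bounded_measurable_cst.
  exact: bounded_measurable_psi.
- by rewrite periodic_psi.
- by rewrite psi_setk.
Qed.

Lemma state_rho1 a f t : wf1 a -> state f -> state (rho1 a f t).
Proof.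
move=> wa sf; have [bk pk] := state_kick a f sf; have [bv pv _] := speed_spec a wa.
split.
  apply: (bounded_measurable_comp bk); under eq_fun do rewrite -scaleNr.
  apply: measurable_shear => //.
  by apply: measurableT_comp => //; apply: measurable_funM => //; case: bv.
by move=> x k; rewrite /rho1 pv addrAC pk.
Qed.

Lemma state_exec1 a f : wf1 a -> state f -> state (exec1 a f).
Proof. exact: state_rho1. Qed.

Lemma measurable_piece h P f : wf P -> state f ->
  (forall a g, wf1 a -> state g ->
     measurable_fun setT (fun z : measurableTypeR R * 'rV[R]_d => h a g z.1 z.2)) ->
  measurable_fun setT (fun z : measurableTypeR R * 'rV[R]_d => piece h P f z.1 z.2).
Proof.
move=> + + mh; elim: P f => [|a P IH] f wP sf; first exact: measurable_cst.
have [wa wP'] := wP.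
apply: measurable_fun_ifT => /=.
- by apply: measurable_fun_ltr; [exact: measurable_fst | exact: measurable_cst].
- exact: mh.
- have mI : measurable_fun setT (fun z : measurableTypeR R * 'rV[R]_d =>
      ((z.1 - a.1, z.2) : measurableTypeR R * 'rV[R]_d)).
    apply/measurable_fun_pairP; split; last exact: measurable_snd.
    by apply: measurable_funB => //; exact: measurable_fst.
  apply: (measurableT_comp (IH (exec1 a f) _ _) mI); last exact: state_exec1.
  exact: wP'.
Qed.

Lemma periodic_piece h P f t : wf P -> state f ->
  (forall a g s, wf1 a -> state g -> periodic (h a g s)) ->
  periodic (piece h P f t).
Proof.
move=> + + ph; elim: P f t => [|a P IH] f t wP sf //= x k.
have [wa wP'] := wP.
rewrite (ph _ _ _ wa sf) IH//; last exact: state_exec1.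
Qed.

Lemma measurable_rho1 a f : wf1 a -> state f ->
  measurable_fun setT (fun z : measurableTypeR R * 'rV[R]_d => rho1 a f z.1 z.2).
Proof.
move=> wa sf; have [[mk _] _] := state_kick a f sf; have [[mv _] _ _] := speed_spec a wa.
apply: (measurableT_comp mk); under eq_fun do rewrite -scaleNr.
apply: measurable_shear; first exact: measurable_snd.
apply: measurableT_comp => //; apply: measurable_funM; first exact: measurable_fst.
exact: (measurableT_comp mv measurable_snd).
Qed.

Lemma measurable_vel1 k a f : wf1 a -> state f ->
  measurable_fun setT (fun z : measurableTypeR R * 'rV[R]_d => vel1 k a f z.1 z.2).
Proof.
move=> wa sf; have [[mv _] _ _] := speed_spec a wa; rewrite /vel1.
case: eqP => _; last exact: measurable_cst.
exact: (measurableT_comp mv measurable_snd).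
Qed.

Lemma measurable_dvel1 k l a f : wf1 a -> state f ->
  measurable_fun setT (fun z : measurableTypeR R * 'rV[R]_d => dvel1 k l a f z.1 z.2).
Proof.
rewrite /wf1 /dvel1; case: a.2 => [S B _ _|i c r h Q [_ [r0 r8 _]] _].
  exact: measurable_cst.
case: eqP => _; last exact: measurable_cst.
apply: measurable_funM => //; have [md _] := bounded_measurable_dpsi i c r r0 r8 l.
exact: (measurableT_comp md measurable_snd).
Qed.

Lemma periodic_vel1 k a f t : wf1 a -> periodic (vel1 k a f t).
Proof. by move=> /speed_spec[_ pv _] x j; rewrite /vel1 pv. Qed.

Lemma periodic_dvel1 k l a f t : wf1 a -> periodic (dvel1 k l a f t).
Proof.
rewrite /wf1 /dvel1 => -[_]; case: a.2 => // i c r h Q [r0 r8 _] x j.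
by rewrite periodic_dpsi.
Qed.

Lemma duration_ge0 P : wf P -> 0 <= duration P.
Proof.
elim: P => [_|a P IH [[a0 _] /IH]]; first by rewrite /duration big_nil.
by rewrite duration_cons => ?; rewrite addr_ge0// ltW.
Qed.

Lemma piece_cat h P1 P2 f t x : wf P1 -> 0 <= t ->
  piece h (P1 ++ P2) f t x =
  if t < duration P1 then piece h P1 f t x
  else piece h P2 (exec P1 f) (t - duration P1) x.
Proof.
elim: P1 f t => [|a P IH] f t wP t0.
  by rewrite /duration big_nil /= subr0 ltNge t0.
have [wa wP'] := wP; have D0 := duration_ge0 _ wP'.
rewrite duration_cons /=; have [ta|ta] := ltP t a.1.
  by rewrite (lt_le_trans ta)// lerDl.
by rewrite IH ?subr_ge0// ltrBlDl opprD addrA.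
Qed.

End programs.

(** * The weak formulation along a program *)

Section program_rates.
Context {R : realType} {d : nat}.
Local Notation leb := (@lebesgue_measure R).
Local Notation tor := (@torus R d).
Implicit Types (f : 'rV[R]_d -> R) (x : 'rV[R]_d) (S : @slot R d)
  (a : @step R d) (P : seq (@step R d)).

Definition jump_flux (p : R) a : R :=
  match a.2 with Jump J _ => mass J * len J `^ p^-1 | Shear _ _ _ _ _ => 0 end.

Definition flux (p : R) P : R := \sum_(a <- P) jump_flux p a.

Lemma jump_flux_ge0 p a : 0 <= jump_flux p a.
Proof.
rewrite /jump_flux; case: a.2 => // J _.
by rewrite mulr_ge0 ?powR_ge0 ?mass_ge0.
Qed.

Lemma len_le_powR p S : 1 <= p -> len S <= len S `^ p^-1.
Proof.
move=> p1; have l0 : 0 < len S by exact: side_gt0.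
apply: ger1_powR; first by rewrite l0 side_le1.
by rewrite invf_le1// (lt_le_trans ltr01).
Qed.

Context (phi : R * 'rV[R]_d -> R) (C : R) (T : R).
Hypotheses (sphi : smooth phi) (pphi : forall t, periodic (fun x => phi (t, x))).
Hypothesis phiC : forall k t x, 0 <= t <= T -> `|space_derive k phi (t, x)| <= C.

Let bphi t : bounded_measurable (fun x => phi (t, x)).
Proof.
have cphi := smooth_continuous _ sphi.
have mphi : measurable_fun setT (phi : measurableTypeR R * 'rV[R]_d -> R).
  exact: continuous_measurable_RrV.
split; first exact: (measurableT_comp mphi (measurable_pair1 (t : measurableTypeR R))).
have [A A0 HA] := continuous_periodic_bounded _ _ t t cphi pphi.
by exists A => x; apply: HA; rewrite lexx.
Qed.

(** Translating one of the two boxes onto the other turns the pairing into the integral over a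
    single box of a difference of [phi] at distance [len S]. *)
Lemma slot_pairing S t : 0 <= t <= T ->
  `|\int[tor]_x (slot_fun S x * phi (t, x))| <= C * (mass S * len S).
Proof.
move=> tT; pose e : 'rV[R]_d := basis_vec (dir S).
pose B := ib (corner S) (side (lev S)).
have bB : bounded_measurable B by exact: bounded_measurable_ib.
have l0 : 0 < len S by exact: side_gt0.
have sh (l : R) : measurable_fun setT (fun x : 'rV[R]_d => x + l *: e).
  by apply: measurable_shear.
have b1 : bounded_measurable (fun x => B (x - len S *: e) * phi (t, x)).
  apply: bounded_measurableM => //; apply: (bounded_measurable_comp bB).
  by under eq_fun do rewrite -scaleNr; exact: sh.
have b2 : bounded_measurable (fun x => B x * phi (t, x)) by exact: bounded_measurableM.
have b3 : bounded_measurable (fun x => B x * phi (t, x + len S *: e)).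
  by apply: bounded_measurableM => //; exact: (bounded_measurable_comp (bphi t) (sh (len S))).
have -> : \int[tor]_x (slot_fun S x * phi (t, x)) =
    amp S * \int[tor]_x (B x * (phi (t, x + len S *: e) - phi (t, x))).
  under eq_Rintegral do rewrite /slot_fun -mulrA mulrBl.
  under [in RHS]eq_Rintegral do rewrite mulrBr.
  rewrite RintegralZl//; last first.
    by apply: bounded_measurable_integrable; exact: bounded_measurableB.
  congr (_ * _); rewrite !RintegralB//; try exact: bounded_measurable_integrable.
  congr (_ - _).
  rewrite -(integral_torus_shear _ (dir S) (fun=> len S) (fun x => B (x - len S *: e) * phi (t, x)))//.
  - by apply: eq_Rintegral => x _; rewrite addrK.
  - by case: b1.
  - by move=> x k; rewrite addrAC pphi /B periodic_ib.
have lip x : `|phi (t, x + len S *: e) - phi (t, x)| <= C * len S.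
  have [s|c _ E] := @mean_value_unordered _ (fun s => phi (t, x + s *: e))
    (fun s => space_derive (dir S) phi (t, x + s *: e)) (len S).
    have := @is_derive_line _ _ phi (t, x) (0, e) s (smooth_derivable _ sphi _ _).
    have E (r : R) : (t, x) + r *: (0, e) = (t, x + r *: e).
      by congr pair; rewrite /= ?scaler0 ?addr0.
    rewrite E (_ : (fun s0 : R => _) = (fun s0 : R => phi (t, x + s0 *: e)))//.
    by apply/funext => r; rewrite E.
  move: E; rewrite scale0r addr0 => ->.
  by rewrite normrM [X in _ * X]gtr0_norm// ler_pM2r// phiC.
have -> : C * (mass S * len S) = `|amp S| * (vol (lev S) * (C * len S)).
  by rewrite /mass; ring.
rewrite normrM; apply: ler_wpM2l => //.
have iB : \int[tor]_x B x = vol (lev S) by apply: Rintegral_ib => l; exact: side01.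
have bm : bounded_measurable (fun x => B x * (phi (t, x + len S *: e) - phi (t, x))).
  by under eq_fun do rewrite mulrBr; exact: bounded_measurableB.
apply: le_trans (le_normr_Rintegral _ _) _ => //; first exact: bounded_measurable_integrable.
apply: (@le_trans _ _ (\int[tor]_x (B x * (C * len S)))); last first.
  by rewrite RintegralZr ?iB//; exact: bounded_measurable_integrable.
apply: le_Rintegral => //.
- apply: bounded_measurable_integrable; have [mm [M HM]] := bm.
  by split; [exact: measurableT_comp | exists M => x; rewrite normr_id].
- apply: bounded_measurable_integrable; apply: bounded_measurableM => //.
  exact: bounded_measurable_cst.
- by move=> x _; rewrite normrM ger0_norm ?ib_ge0// ler_wpM2l ?ib_ge0.
Qed.

(** The time density of the weak formulation along [P], started from [f] at time [t0]. *)
Definition rate P f (t0 t : R) : R :=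
  \int[tor]_x (piece rho1 P f (t - t0) x *
    (time_derive phi (t, x) +
     \sum_(k < d) piece (vel1 k) P f (t - t0) x * space_derive k phi (t, x))).

Lemma rate_head a P f t0 t : t - t0 < a.1 ->
  rate (a :: P) f t0 t = transport_rate (direction a) (kick a f) (speed a) phi t0 t.
Proof.
move=> ta; rewrite /rate /transport_rate; apply: eq_Rintegral => x _ /=.
rewrite ta /rho1; congr (_ * (_ + _)).
rewrite (bigD1 (direction a))//= big1 => [|k /negbTE ka].
  by rewrite /vel1 eqxx addr0.
by rewrite /vel1 ka mul0r.
Qed.

Lemma rate_tail a P f t0 t : a.1 <= t - t0 ->
  rate (a :: P) f t0 t = rate P (exec1 a f) (t0 + a.1) t.
Proof.
move=> ta; rewrite /rate; apply: eq_Rintegral => x _ /=.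
by rewrite ltNge ta/= opprD addrA.
Qed.

Lemma integrable_setU_disjoint (A B : set R) (h : R -> \bar R) :
  measurable A -> measurable B -> leb.-integrable A h -> leb.-integrable B h ->
  [disjoint A & B] -> leb.-integrable (A `|` B) h.
Proof.
move=> mA mB /integrableP[mAh iA] /integrableP[mBh iB] AB; apply/integrableP.
have mh : measurable_fun (A `|` B) h by apply/measurable_funU.
split => //; rewrite ge0_integral_setU//; last exact: measurableT_comp.
exact: lte_add_pinfty.
Qed.

Lemma kick_pairing p a f t : 1 <= p -> 0 <= C -> state f -> 0 <= t <= T ->
  `|\int[tor]_x (kick a f x * phi (t, x)) - \int[tor]_x (f x * phi (t, x))| <=
  C * jump_flux p a.
Proof.
move=> p1 C0 [bf _] tT; rewrite /kick /jump_flux; case: a.2 => [J B|_ _ _ _ _]; last first.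
  by rewrite subrr normr0 mulr0.
under eq_Rintegral do rewrite mulrDl.
have [bs _] := state_slot_fun J.
rewrite RintegralD//; try by apply: bounded_measurable_integrable; exact: bounded_measurableM.
rewrite addrAC subrr add0r; apply: le_trans (slot_pairing J t tT) _.
by rewrite ler_wpM2l// ler_wpM2l ?mass_ge0// len_le_powR.
Qed.

(** After its initial kick each step satisfies the transport identity exactly. The boundary terms
    telescope over the steps and leave only the pairings of the kicks with [phi]. *)
Lemma rate_estimate p P f t0 : 1 <= p -> 0 <= C -> wf P -> state f -> 0 <= t0 ->
  t0 + duration P <= T ->
  leb.-integrable `[t0, t0 + duration P[ (EFin \o rate P f t0) /\
  `|\int[leb]_(t in `[t0, (t0 + duration P)[) rate P f t0 t -
    (\int[tor]_x (exec P f x * phi (t0 + duration P, x)) -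
     \int[tor]_x (f x * phi (t0, x)))| <= C * flux p P.
Proof.
move=> p1 C0; elim: P f t0 => [|a P IH] f t0 wP sf t00 tT.
  rewrite /flux /duration !big_nil addr0 mulr0 /= subrr subr0 normr_le0.
  rewrite set_itvco0.
  by split; [exact: integrable_set0 | rewrite Rintegral_set0].
have [wa wP'] := wP; have a0 : 0 < a.1 by case: wa.
have D0 := duration_ge0 _ wP'.
rewrite duration_cons addrA in tT *; set t1 := t0 + a.1; set D := duration P.
have t01 : t0 <= t1 by rewrite lerDl ltW.
have t1T : t1 <= T by rewrite (le_trans _ tT)// lerDl.
have [iB eB] := IH (exec1 a f) t1 wP' (state_exec1 _ _ wa sf) (le_trans t00 t01) tT.
have [bv pv gv] := speed_spec a wa; have [bk pk] := state_kick a f sf.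
have [iA eA] := transport_identity (direction a) (kick a f) (speed a) phi bk pk bv pv gv
  sphi pphi t0 a.1 (ltW a0).
have iA' : leb.-integrable `[t0, t1[ (EFin \o transport_rate (direction a) (kick a f) (speed a) phi t0).
  by apply: integrableS iA => //; apply: subset_itvl; rewrite bnd_simp.
have hA t : t \in `[t0, t1[%classic ->
    rate (a :: P) f t0 t = transport_rate (direction a) (kick a f) (speed a) phi t0 t.
  by rewrite inE/= in_itv/= => /andP[_ tt]; rewrite rate_head// ltrBlDl.
have hB t : t \in `[t1, (t1 + D)[%classic -> rate (a :: P) f t0 t = rate P (exec1 a f) t1 t.
  by rewrite inE/= in_itv/= => /andP[tt _]; rewrite rate_tail// lerBrDl.
have iA2 : leb.-integrable `[t0, t1[ (EFin \o rate (a :: P) f t0).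
  by apply: eq_integrable iA' => // t /hA /= ->.
have iB2 : leb.-integrable `[t1, (t1 + D)[ (EFin \o rate (a :: P) f t0).
  by apply: eq_integrable iB => // t /hB /= ->.
have dAB : [disjoint `[t0, t1[%classic & `[t1, (t1 + D)[%classic].
  apply/disj_setPS => x /=; rewrite !in_itv/= => -[/andP[_ xb] /andP[bx _]].
  by move: (lt_le_trans xb bx); rewrite ltxx.
have U1 : `[t0, (t1 + D)[%classic = `[t0, t1[%classic `|` `[t1, (t1 + D)[%classic.
  by rewrite -itv_bndbnd_setU// bnd_simp// lerDl.
have iU : leb.-integrable (`[t0, t1[%classic `|` `[t1, (t1 + D)[%classic) (EFin \o rate (a :: P) f t0).
  exact: integrable_setU_disjoint.
rewrite U1; split => //; rewrite Rintegral_setU//.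
have EA : \int[leb]_(t in `[t0, t1[) rate (a :: P) f t0 t =
    \int[leb]_(t in `[t0, t1[) transport_rate (direction a) (kick a f) (speed a) phi t0 t.
  exact: eq_Rintegral.
have EB : \int[leb]_(t in `[t1, (t1 + D)[) rate (a :: P) f t0 t =
    \int[leb]_(t in `[t1, (t1 + D)[) rate P (exec1 a f) t1 t.
  exact: eq_Rintegral.
have eA' : \int[leb]_(t in `[t0, t1])
      transport_rate (direction a) (kick a f) (speed a) phi t0 t =
    \int[tor]_x (exec1 a f x * phi (t1, x)) - \int[tor]_x (kick a f x * phi (t0, x)).
  exact: eA.
rewrite EA EB (Rintegral_itv_bndo_bndc iA') eA'.
have K := kick_pairing p a f t0 p1 C0 sf _; rewrite {}/flux big_cons mulrDr -/(flux p P) /=.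
rewrite -/(exec P (exec1 a f)); rewrite -/t1 in eB *.
set X0 := \int[tor]_x (f x * _) in K *; set X1 := \int[tor]_x (kick a f x * _) in K *.
set X2 := \int[tor]_x (exec1 a f x * _) in eB *; set X3 := \int[tor]_x (exec P _ x * _) in eB *.
set Y := Rintegral _ _ _ in eB *.

have {}K : `|X1 - X0| <= C * jump_flux p a by apply: K; rewrite t00 (le_trans t01).
clearbody X0 X1 X2 X3 Y.
have -> : X2 - X1 + Y - (X3 - X0) = (Y - (X3 - X2)) - (X1 - X0) by ring.
by apply: (le_trans (ler_normB _ _)); rewrite addrC; exact: lerD.
Qed.

End program_rates.

(** * Thin tubes *)

Section exec_lemmas.
Context {R : realType} {d : nat}.
Implicit Types (f : 'rV[R]_d -> R) (x : 'rV[R]_d) (S : @slot R d) (P : seq (@step R d)).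

Lemma exec1_jump t S B f : exec1 (t, Jump S B) f = fun x => f x + slot_fun S x.
Proof. by apply/funext => x; rewrite /exec1 /rho1 /kick /speed/= mulr0 scale0r subr0. Qed.

Lemma exec1_shear t i c r h Q f : t != 0 ->
  exec1 (t, Shear i c r h Q) f = fun x => f (x - (h * psi i c r x) *: basis_vec i).
Proof.
move=> t0; apply/funext => x; rewrite /exec1 /rho1 /kick /speed /direction/=.
by congr (f (_ - _ *: _)); field.
Qed.

(** The duration 1 and the bound 0 are placeholders; [fill] sets the actual values. *)
Definition jumps (s : seq (@slot R d)) : seq (@step R d) :=
  [seq (1, Jump J 0) | J <- s].

Lemma exec_jumps s f : exec (jumps s) f = fun x => f x + \sum_(J <- s) slot_fun J x.
Proof.
elim: s f => [|S s IH] f.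
  by apply/funext => x; rewrite big_nil addr0.
rewrite /exec /= -/(exec _ _) exec1_jump IH.
by apply/funext => x; rewrite big_cons addrA.
Qed.

Lemma exec_cons (a : @step R d) P f : exec (a :: P) f = exec P (exec1 a f).
Proof. by []. Qed.

End exec_lemmas.

Section tube.
Context {R : realType} {d : nat}.
Context (i j : 'I_d) (ji : j != i) (lo : 'rV[R]_d) (n : 'I_d -> nat) (N : nat).
Hypothesis nN : forall l, l != i -> n l = N.
Local Notation r := ((2^-1 : R) ^+ N).
Hypothesis r8 : r <= 1 / 8.
Context (a : R) (G : nat) (G0 : (0 < G)%N).
Implicit Types (f : 'rV[R]_d -> R) (x : 'rV[R]_d).
Let e := @basis_vec R d i.
Let e' := @basis_vec R d j.

Definition tube_slot : slot := Slot a lo n i.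
Let l := len tube_slot.
Definition tube_shift : R := l / G%:R.
Let del := tube_shift.
Let B (y : 'rV[R]_d) := ib y (side n).
Let y k : 'rV[R]_d := lo + (k%:R * del) *: e.

(** Two consecutive jumps of length [r] connect each box with its copy at distance [2 r] in
    direction [j]. That copy occupies [-2 r, -r) in this coordinate, just below the support
    [-r, 2 r] of the profile; a single jump would end inside the support. *)
Definition hops (b : R) : seq slot :=
  flatten [seq [:: Slot b (y k - (2 * r) *: e') n j; Slot b (y k - r *: e') n j] | k <- iota 0 G].

(** The [G] boxes keep the full length [l] and overlap, each being the previous one moved by [del];
    only so does the shift by [del] telescope. *)
Definition train x : R := \sum_(0 <= k < G) a * B (y k) x.
Definition side_train x : R := \sum_(0 <= k < G) a * B (y k - (2 * r) *: e') x.

Lemma sum_hops b x : \sum_(J <- hops b) slot_fun J x =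
  \sum_(0 <= k < G) (b * B (y k) x - b * B (y k - (2 * r) *: e') x).
Proof.
rewrite /hops big_flatten big_map /index_iota subn0; apply: eq_bigr => k _.
rewrite !big_cons big_nil /= addr0 /slot_fun /len/=.
have -> : side n j = r by rewrite /side nN.
rewrite -!mulrBr -mulrDr; congr (_ * _); rewrite !ib_shift -/(B _) !opprK.
have -> : y k - (2 * r) *: e' + r *: basis_vec j = y k - r *: e'.
  by rewrite -/e' mulrDl mul1r scalerDl opprD addrA addrNK.
have -> : y k - r *: e' + r *: basis_vec j = y k by rewrite addrNK.
by rewrite addrC addrA subrK.
Qed.

Lemma sum_hopsE x : \sum_(J <- hops a) slot_fun J x = train x - side_train x.
Proof. by rewrite sum_hops sumrB. Qed.

Lemma sum_hopsN x : \sum_(J <- hops (- a)) slot_fun J x = side_train x - train x.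
Proof.
rewrite sum_hops -opprB -[in RHS]sumrB -sumrN; apply: eq_bigr => k _.
by rewrite !mulNr opprB opprK addrC.
Qed.

Let r0 : 0 < r. Proof. by rewrite exprn_gt0// invr_gt0. Qed.

(** Inside the tube the profile is 1. Outside it both sides vanish, since motion along [e] does not
    change the transverse coordinates. *)
Lemma train_shear x :
  train (x - (del * psi i lo r x) *: e) = train (x - del *: e).
Proof.
apply: eq_bigr => k _; congr (_ * _); rewrite /B !ibE.
have [H|] := boolP [forall m, (m != i) ==> (fracp (x 0 m - lo 0 m) < r)].
  have -> : psi i lo r x = 1.
    rewrite /psi big1// => m _; case: eqP => // /eqP mi; apply: cutoff1 => //.
    by have /forallP/(_ m) := H; rewrite mi.
  by rewrite mulr1.
move=> /forallPn[m]; rewrite negb_imply => /andP[mi /negbTE mr].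
have c t : \prod_m0 ((fracp ((x - t *: e) 0 m0 - (y k) 0 m0) < side n m0)%R)%:R = 0 :> R.
  rewrite (bigD1 m)//= !mxE eqxx/= (negbTE mi) !mulr0 subr0 addr0 /side nN//.
  by rewrite mr mul0r.
by rewrite !c.
Qed.

(** On the side boxes the offset in coordinate [j], increased by [r], is at least [1 - r] modulo 1.
    As [1 - r >= 3 r], the cutoff in this coordinate is 0 and the shear does not move the point. *)
Lemma side_train_shear x :
  side_train (x - (del * psi i lo r x) *: e) = side_train x.
Proof.
apply: eq_bigr => k _; congr (_ * _); rewrite /B !ibE.
have yj t : (x - t *: e) 0 j - (y k - (2 * r) *: e') 0 j = x 0 j - lo 0 j + 2 * r.
  by rewrite !mxE !eqxx/= (negbTE ji) !mulr0 !mulr1 subr0 addr0; ring.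
have [H|H] := ltP (fracp (x 0 j - lo 0 j + 2 * r)) r; last first.
  have c t : \prod_m0 ((fracp ((x - t *: e) 0 m0 - (y k - (2 * r) *: e') 0 m0) < side n m0)%R)%:R = 0 :> R.
    by rewrite (bigD1 j)//= yj /side nN// ltNge H mul0r.
  by rewrite c -[in RHS](subr0 x) -(scale0r e) c.
have -> : psi i lo r x = 0; last by rewrite mulr0 scale0r subr0.
rewrite /psi (bigD1 j)//= (negbTE ji) cutoff0 ?mul0r//.
have r8' := r8; have r0' := r0.
set u := x 0 j - lo 0 j + 2 * r in H *.
have -> : x 0 j - lo 0 j + r = (fracp u - r + 1) + (Num.floor u - 1)%:~R.
  by rewrite intrB /fracp /u; ring.
have /andP[u0 u1] := fracp_itv u.
by rewrite fracpDz fracp_id; [|apply/andP; split]; lra.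
Qed.

Lemma train_telescope x : train (x - del *: e) - train x = slot_fun tube_slot x.
Proof.
rewrite /train -sumrB /slot_fun /tube_slot /= -/l -/e -/(B _).
under eq_bigr do rewrite -mulrBr.
rewrite -mulr_sumr; congr (_ * _).
have yS k : B (y k) (x - del *: e) = B (y k.+1) x.
  have Ey : y k + del *: e = y k.+1 by rewrite /y -addrA -scalerDl -natr1 mulrDl mul1r.
  by rewrite /B ib_shift opprK Ey.
under eq_bigr do rewrite yS.
rewrite (telescope_sumr (fun k => B (y k) x))//; congr (_ - _).
  have Ey : lo + l *: e = y G by rewrite /y /del /tube_shift mulrC divfK// pnatr_eq0 -lt0n.
  by rewrite /B ib_shift opprK Ey.
by rewrite /y mul0r scale0r addr0.
Qed.

(* Adding [train - side_train] between the two shears amounts to adding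
   [train (x - del e_i) - side_train], since [side_train] is off the support of
   [psi]; [train (x - del e_i) - train x] telescopes to the slot. *)
Definition tube_program (t Q : R) : seq step :=
  (t, Shear i lo r (- del) Q) :: jumps (hops a) ++
  (t, Shear i lo r del Q) :: jumps (hops (- a)).

Lemma exec_tube_program t Q f : t != 0 ->
  exec (tube_program t Q) f = fun x => f x + slot_fun tube_slot x.
Proof.
move=> t0; rewrite /tube_program exec_cons exec_cat exec_cons.
rewrite exec1_shear// exec_jumps exec1_shear// exec_jumps.
apply/funext => x; rewrite sum_hopsE sum_hopsN -/e.
have -> : psi i lo r (x - (del * psi i lo r x) *: e) = psi i lo r x.
  by rewrite -scaleNr psi_shift.
rewrite mulNr scaleNr opprK subrK train_shear side_train_shear -train_telescope.
ring.
Qed.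

End tube.

(** * Powers of the width of a tube *)

Section exponents.
Context {R : realType}.

(** Every requirement on the width [2^-N] of a tube is brought to this form, so that finitely many
    of them hold together for large [N]. *)
Lemma small_power (c c' e : R) : 0 < e -> 0 < c' ->
  \forall N \near \oo, c * ((2^-1 : R) ^+ N) `^ e <= c'.
Proof.
move=> e0 c'0.
have h0 : (0 : R) < 2^-1 by rewrite invr_gt0.
have E N : ((2^-1 : R) ^+ N) `^ e = ((2^-1 : R) `^ e) ^+ N.
  rewrite -(powR_mulrn N (ltW h0)) -(powR_mulrn N (powR_ge0 2^-1 e)).
  exact: powRAC.
have b1 : `|(2^-1 : R) `^ e| < 1.
  rewrite ger0_norm ?powR_ge0// -[X in _ < X](@powRr0 _ (2^-1 : R)).
  rewrite /powR gt_eqF// ltr_expR mul0r pmulr_rlt0// ln_lt0// h0/=.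
  by rewrite invf_lt1// ltr1n.
have := cvg_geometric c b1 => /cvgrPdist_le /(_ c' c'0).
apply: filterS => N; rewrite sub0r normrN /= E => h.
exact: le_trans (ler_norm _) h.
Qed.

(** [X] bounds the L^p norm of a train of mass [mu], and [tau] is chosen so that [tau * X^s] is the
    flux [mu * l^(1/p)]. The third claim says that the field then has L^p' norm [X^(s - 1)] up to a
    constant, so that both mixed norms have [X^s] as integrand in time. The last claim shows that
    [X] blows up for thin tubes. *)
Lemma tube_arith (p s gam l mu r G : R) (m : nat) (pc := p / (p - 1)) :
  1 < p -> 1 <= s -> 0 <= gam -> 0 < l -> l <= 1 -> 0 < mu -> 0 < r ->
  r `^ (- gam) <= G ->
  let X := mu * G * (l * r ^+ m) `^ (- pc^-1) in
  let tau := mu * l `^ p^-1 / X `^ s in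
  [/\ 0 < X, 0 < tau, l / G / tau * (r ^+ m) `^ pc^-1 = X `^ (s - 1) &
      mu * r `^ (- (gam + m%:R / pc)) <= X].
Proof.
move=> p1 s1 gam0 l0 l1 mu0 r0 GG X tau.
have p0 : 0 < p by lra.
have ipc : pc^-1 = 1 - p^-1 by rewrite /pc invf_div mulrBl mul1r divff// gt_eqF.
have G0 : 0 < G by apply: lt_le_trans GG; exact: powR_gt0.
have rm0 : 0 < r ^+ m by exact: exprn_gt0.
have V0 : 0 < l * r ^+ m by exact: mulr_gt0.
have X0 : 0 < X by rewrite !mulr_gt0// powR_gt0.
have Xs0 := powR_gt0 s X0.
have tau0 : 0 < tau by rewrite divr_gt0// mulr_gt0// powR_gt0.
have lp := powR_gt0 p^-1 l0; have lc := powR_gt0 pc^-1 l0.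
have rc := powR_gt0 pc^-1 rm0.
have XG : X * (l `^ pc^-1 * (r ^+ m) `^ pc^-1) = mu * G.
  rewrite -powRM ?ltW// -mulrA -powRD; last by apply/implyP => _; rewrite gt_eqF.
  by rewrite addNr powRr0 mulr1.
have ll : l `^ pc^-1 * l `^ p^-1 = l.
  by rewrite -powRD; [rewrite ipc subrK powRr1// ltW|apply/implyP => _; rewrite gt_eqF].
split => //.
- rewrite powRB; last by apply/implyP => _; rewrite gt_eqF.
  rewrite powRr1 ?ltW// /tau.
  have E : mu * l `^ p^-1 * G = X * l * (r ^+ m) `^ pc^-1.
    by rewrite mulrAC -XG -[in RHS]ll; ring.
  move: E; set a := l `^ p^-1 in lp *; set b := (r ^+ m) `^ pc^-1 in rc *; set c := X `^ s in Xs0 *.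
  move=> E; have nz (z : R) : 0 < z -> z != 0 by move=> z0; rewrite gt_eqF.
  have -> : l / G / (mu * a / c) * b = l * c * b / (mu * a * G).
    by field; rewrite !nz.
  by rewrite E; field; rewrite !nz.
- rewrite /X -[leRHS]mulrA ler_pM2l//.
  rewrite opprD powRD; last by apply/implyP => _; rewrite gt_eqF.
  apply: ler_pM; rewrite ?powR_ge0//.
  rewrite (powRM _ (ltW l0) (ltW rm0)) -(powR_mulrn m (ltW r0)) -powRrM mulrN.
  rewrite -[leLHS]mul1r ler_wpM2r ?powR_ge0//.
  rewrite powRN invf_ge1// -[leRHS](powRr0 l) ger_powR ?l0 ?l1//.
  by rewrite ipc subr_ge0 invf_le1// ltW.
Qed.

End exponents.

(** * Norms of a shear *)

Section norm_bounds.
Context {R : realType} {d : nat}.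
Local Notation tor := (@torus R d).
Local Notation N_ p f := (Lnorm tor p%:E (fun x => (f x)%:E)).
Implicit Types (f g : 'rV[R]_d -> R) (p : R).

Lemma Lnorm_add p f g (A B : R) : 1 <= p -> measurable_fun setT f -> measurable_fun setT g ->
  (N_ p f <= A%:E)%E -> (N_ p g <= B%:E)%E -> (N_ p (fun x => f x + g x) <= (A + B)%:E)%E.
Proof.
move=> p1 mf mg fA gB; apply: le_trans (minkowski_EFin tor mf mg p1) _.
by rewrite EFinD; exact: leeD.
Qed.

Lemma Lnorm_sum p (F : nat -> 'rV[R]_d -> R) (G : nat) (A : R) : 1 <= p ->
  (forall k, bounded_measurable (F k)) -> (forall k, (N_ p (F k) <= A%:E)%E) ->
  (N_ p (fun x => \sum_(0 <= k < G) F k x) <= (G%:R * A)%:E)%E.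
Proof.
move=> p1 bF FA; elim: G => [|G IH].
  rewrite mul0r; apply: Lnorm_le_cst => //; first exact: lt_le_trans ltr01 p1.
    by under eq_fun do rewrite big_nil; exact: measurable_cst.
  by move=> x; rewrite big_nil normr0.
under [X in Lnorm _ _ X]eq_fun do rewrite big_nat_recr//=.
rewrite -natr1 mulrDl mul1r; apply: Lnorm_add => //; last by case: (bF G).
by case: (bounded_measurable_sum (index_iota 0 G) F bF).
Qed.

Lemma prod_except (i : 'I_d) (c : R) : \prod_(l | l != i) c = c ^+ d.-1.
Proof. by rewrite prodr_const cardC1 card_ord. Qed.

Context (p q s st K : R).
Let pc := p / (p - 1).

(** [1 - s^-1] is the inverse of the conjugate exponent of [s]; for [s = 1] it is 0 and the bound on
    the speed is the constant [K]. *)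
Definition shear_norms (a : @step R d) f (Q : R) : Prop :=
  [/\ (N_ p f <= (Q `^ s^-1)%:E)%E,
      (N_ pc (speed a) <= (K * Q `^ (1 - s^-1))%:E)%E,
      (N_ q (speed a) <= (Q `^ st^-1)%:E)%E &
      forall k l, (N_ q (dvel1 k l a f 0) <= (Q `^ st^-1)%:E)%E].

Context (i : 'I_d) (c : 'rV[R]_d) (r : R) (r0 : 0 < r) (r8 : r <= 1 / 8).
Context (t h X : R) (t0 : 0 < t) (X0 : 0 < X).
Hypotheses (p1 : 1 < p) (q1 : 1 <= q) (s1 : 1 <= s) (st1 : 1 <= st).
Hypothesis KE : K = 3 `^ s * 3 ^+ d.-1.
Let Q := K * X `^ s.
Hypothesis hX : `|h| / t * (r ^+ d.-1) `^ pc^-1 = X `^ (s - 1).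
Hypothesis hq : 6 * 3 ^+ d.-1 / r * (`|h| / t) * (r ^+ d.-1) `^ q^-1 <= X `^ (s / st).

Let supp_w (l : 'I_d) : R := if l == i then 1 else 3 * r.

Let w01 l : 0 <= supp_w l <= 1.
Proof.
have [r0' r8'] := (r0, r8).
by rewrite /supp_w; case: eqP => _; rewrite ?ler01 ?lexx//; apply/andP; split; lra.
Qed.

Let prod_w : \prod_l supp_w l = (3 * r) ^+ d.-1.
Proof.
rewrite (bigD1 i)//= /supp_w eqxx mul1r -(prod_except i).
by apply: eq_bigr => l /negbTE ->.
Qed.

Let three_power e : 0 < e -> e <= 1 ->
  ((3 * r) ^+ d.-1) `^ e <= 3 ^+ d.-1 * (r ^+ d.-1) `^ e.
Proof.
move=> e0 e1; have a0 : (0 : R) <= 3 ^+ d.-1 by exact: exprn_ge0.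
have b0 : (0 : R) <= r ^+ d.-1 by apply: exprn_ge0; exact: ltW.
rewrite exprMn (powRM _ a0 b0); apply: ler_wpM2r; first exact: powR_ge0.
by apply: ler1_powR => //; rewrite exprn_ege1// ler1n.
Qed.

Let pow3 : 1 <= 3 `^ s :> R.
Proof.
apply: (@le_trans _ _ (3 `^ 0)); first by rewrite powRr0.
by apply: ler_powR; rewrite ?ler1n// (le_trans ler01).
Qed.


Let K1 : 1 <= K.
Proof.
by rewrite KE -[leLHS]mulr1; apply: ler_pM => //; rewrite exprn_ege1// ler1n.
Qed.

Let Q_power e : 0 <= e -> X `^ (s * e) <= Q `^ e.
Proof.
move=> e0; have K0 : 0 <= K by exact: le_trans ler01 K1.
rewrite /Q (powRM _ K0 (powR_ge0 _ _)) -powRrM -[leLHS]mul1r.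
apply: ler_wpM2r; first exact: powR_ge0.
have -> : 1 = 1 `^ e :> R by rewrite powR1.
by apply: ge0_ler_powR; rewrite // nnegrE ?ler01.
Qed.

(** In [K] the factor [3^s] absorbs the bound [3 X] on the state, and [3^(d-1)] absorbs the width
    [3 r] of the support of the profile in place of [r]. *)
Lemma shear_norms_tube f : (N_ p f <= (3 * X)%:E)%E ->
  shear_norms (t, Shear i c r h Q) f Q.
Proof.
move=> fX; have s0 : 0 < s by exact: lt_le_trans ltr01 s1.
have q0 : 0 < q by exact: lt_le_trans ltr01 q1.
have st0 : 0 < st by exact: lt_le_trans ltr01 st1.
have K0 : 0 <= K by exact: le_trans ler01 K1.
have ht0 : 0 <= `|h| / t by rewrite divr_ge0// ltW.
have pc0 : 0 < pc by rewrite /pc divr_gt0 ?subr_gt0// (lt_trans ltr01).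
have pc1 : pc^-1 <= 1.
  rewrite /pc invf_div ler_pdivrMr ?mul1r ?gerBl ?ler01//; exact: lt_trans ltr01 p1.
have [mspeed _] := bounded_measurable_psi i c r r0 r8.
have speed_le x : `|speed (t, Shear i c r h Q) x| <= `|h| / t * ib (c - const_mx r) supp_w x.
  rewrite /speed/= !normrM normfV (gtr0_norm t0); apply: ler_wpM2l => //.
  exact: psi_le_supp.
have mspeed' : measurable_fun setT (speed (t, Shear i c r h Q)).
  exact: measurable_funM.
have r6 : 1 <= 6 / r.
  by have [r0' r8'] := (r0, r8); rewrite ler_pdivlMr// mul1r; lra.
have b30 : (0 : R) <= 3 ^+ d.-1 by exact: exprn_ge0.
have qbound : 6 / r * (`|h| / t) * ((3 * r) ^+ d.-1) `^ q^-1 <= Q `^ st^-1.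
  apply: le_trans (_ : X `^ (s / st) <= _); last first.
    by apply: Q_power; rewrite invr_ge0 ltW.
  apply: le_trans hq; rewrite -!mulrA.
  have -> : 6 * (3 ^+ d.-1 * (r^-1 * (`|h| * (t^-1 * (r ^+ d.-1) `^ q^-1)))) =
      (6 * (r^-1 * (`|h| * t^-1))) * (3 ^+ d.-1 * (r ^+ d.-1) `^ q^-1) by ring.
  have -> : 6 * (r^-1 * (`|h| * (t^-1 * ((3 * r) ^+ d.-1) `^ q^-1))) =
      (6 * (r^-1 * (`|h| * t^-1))) * ((3 * r) ^+ d.-1) `^ q^-1 by ring.
  apply: ler_wpM2l.
    by rewrite !mulr_ge0// invr_ge0 ltW.
  by apply: three_power; rewrite ?invr_gt0// invf_le1.
split.
- apply: le_trans fX _; rewrite lee_fin /Q.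
  rewrite (powRM _ K0 (powR_ge0 _ _)) -powRrM divff ?gt_eqF// (powRr1 (ltW X0)).
  apply: ler_wpM2r; first exact: ltW.
  rewrite -[leLHS](@powRr1 _ 3)// -[X in 3 `^ X](divff (lt0r_neq0 s0)) powRrM.
  apply: ge0_ler_powR; rewrite ?nnegrE ?powR_ge0 ?invr_ge0 ?(ltW s0)//.
  by rewrite KE -[leLHS]mulr1 ler_wpM2l ?powR_ge0// exprn_ege1// ler1n.
- have := Lnorm_le_ib _ _ _ _ _ pc0 ht0 w01 mspeed' speed_le.
  move=> /le_trans; apply; rewrite lee_fin prod_w.
  apply: le_trans (_ : `|h| / t * (3 ^+ d.-1 * (r ^+ d.-1) `^ pc^-1) <= _).
    by apply: ler_wpM2l => //; apply: three_power => //; rewrite invr_gt0.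
  rewrite mulrCA hX; apply: ler_pM => //; first exact: powR_ge0.
    by rewrite KE -[leLHS]mul1r; apply: ler_wpM2r.
  have -> : s - 1 = s * (1 - s^-1) by rewrite mulrBr mulr1 divff// gt_eqF.
  by apply: Q_power; rewrite subr_ge0 invf_le1.
- have := Lnorm_le_ib _ _ _ _ _ q0 ht0 w01 mspeed' speed_le.
  move=> /le_trans; apply; rewrite lee_fin prod_w; apply: le_trans qbound.
  rewrite -[leLHS]mul1r -mulrA; apply: ler_wpM2r r6.
  by rewrite mulr_ge0// powR_ge0.
- move=> k l; have C0 : 0 <= 6 / r * (`|h| / t).
    by rewrite mulr_ge0// (le_trans ler01).
  have dle x : `|dvel1 k l (t, Shear i c r h Q) f 0 x| <=
      6 / r * (`|h| / t) * ib (c - const_mx r) supp_w x.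
    rewrite /dvel1/=; case: eqP => _; last first.
      by rewrite normr0 mulr_ge0// ib_ge0.
    rewrite !normrM normfV (gtr0_norm t0) [6 / r * _]mulrC -[leRHS]mulrA.
    by apply: ler_wpM2l => //; exact: dpsi_le_supp.
  have mdv : measurable_fun setT (dvel1 k l (t, Shear i c r h Q) f 0).
    rewrite /dvel1/=; case: eqP => _; last exact: measurable_cst.
    by apply: measurable_funM => //; case: (bounded_measurable_dpsi i c r r0 r8 l).
  have := Lnorm_le_ib _ _ _ _ _ q0 C0 w01 mdv dle.
  by move=> /le_trans; apply; rewrite lee_fin prod_w.
Qed.

End norm_bounds.

(** * Realising a slot in a thin tube *)

Section preprograms.
Context {R : realType} {d : nat}.
Local Notation tor := (@torus R d).
Local Notation N_ p f := (Lnorm tor p%:E (fun x => (f x)%:E)).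
Context (p q s st K : R).
Implicit Types (f : 'rV[R]_d -> R) (a : @step R d) (P : seq (@step R d)) (S : @slot R d).

(* Validity with the durations and the bounds of the jumps left open. *)
Definition prevalid1 a f : Prop :=
  match a.2 with
  | Jump _ _ => True
  | Shear _ _ _ _ Q => wf1 a /\ shear_norms p q s st K a f Q
  end.

Fixpoint prevalid P f : Prop :=
  if P is a :: P' then prevalid1 a f /\ prevalid P' (exec1 a f) else True.

Definition cost P : R :=
  \sum_(a <- P) match a.2 with Jump _ _ => 0 | Shear _ _ _ _ Q => a.1 * Q end.

Definition shear_time P : R :=
  \sum_(a <- P) match a.2 with Jump _ _ => 0 | Shear _ _ _ _ _ => a.1 end.

Definition weight S : R := mass S * len S `^ p^-1.

Lemma prevalid_cons a P f :
  prevalid (a :: P) f <-> prevalid1 a f /\ prevalid P (exec1 a f).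
Proof. by []. Qed.

Lemma prevalid_cat P1 P2 f :
  prevalid (P1 ++ P2) f <-> prevalid P1 f /\ prevalid P2 (exec P1 f).
Proof.
elim: P1 f => [|a P1 IH] f /=; first by split => // -[].
by rewrite IH; split => [[? []]|[[]]].
Qed.

Lemma prevalid_jumps (l : seq slot) f : prevalid (jumps l) f.
Proof. by elim: l f => [//|J l IH] f; split => //; exact: IH. Qed.

Lemma flux_cat P1 P2 : flux p (P1 ++ P2) = flux p P1 + flux p P2.
Proof. by rewrite /flux big_cat. Qed.

Lemma cost_cat P1 P2 : cost (P1 ++ P2) = cost P1 + cost P2.
Proof. by rewrite /cost big_cat. Qed.

Lemma shear_time_cat P1 P2 : shear_time (P1 ++ P2) = shear_time P1 + shear_time P2.
Proof. by rewrite /shear_time big_cat. Qed.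

Lemma flux_jumps (l : seq slot) : flux p (jumps l) = \sum_(J <- l) weight J.
Proof. by rewrite /flux big_map. Qed.

Lemma cost_jumps (l : seq slot) : cost (jumps l) = 0.
Proof. by rewrite /cost big_map big1. Qed.

Lemma shear_time_jumps (l : seq slot) : shear_time (jumps l) = 0.
Proof. by rewrite /shear_time big_map big1. Qed.

Definition core_lev S (N : nat) (l : 'I_d) : nat := if l == dir S then lev S l else N.

(** The slot squeezed to the width [2^-N]; the amplitude is rescaled to keep the mass, and hence the
    flux. *)
Definition core S N : slot :=
  Slot (amp S * vol (lev S) / vol (core_lev S N)) (corner S) (core_lev S N) (dir S).

Lemma vol_core S N : vol (core_lev S N) = len S * (2^-1 ^+ N) ^+ d.-1.
Proof.
rewrite /vol (bigD1 (dir S))//= /side /core_lev eqxx; congr (_ * _).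
by rewrite -(prod_except (dir S)); apply: eq_bigr => l /negbTE ->.
Qed.

Lemma mass_core S N : mass (core S N) = mass S.
Proof.
rewrite /mass /core/= !normrM normfV (gtr0_norm (vol_gt0 _)) (gtr0_norm (vol_gt0 _)).
by rewrite divfK// gt_eqF// vol_gt0.
Qed.

Lemma len_core S N : len (core S N) = len S.
Proof. by rewrite /len /side /core/= /core_lev eqxx. Qed.

Context (gam : R).
Let pc := p / (p - 1).
Let m : R := d.-1%:R.
Let sig := s - s / st.
Hypotheses (p1 : 1 < p) (q1 : 1 <= q) (s1 : 1 <= s) (st1 : 1 <= st).
Hypothesis KE : K = 3 `^ s * 3 ^+ d.-1.
Hypotheses (gam0 : 0 <= gam) (gamp : gam < p^-1) (sig1 : sig < 1).
Hypothesis m0 : 0 < m.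
Hypothesis kap0 : 0 < m / q - m / pc - 1 + (1 - sig) * (gam + m / pc).

Lemma weight_hops S (j : 'I_d) (N G : nat) (a b : R) : j != dir S ->
  `|b| * vol (core_lev S N) = mass S ->
  \sum_(J <- hops (dir S) j (corner S) (core_lev S N) N a G b) weight J =
  2 * G%:R * (mass S * (2^-1 ^+ N) `^ p^-1).
Proof.
move=> jS bE; rewrite /hops big_flatten/= big_map.
under eq_bigr => k _.
  rewrite !big_cons big_nil/= addr0 /weight /mass /len/= bE /side /core_lev (negbTE jS).
  rewrite -mulr2n; over.
by rewrite big_const_seq count_predT size_iota iter_addr_0 -mulrnA -[LHS]mulr_natl natrM.
Qed.

(** Triangle inequality over the [G] boxes, each of norm mass times volume to the power
    [1/p - 1]. *)
Lemma Lnorm_train S (N G : nat) (b : R) (y : nat -> 'rV[R]_d) : `|b| * vol (core_lev S N) = mass S ->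
  (N_ p (fun x => (\sum_(0 <= k < G) b * ib (y k) (side (core_lev S N)) x)) <=
   (mass S * G%:R * vol (core_lev S N) `^ (- pc^-1))%:E)%E.
Proof.
move=> bE; have p0 : 0 < p by exact: lt_trans ltr01 p1.
have V0 := vol_gt0 (R := R) (core_lev S N).
have -> : mass S * G%:R * vol (core_lev S N) `^ (- pc^-1) =
    G%:R * (`|b| * vol (core_lev S N) `^ p^-1).
  have -> : vol (core_lev S N) `^ p^-1 =
      vol (core_lev S N) * vol (core_lev S N) `^ (- pc^-1).
    rewrite -[X in X * _](powRr1 (ltW V0)) -powRD; last by apply/implyP => _; rewrite gt_eqF.
    by congr (_ `^ _); rewrite /pc invf_div mulrBl mul1r divff ?gt_eqF//; ring.
  by rewrite -bE; ring.
have bF k : bounded_measurable (fun x => b * ib (y k) (side (core_lev S N)) x).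
  by apply: bounded_measurableM; [exact: bounded_measurable_cst|exact: bounded_measurable_ib].
apply: (Lnorm_sum _ _ _ _ (ltW p1) bF) => k.
apply: (@Lnorm_le_ib _ _ _ (y k) (side (core_lev S N))) => //.
- by move=> l; exact: side01.
- by case: (bF k).
- by move=> x; rewrite normrM [X in _ * X]ger0_norm ?ib_ge0.
Qed.

(** With about [r^(-gam)] cuts, the flux of the sideways jumps is of order [r^(1/p - gam)] and tends
    to 0. Meanwhile [X] tends to infinity, which makes the background negligible beside the train,
    the shears short, and, by [kap0], the gradient admissible. *)
Lemma tube_realizable S (j : 'I_d) (M eps : R) : amp S != 0 -> j != dir S ->
  0 <= M -> 0 < eps ->
  \forall N \near \oo, exists P,
  [/\ forall f, state f -> (forall x, `|f x| <= M) ->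
        exec P f = (fun x => f x + slot_fun (core S N) x) /\ prevalid P f,
      flux p P <= weight S / 4, cost P <= 2 * K * weight S & shear_time P <= eps].
Proof.
move=> aS jS M0 eps0.
have p0 : 0 < p by exact: lt_trans ltr01 p1.
have pc0 : 0 < pc by rewrite /pc divr_gt0 ?subr_gt0.
have mu0 : 0 < mass S by rewrite /mass mulr_gt0 ?normr_gt0 ?vol_gt0.
have l0 : 0 < len S by exact: side_gt0.
have l1 : len S <= 1 by exact: side_le1.
have W0 : 0 < weight S by rewrite mulr_gt0 ?powR_gt0.
pose del := gam + m / pc.
have del0 : 0 < del by rewrite ltr_wpDl// divr_gt0.
near=> N.
(* [C6] makes the profile fit into the torus, [C1] is the gradient bound [hq], [C2] makes [X] exceed
   the bound [M] of the background, [C3] gives [X >= 1], [C4] limits the time of the shears and [C5]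
   the flux of the sideways jumps. *)
have C6 : 1 * (2^-1 ^+ N) `^ 1 <= 1 / 8 :> R by near: N; apply: small_power; lra.
have C1 : 6 * 3 ^+ d.-1 * (2^-1 ^+ N) `^ (m / q - m / pc - 1 + (1 - sig) * del) <= mass S `^ (1 - sig).
  by near: N; apply: small_power => //; exact: powR_gt0.
have C2 : M * (2^-1 ^+ N) `^ del <= mass S by near: N; exact: small_power.
have C3 : 1 * (2^-1 ^+ N) `^ del <= mass S by near: N; exact: small_power.
have C4 : 2 * weight S * (2^-1 ^+ N) `^ del <= eps * mass S.
  by near: N; apply: small_power => //; exact: mulr_gt0.
have C5 : 8 * mass S * (2^-1 ^+ N) `^ (p^-1 - gam) <= weight S / 4.
  by near: N; apply: small_power; rewrite ?subr_gt0// divr_gt0.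
set r : R := 2^-1 ^+ N in C1 C2 C3 C4 C5 C6 *.
have r0 : 0 < r by rewrite exprn_gt0// invr_gt0.
have r8 : r <= 1 / 8 by move: C6; rewrite mul1r (powRr1 (ltW r0)).
have nz (z : R) : 0 < z -> z != 0 by move=> z0; rewrite gt_eqF.
(* Between [r^(-gam)] and [2 r^(-gam)], because [r^(-gam) >= 1]. *)
pose G := (Num.truncn (r `^ (- gam))).+1.
have G1 : r `^ (- gam) <= G%:R by apply/ltW; exact: truncnS_gt.
have G2 : G%:R <= 2 * r `^ (- gam).
  have g1 : 1 <= r `^ (- gam).
    rewrite powRN invf_ge1 ?powR_gt0// -[leRHS](powRr0 r) ger_powR ?r0//; lra.
  rewrite /G -natr1 mulr2n mulrDl mul1r lerD// truncn_le//; exact: le_trans g1.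
have G0 : 0 < G%:R :> R by rewrite ltr0n.
pose X := mass S * G%:R * (len S * r ^+ d.-1) `^ (- pc^-1).
pose tau := mass S * len S `^ p^-1 / X `^ s.
have [X0 tau0 hX Xlow] := tube_arith p s gam (len S) (mass S) r G%:R d.-1 p1 s1 gam0 l0 l1 mu0 r0 G1.
rewrite -/X -/tau -/pc -/m -/del in X0 tau0 hX Xlow.
have rd := powR_gt0 del r0.
have Xge c : 0 <= c -> c * r `^ del <= mass S -> c <= X.
  by move=> c0 h; apply: le_trans Xlow; rewrite powRN ler_pdivlMr.
have MX : M <= X by exact: Xge.
have X1 : 1 <= X by exact: Xge.
(* The speed contributes [X^(s-1)]. What remains of [X^(s/st)] is [X^(1 - sig)], at least
   [(mass * r^(-del))^(1 - sig)], and the powers of [r] combine to the exponent in [C1]. *)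
have hq : 6 * 3 ^+ d.-1 / r * (len S / G%:R / tau) * (r ^+ d.-1) `^ q^-1 <= X `^ (s / st).
  have rm : r ^+ d.-1 = r `^ m by rewrite powR_mulrn// ltW.
  have -> : len S / G%:R / tau = X `^ (s - 1) / (r ^+ d.-1) `^ pc^-1.
    by rewrite -hX mulfK// nz// powR_gt0// exprn_gt0.
  have -> : s / st = (s - 1) + (1 - sig) by rewrite /sig; ring.
  rewrite [leRHS]powRD; last by apply/implyP => _; exact: nz.
  have -> : 6 * 3 ^+ d.-1 / r * (X `^ (s - 1) / (r ^+ d.-1) `^ pc^-1) * (r ^+ d.-1) `^ q^-1 =
      X `^ (s - 1) * (6 * 3 ^+ d.-1 * ((r ^+ d.-1) `^ q^-1 / (r ^+ d.-1) `^ pc^-1 / r)) by ring.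
  apply: ler_wpM2l; first exact: powR_ge0.
  apply: le_trans (_ : (mass S * r `^ (- del)) `^ (1 - sig) <= _); last first.
    have sig0 : 0 <= 1 - sig by rewrite subr_ge0 ltW.
    apply: ge0_ler_powR => //; rewrite nnegrE ?(ltW X0)//.
    by rewrite mulr_ge0 ?powR_ge0// ltW.
  rewrite (powRM _ (ltW mu0) (powR_ge0 _ _)) -[in leRHS]powRrM.
  have -> : (r ^+ d.-1) `^ q^-1 / (r ^+ d.-1) `^ pc^-1 / r =
      r `^ (m / q - m / pc - 1 + (1 - sig) * del) * r `^ (- del * (1 - sig)).
    rewrite rm -!powRrM -powRD; last by apply/implyP => _; exact: nz.
    rewrite -[X in _ / X](powRr1 (ltW r0)) -!powRB; try by apply/implyP => _; exact: nz.
    by congr (_ `^ _); ring.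
  by rewrite mulrA ler_wpM2r ?powR_ge0.
pose b := amp (core S N).
have bE : `|b| * vol (core_lev S N) = mass S by exact: (mass_core S N).
have bNE : `|- b| * vol (core_lev S N) = mass S by rewrite normrN.
have nN l : l != dir S -> core_lev S N l = N by rewrite /core_lev => /negbTE ->.
have GG : (0 < G)%N by [].
have slotE : tube_slot (dir S) (corner S) (core_lev S N) b = core S N by [].
have lenE : tube_shift (dir S) (corner S) (core_lev S N) b G = len S / G%:R.
  by rewrite /tube_shift slotE len_core.
pose Q := K * X `^ s.
exists (tube_program (dir S) j (corner S) (core_lev S N) N b G tau Q).
have lG0 : 0 <= len S / G%:R by rewrite divr_ge0// ltW.
split.
- move=> f sf fM; split.
    by rewrite (exec_tube_program _ _ jS _ _ _ nN r8 _ _ GG) ?slotE// nz.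
  have norms h g : `|h| = len S / G%:R -> (N_ p g <= (3 * X)%:E)%E ->
      shear_norms p q s st K (tau, Shear (dir S) (corner S) r h Q) g Q.
    move=> hE gX; apply: shear_norms_tube => //; first by rewrite hE.
    by rewrite hE.
  have wfh h : wf1 (tau, Shear (dir S) (corner S) r h Q).
    split => //=; split => //; rewrite mulr_ge0 ?powR_ge0// KE.
    by rewrite mulr_ge0 ?powR_ge0// exprn_ge0.
  have NM (g : 'rV[R]_d -> R) : measurable_fun setT g -> (forall x, `|g x| <= M) -> (N_ p g <= X%:E)%E.
    by move=> mg gM; apply: (Lnorm_le_cst _ _ _ p0 (ltW X0) mg) => x; exact: le_trans MX.
  apply/prevalid_cons; split.
    split => //; apply: norms; first by rewrite normrN lenE ger0_norm.
    apply: le_trans (NM f _ fM) _; first by case: sf => -[].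
    by rewrite lee_fin; lra.
  apply/prevalid_cat; split; first exact: prevalid_jumps.
  apply/prevalid_cons; split; last exact: prevalid_jumps.
  split => //; apply: norms; first by rewrite lenE ger0_norm.
  have sg := state_exec1 _ _ (wfh (- tube_shift (dir S) (corner S) (core_lev S N) b G)) sf.
  set g := exec1 _ f in sg *; rewrite exec_jumps.
  have gM x : `|g x| <= M by rewrite /g exec1_shear ?nz.
  under eq_fun do rewrite sum_hopsE//.
  (* One [X] each for the background, the train and the side train. *)
  have -> : 3 * X = X + (X + X) by ring.
  have mg : measurable_fun setT g by case: sg => -[].
  have XE : X = mass S * G%:R * vol (core_lev S N) `^ (- pc^-1) by rewrite vol_core.
  have bsum (c : R) (y : nat -> 'rV[R]_d) : bounded_measurable (fun x => \sum_(0 <= k < G) c * ib (y k) (side (core_lev S N)) x).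
    apply: bounded_measurable_sum => k.
    by apply: bounded_measurableM; [exact: bounded_measurable_cst|exact: bounded_measurable_ib].
  have m1 : measurable_fun setT (train (dir S) (corner S) (core_lev S N) b G).
    by case: (bsum b (fun k => corner S + (k%:R * tube_shift (dir S) (corner S) (core_lev S N) b G) *: basis_vec (dir S))).
  have m2 : measurable_fun setT (side_train (dir S) j (corner S) (core_lev S N) N b G).
    by case: (bsum b (fun k => corner S + (k%:R * tube_shift (dir S) (corner S) (core_lev S N) b G) *: basis_vec (dir S) - (2 * r) *: basis_vec j)).
  apply: (Lnorm_add _ _ _ _ _ (ltW p1) mg); [exact: measurable_funB|exact: NM|].
  apply: (Lnorm_add _ _ _ _ _ (ltW p1) m1); [exact: measurableT_comp|by rewrite XE; exact: Lnorm_train|].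
  under eq_fun do rewrite /side_train -sumrN.
  under eq_fun do under eq_bigr do rewrite -mulNr.
  by rewrite XE; exact: Lnorm_train.
- rewrite /tube_program -cat1s !flux_cat flux_jumps -[X in _ + (_ + X)]/(flux p ([:: _] ++ _)).
  rewrite flux_cat flux_jumps !weight_hops//.
  rewrite /flux !big_cons !big_nil /jump_flux/= !addr0 !add0r.
  apply: le_trans C5; rewrite -mulrDl.
  (* There are [4 G] sideways jumps in all and [G <= 2 r^(-gam)], whence 8. *)
  have -> : 8 * mass S * r `^ (p^-1 - gam) = (2 * (2 * r `^ (- gam)) + 2 * (2 * r `^ (- gam))) * (mass S * r `^ p^-1).
    by rewrite powRD; [ring|apply/implyP => _; exact: nz].
  by apply: ler_wpM2r; [rewrite mulr_ge0 ?powR_ge0 ?mass_ge0 | rewrite lerD// ler_wpM2l].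
- rewrite /tube_program -cat1s !cost_cat cost_jumps -[X in _ + (_ + X)]/(cost ([:: _] ++ _)).
  rewrite cost_cat cost_jumps /cost !big_cons !big_nil /= !addr0 !add0r.
  have -> : tau * Q = K * weight S.
    by rewrite /tau /Q mulrCA divfK// nz// powR_gt0.
  by rewrite -mulrA mulr2n mulrDl mul1r.
- rewrite /tube_program -cat1s !shear_time_cat shear_time_jumps -[X in _ + (_ + X)]/(shear_time ([:: _] ++ _)).
  rewrite shear_time_cat shear_time_jumps /shear_time !big_cons !big_nil /= !addr0 !add0r.
  (* Since [X >= 1] and [s >= 1], [X^s] is at least [X]. *)
  have tX : tau <= weight S / X.
    rewrite /tau -/(weight S) ler_pM2l// lef_pV2 ?posrE ?powR_gt0//.
    exact: le1r_powR.
  have : 2 * weight S / eps <= X.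
    apply: Xge; first by rewrite divr_ge0 ?(ltW eps0)// mulr_ge0// ltW.
    by rewrite mulrAC ler_pdivrMr// [mass S * eps]mulrC.
  rewrite ler_pdivrMr// => h.
  have : 2 * (weight S / X) <= eps by rewrite mulrA ler_pdivrMr// [eps * X]mulrC.
  lra.
Unshelve. all: by end_near. Qed.

End preprograms.

(** * Concentration and refinement *)

Section halving.
Context {R : realType} {d : nat} (p : R).
Hypothesis p1 : 1 < p.
Implicit Types (x lo : 'rV[R]_d) (n : 'I_d -> nat) (l : 'I_d).

Definition deepen n l (k : nat) : 'I_d -> nat := fun l' => if l' == l then (n l' + k)%N else n l'.

Lemma side_deepen n l k l' :
  side (deepen n l k) l' = side n l' * (if l' == l then 2^-1 ^+ k else 1) :> R.
Proof. by rewrite /side /deepen; case: eqP => _; rewrite ?mulr1// exprD. Qed.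

Lemma vol_deepen n l k : vol (deepen n l k) = vol n * 2^-1 ^+ k :> R.
Proof.
rewrite /vol; under eq_bigr do rewrite side_deepen.
rewrite big_split/=; congr (_ * _); rewrite (bigD1 l)//= eqxx big1 ?mulr1// => l' /negbTE ->.
by [].
Qed.

Lemma fracp_halve (z w : R) : 0 < w <= 1 ->
  (fracp z < w)%R%:R = (fracp z < w / 2)%R%:R + (fracp (z - w / 2) < w / 2)%R%:R :> R.
Proof.
move=> /andP[w0 w1]; have /andP[z0 z1] := fracp_itv z.
have E : z - w / 2 = (fracp z - w / 2) + (Num.floor z)%:~R by rewrite /fracp; ring.
rewrite E fracpDz; have [zw|zw] := ltP (fracp z) (w / 2).
  have -> : fracp (fracp z - w / 2) = fracp z - w / 2 + 1.
    rewrite -(fracpDz _ 1) fracp_id; first by rewrite mulr1z.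
    by rewrite mulr1z; apply/andP; split; lra.
  have -> : fracp z < w by lra.
  have -> : (fracp z - w / 2 + 1 < w / 2) = false by apply/negbTE; rewrite -leNgt; lra.
  by rewrite addr0.
have -> : fracp (fracp z - w / 2) = fracp z - w / 2.
  by rewrite fracp_id//; apply/andP; split; lra.
rewrite add0r; congr (_%:R); congr nat_of_bool; apply/idP/idP; lra.
Qed.

Lemma ib_halve lo n l x :
  ib lo (side n) x = ib lo (side (deepen n l 1)) x +
    ib lo (side (deepen n l 1)) (x - side (deepen n l 1) l *: basis_vec l) :> R.
Proof.
rewrite !ibE (bigD1 l)//= [X in _ = X + _](bigD1 l)//= [X in _ = _ + X](bigD1 l)//=.
have E (y : 'rV[R]_d) : (forall m, m != l -> y 0 m = x 0 m) ->
    \prod_(m < d | m != l) ((fracp (y 0 m - lo 0 m) < side (deepen n l 1) m)%R)%:R =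
    \prod_(m < d | m != l) ((fracp (x 0 m - lo 0 m) < side n m)%R)%:R :> R.
  move=> H; apply: eq_bigr => m ml.
  by rewrite (H m ml) side_deepen (negbTE ml) mulr1.
rewrite !E//; last first.
  by move=> m /negbTE ml; rewrite !mxE eqxx/= ml mulr0 subr0.
rewrite -mulrDl side_deepen eqxx expr1; congr (_ * _).
have -> : (x - (side n l / 2) *: basis_vec l) 0 l - lo 0 l = x 0 l - lo 0 l - side n l / 2.
  by rewrite !mxE !eqxx mulr1; ring.
by apply: fracp_halve; rewrite side_gt0 side_le1.
Qed.

(** The sum of all positive powers of [2^(-1/p)]: successive halvings have lengths side/2, side/4,
    and so on, and the same mass up to a factor. *)
Definition halving_factor : R := (2^-1) `^ p^-1 / (1 - (2^-1) `^ p^-1).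

Let th : R := (2^-1) `^ p^-1.

Let th1 : 0 < 1 - th.
Proof.
rewrite subr_gt0 /th -[ltRHS](powRr0 2^-1) /powR gt_eqF ?invr_gt0// ltr_expR mul0r.
rewrite pmulr_rlt0 ?invr_gt0 ?(lt_trans ltr01 p1)//.
by rewrite ln_lt0// invr_gt0 ltr0n invf_lt1// ltr1n.
Qed.

Lemma halving_factor_ge0 : 0 <= halving_factor.
Proof. by rewrite divr_ge0 ?powR_ge0// ltW. Qed.

(* [2 b 1_(B/2) - b 1_B] is a slot, where [B/2] is half of the box [B]; the
   fluxes of the successive halvings form a geometric series. *)
Lemma concentrate1 lo n l (k : nat) (a : R) : exists L : seq slot,
  [/\ forall x, \sum_(J <- L) slot_fun J x =
        a * 2 ^+ k * ib lo (side (deepen n l k)) x - a * ib lo (side n) x &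
      \sum_(J <- L) weight p J <=
        `|a| * vol n / 2 * halving_factor * side n l `^ p^-1].
Proof.
elim: k n a => [|k IH] n a.
  exists [::]; split => [x|].
    rewrite big_nil expr0 mulr1 (_ : deepen n l 0 = n) ?subrr//.
    by apply/funext => l'; rewrite /deepen addn0; case: ifP.
  rewrite big_nil; apply: mulr_ge0; last exact: powR_ge0.
  apply: mulr_ge0; last exact: halving_factor_ge0.
  by rewrite divr_ge0// mulr_ge0// ltW// vol_gt0.
have [L [Lsum Lw]] := IH (deepen n l 1) (a * 2).
(* The negative amplitude takes [a] off the second half and adds it to the first. *)
exists (Slot (- a) lo (deepen n l 1) l :: L); split => [x|].
  rewrite big_cons Lsum /slot_fun/= /len/= (ib_halve lo n l x).
  have -> : deepen (deepen n l 1) l k = deepen n l k.+1.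
    by apply/funext => l'; rewrite /deepen; case: eqP => // _; rewrite -addnA add1n.
  by rewrite exprS; ring.
rewrite big_cons /weight /mass /len/= normrN.
apply: le_trans (lerD (lexx _) Lw) _.
rewrite vol_deepen side_deepen eqxx expr1 normrM [ `|2| ]ger0_norm//.
rewrite (powRM _ (ltW (side_gt0 _ _))) ?invr_ge0// -/th.
have E : halving_factor = th * (1 + halving_factor).
  by rewrite /halving_factor -/th; field; rewrite gt_eqF.
rewrite le_eqVlt; apply/orP; left; apply/eqP.
by rewrite [in RHS]E; field.
Qed.

(** Directions are squeezed one after the other. Each pass keeps [a * vol n] and does not lengthen
    any side, so the flux of every pass is bounded by data of the initial box. *)
Lemma concentrate lo (N : nat) (ds : seq 'I_d) n (a : R) :
  exists L : seq slot, exists b : R,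
  let n' := fun l => if l \in ds then maxn (n l) N else n l in
  [/\ forall x, \sum_(J <- L) slot_fun J x = b * ib lo (side n') x - a * ib lo (side n) x,
      b * vol n' = a * vol n &
      \sum_(J <- L) weight p J <=
        `|a| * vol n / 2 * halving_factor * \sum_(l <- ds) side n l `^ p^-1].
Proof.
elim: ds n a => [|l ds IH] n a.
  exists [::], a => n'; split => [x||].
  - by rewrite big_nil subrr.
  - by [].
  - by rewrite !big_nil mulr0.
(* The subtraction is truncated: a side that is already at most [2^-N] is not halved. *)
have [L1 [L1sum L1w]] := concentrate1 lo n l (N - n l) a.
set n1 := deepen n l (N - n l) in L1sum.
have [L2 [b [L2sum bE L2w]]] := IH n1 (a * 2 ^+ (N - n l)).
exists (L1 ++ L2), b => n'.
have nn : (fun l' => if l' \in ds then maxn (n1 l') N else n1 l') = n'.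
  apply/funext => l'; rewrite /n' in_cons /n1 /deepen.
  case: (eqVneq l' l) => [->|_]; last by [].
  by rewrite /= -maxnE; case: ifP => // _; rewrite -maxnA maxnn.
rewrite nn in L2sum bE.
have av : a * 2 ^+ (N - n l) * vol n1 = a * vol n.
  rewrite /n1 vol_deepen mulrACA -exprMn mulfV//.
  by rewrite expr1n mulr1.
split.
- by move=> x; rewrite big_cat/= L1sum L2sum; ring.
- by rewrite bE av.
- rewrite big_cat/= big_cons mulrDr; apply: lerD => //; apply: le_trans L2w _.
  have -> : `|a * 2 ^+ (N - n l)| * vol n1 = `|a| * vol n.
    rewrite -[in LHS](gtr0_norm (vol_gt0 n1)) -normrM av normrM.
    by rewrite (gtr0_norm (vol_gt0 _)).
  apply: ler_wpM2l.
    apply: mulr_ge0; last exact: halving_factor_ge0.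
    by rewrite divr_ge0// mulr_ge0// ltW// vol_gt0.
  apply: ler_sum => l' _; apply: ge0_ler_powR.
  - by rewrite invr_ge0 ltW// (lt_trans ltr01).
  - by rewrite nnegrE ltW// side_gt0.
  - by rewrite nnegrE ltW// side_gt0.
  rewrite /n1 side_deepen -[leRHS]mulr1 ler_wpM2l//; first by rewrite ltW// side_gt0.
  by case: ifP => // _; rewrite exprn_ile1// ?invr_ge0// invf_le1// ler1n.
Qed.

End halving.

(** * Realising an arbitrary slot *)

Section realizations.
Context {R : realType} {d : nat} (p q s st K gam : R).
Let pc := p / (p - 1).
Let m : R := d.-1%:R.
Let sig := s - s / st.
Hypotheses (p1 : 1 < p) (q1 : 1 <= q) (s1 : 1 <= s) (st1 : 1 <= st).
Hypothesis KE : K = 3 `^ s * 3 ^+ d.-1.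
Hypotheses (gam0 : 0 <= gam) (gamp : gam < p^-1) (sig1 : sig < 1).
Hypothesis d1 : (1 < d)%N.
Hypothesis kap0 : 0 < m / q - m / pc - 1 + (1 - sig) * (gam + m / pc).
Implicit Types (F f : 'rV[R]_d -> R) (S : @slot R d).

(** [A] and [c] are fixed before [M] and [eps]: flux and cost depend neither on the size of the
    background nor on the time allowed. *)
Definition realizes F (A c : R) : Prop := forall M eps : R, 0 <= M -> 0 < eps ->
  exists P,
  [/\ forall f, state f -> (forall x, `|f x| <= M) ->
        exec P f = (fun x => f x + F x) /\ prevalid p q s st K P f,
      flux p P <= A, cost P <= c & shear_time P <= eps].

Lemma slot_fun_le S x : `|slot_fun S x| <= `|amp S|.
Proof.
rewrite /slot_fun normrM -[leRHS]mulr1; apply: ler_wpM2l => //.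
rewrite /ib; case: inbox; case: inbox; rewrite ?subrr ?subr0 ?sub0r ?normrN ?normr1 ?normr0 //.
Qed.

Lemma realizes_add F G A A' c c' : state F -> realizes F A c -> realizes G A' c' ->
  realizes (fun x => F x + G x) (A + A') (c + c').
Proof.
move=> [[mF [B HB]] pF] rF rG M eps M0 eps0.
have e2 : 0 < eps / 2 by rewrite divr_gt0.
have B0 : 0 <= B by exact: le_trans (HB 0).
have [P1 [P1F P1A P1c P1t]] := rF M _ M0 e2.
(* The second program acts on the background [f + F], whence [M + B]. *)
have [P2 [P2F P2A P2c P2t]] := rG (M + B) _ (addr_ge0 M0 B0) e2.
exists (P1 ++ P2); split.
- move=> f sf fM; have [E1 v1] := P1F f sf fM.
  have [E2 v2] : exec P2 (fun x => f x + F x) = (fun x => f x + F x + G x) /\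
      prevalid p q s st K P2 (fun x => f x + F x).
    apply: P2F => [|x]; last by rewrite (le_trans (ler_normD _ _))// lerD.
    have [bf pf] := sf; split; last by move=> x k; rewrite pf pF.
    by apply: bounded_measurableD => //; split => //; exists B.
  split; last by apply/prevalid_cat; rewrite E1.
  by rewrite exec_cat E1 E2; apply/funext => x; rewrite addrA.
- by rewrite flux_cat lerD.
- by rewrite cost_cat lerD.
- by rewrite shear_time_cat; move: P1t P2t; lra.
Qed.

Lemma realizes_ext F G A c : F =1 G -> realizes F A c -> realizes G A c.
Proof. by move=> /funext ->. Qed.

(** The mass is squeezed into the core at the source and spread out again at the target; as jumps
    are additive, [L1] and [L2] may both follow the program for the core. Thinness bounds their flux
    by a quarter of the weight, and the core takes another quarter. *)
Lemma thin_realizes S : amp S != 0 ->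
  halving_factor p * (d%:R * \big[Num.max/0]_(l | l != dir S) side (lev S) l `^ p^-1)
    <= len S `^ p^-1 / 4 ->
  realizes (slot_fun S) (weight p S / 2) (2 * K * weight p S).
Proof.
move=> aS thin M eps M0 eps0.
have [j jS] : exists j : 'I_d, j != dir S.
  have : (0 < #|predC1 (dir S)|)%N by rewrite cardC1 card_ord -subn1 subn_gt0.
  by case/card_gt0P => j; rewrite !inE => jS; exists j.
have m0 : 0 < m by rewrite ltr0n -subn1 subn_gt0.
have := tube_realizable p q s st K gam p1 q1 s1 st1 KE gam0 gamp sig1 m0 kap0 S j M eps
  aS jS M0 eps0.
(* Above all levels of [S], so that concentration to level [N] ends exactly in the core. *)
move=> [N0 _ HN]; pose N := maxn N0 (\max_l lev S l).
have [P0 [P0F P0A P0c P0t]] : exists P,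
  [/\ forall f, state f -> (forall x, `|f x| <= M) ->
        exec P f = (fun x => f x + slot_fun (core S N) x) /\ prevalid p q s st K P f,
      flux p P <= weight p S / 4, cost P <= 2 * K * weight p S & shear_time P <= eps].
  by apply: HN; rewrite /= leq_maxl.
pose ds := [seq l <- index_enum 'I_d | l != dir S].
have nN : (fun l => if l \in ds then maxn (lev S l) N else lev S l) = core_lev S N.
  apply/funext => l; rewrite mem_filter mem_index_enum andbT /core_lev.
  case: eqP => //= _; apply/maxn_idPr; rewrite (leq_trans _ (leq_maxr _ _))//.
  exact: (leq_bigmax l).
have [L1 [b1 [L1sum b1E L1w]]] := concentrate p p1 (corner S) N ds (lev S) (amp S).
(* The amplitude is reversed: at the target the core is spread back over the box. *)
have [L2 [b2 [L2sum b2E L2w]]] := concentrate p p1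
  (corner S + len S *: basis_vec (dir S)) N ds (lev S) (- amp S).
rewrite nN in L1sum b1E L2sum b2E.
have V0 := vol_gt0 (R := R) (core_lev S N).
have b1E' : b1 = amp (core S N) by rewrite /= -b1E mulfK// gt_eqF.
have b2E' : b2 = - amp (core S N).
  by apply: (mulIf (lt0r_neq0 V0)); rewrite b2E /= !mulNr divfK// gt_eqF.
have Fsum x : slot_fun (core S N) x + \sum_(J <- L1 ++ L2) slot_fun J x = slot_fun S x.
  rewrite big_cat/= L1sum L2sum b1E' b2E' /slot_fun len_core.
  by rewrite !(ib_shift _ _ _ (- (len S *: basis_vec (dir S)))) !opprK /=; ring.
have thin' : halving_factor p * \sum_(l <- ds) side (lev S) l `^ p^-1 <= len S `^ p^-1 / 4.
  apply: le_trans thin; apply: ler_wpM2l; first exact: halving_factor_ge0.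
  rewrite big_filter.
  pose mx : R := \big[Num.max/0]_(l | l != dir S) side (lev S) l `^ p^-1.
  rewrite -/mx.
  apply: le_trans (_ : \sum_(l | l != dir S) mx <= _).
    by apply: ler_sum => l lS; rewrite /mx; exact: (le_bigmax_cond _ (fun l => side (lev S) l `^ p^-1)).
  have mx0 : 0 <= mx by exact: bigmax_ge_id.
  rewrite sumr_const cardC1 card_ord -[leLHS]mulr_natl ler_wpM2r// ler_nat.
  exact: leq_pred.
have Lw : \sum_(J <- L1 ++ L2) weight p J <= weight p S / 4.
  rewrite big_cat/=; apply: le_trans (lerD L1w L2w) _.
  rewrite normrN -/(mass S) -mulrDl.
  have -> : mass S / 2 * halving_factor p + mass S / 2 * halving_factor p =
    mass S * halving_factor p by field.
  rewrite -mulrA /weight -[leRHS]mulrA; apply: ler_wpM2l => //; exact: mass_ge0.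
exists (P0 ++ jumps (L1 ++ L2)); split.
- move=> f sf fM; have [E0 v0] := P0F f sf fM; split.
    rewrite exec_cat E0 exec_jumps; apply/funext => x.
    by rewrite -addrA Fsum.
  by apply/prevalid_cat; split => //; exact: prevalid_jumps.
- rewrite flux_cat flux_jumps; apply: le_trans (lerD P0A Lw) _.
  by rewrite le_eqVlt; apply/orP; left; apply/eqP; field.
- by rewrite cost_cat cost_jumps addr0.
- by rewrite shear_time_cat shear_time_jumps addr0.
Qed.

(** Halving the box across [e_i] gives two parallel slots of the same length and half the weight,
    and the bounds are linear in the weight. *)
Lemma split_realizes (i l : 'I_d) (a : R) (n : 'I_d -> nat) : l != i ->
  (forall lo, let S := Slot a lo (deepen n l 1) i in
     realizes (slot_fun S) (weight p S / 2) (2 * K * weight p S)) ->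
  forall lo, let S := Slot a lo n i in
     realizes (slot_fun S) (weight p S / 2) (2 * K * weight p S).
Proof.
move=> li H lo S; pose S1 := Slot a lo (deepen n l 1) i.
pose e := side (deepen n l 1) l *: basis_vec l : 'rV[R]_d.
pose S2 := Slot a (lo + e) (deepen n l 1) i.
have len1 : len S1 = len S by rewrite /len/= side_deepen eq_sym (negbTE li) mulr1.
have W1 : weight p S1 = weight p S / 2.
  by rewrite /weight len1 /mass/= vol_deepen expr1; ring.
have W2 : weight p S2 = weight p S / 2 by rewrite -W1.
have E x : slot_fun S1 x + slot_fun S2 x = slot_fun S x.
  rewrite /slot_fun -[len S2]/(len S1) len1/= !(ib_halve lo n l) -/e.
  rewrite !(ib_shift _ _ _ (- e)) !opprK.
  by ring.
apply: realizes_ext E _.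
have := realizes_add _ _ _ _ _ _ (state_slot_fun S1) (H lo) (H (lo + e)).
rewrite -/S1 -/S2 W1 W2.
have -> : weight p S / 2 / 2 + weight p S / 2 / 2 = weight p S / 2 by field.
by have -> : 2 * K * (weight p S / 2) + 2 * K * (weight p S / 2) = 2 * K * weight p S by field.
Qed.

Lemma split_realizes_iter (i l : 'I_d) (a : R) (k : nat) (n : 'I_d -> nat) : l != i ->
  (forall lo, let S := Slot a lo (deepen n l k) i in
     realizes (slot_fun S) (weight p S / 2) (2 * K * weight p S)) ->
  forall lo, let S := Slot a lo n i in
     realizes (slot_fun S) (weight p S / 2) (2 * K * weight p S).
Proof.
move=> li; elim: k n => [|k IH] n H.
  suff <- : deepen n l 0 = n by [].
  by apply/funext => l'; rewrite /deepen addn0; case: ifP.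
apply: (split_realizes _ _ _ _ li); apply: IH.
suff -> : deepen (deepen n l 1) l k = deepen n l k.+1 by [].
by apply/funext => l'; rewrite /deepen; case: eqP => // _; rewrite -addnA add1n.
Qed.

Lemma split_realizes_all (i : 'I_d) (a : R) (k : nat) (ds : seq 'I_d) (n : 'I_d -> nat) :
  uniq ds -> i \notin ds ->
  (forall lo, let S := Slot a lo (fun l => if l \in ds then (n l + k)%N else n l) i in
     realizes (slot_fun S) (weight p S / 2) (2 * K * weight p S)) ->
  forall lo, let S := Slot a lo n i in
     realizes (slot_fun S) (weight p S / 2) (2 * K * weight p S).
Proof.
elim: ds n => [//|l ds IH] n /= /andP[lds uds]; rewrite in_cons negb_or => /andP[il ids] H.
apply: (split_realizes_iter _ l _ k); first by rewrite eq_sym.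
apply: (IH _ uds ids).
suff -> : (fun l' => if l' \in ds then (deepen n l k l' + k)%N else deepen n l k l') =
    (fun l' => if l' \in l :: ds then (n l' + k)%N else n l') by [].
apply/funext => l'; rewrite in_cons /deepen.
by case: (eqVneq l' l) => [->|//]; rewrite (negbTE lds).
Qed.

(** Concentration costs a multiple of the transverse sides to the power [1/p]. Splitting [k] times
    in every transverse direction keeps the length and shrinks these sides until that is small
    against [len^(1/p)]. *)
Lemma slot_realizes S : realizes (slot_fun S) (weight p S / 2) (2 * K * weight p S).
Proof.
have [a0|a0] := eqVneq (amp S) 0.
  have W0 : weight p S = 0 by rewrite /weight /mass a0 normr0 !mul0r.
  rewrite W0 mul0r mulr0 => M eps M0 eps0; exists [::]; split.
  - move=> f sf fM; split => //; apply/funext => x.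
    by rewrite /slot_fun a0 mul0r addr0.
  - by rewrite /flux big_nil.
  - by rewrite /cost big_nil.
  - by rewrite /shear_time big_nil ltW.
have p0 : 0 < p by exact: lt_trans ltr01 p1.
case: S a0 => a lo n i /= a0.
pose S0 := Slot a lo n i.
have l4 : 0 < len S0 `^ p^-1 / 4 by rewrite divr_gt0// powR_gt0// side_gt0.
have [k _ Hk] : \forall k \near \oo,
    halving_factor p * d%:R * (2^-1 ^+ k) `^ p^-1 <= len S0 `^ p^-1 / 4.
  by apply: small_power => //; rewrite invr_gt0.
pose ds := [seq l <- index_enum 'I_d | l != i].
apply: (split_realizes_all i a k ds n) => [||lo' S].
- by rewrite /ds filter_uniq// index_enum_uniq.
- by rewrite /ds mem_filter eqxx.
apply: thin_realizes => //.
have lenE : len S = len S0 by rewrite /len /side/= /ds mem_filter eqxx.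
rewrite lenE; apply: le_trans (Hk k _); last exact: leqnn.
rewrite -mulrA; apply: ler_wpM2l; first exact: halving_factor_ge0.
apply: ler_wpM2l => //; apply: bigmax_le; first exact: powR_ge0.
move=> l li; apply: ge0_ler_powR.
- by rewrite invr_ge0 ltW.
- by rewrite nnegrE ltW// side_gt0.
- by rewrite nnegrE exprn_ge0// invr_ge0.
rewrite /side/= /ds mem_filter li mem_index_enum/=.
by rewrite exprD ler_piMl ?exprn_ge0 ?invr_ge0// exprn_ile1// ?invr_ge0// invf_le1// ler1n.
Qed.

End realizations.

(** * Refining a program *)

Section refinement.
Context {R : realType} {d : nat} (p q s st K : R).
Local Notation tor := (@torus R d).
Implicit Types (f : 'rV[R]_d -> R) (a : @step R d) (P : seq (@step R d)).

Definition valid1 a f : Prop := wf1 a /\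
  match a.2 with
  | Jump J B => forall x, `|f x| <= B /\ `|f x + slot_fun J x| <= B
  | Shear _ _ _ _ Q => shear_norms p q s st K a f Q
  end.

Fixpoint valid P f : Prop :=
  if P is a :: P' then valid1 a f /\ valid P' (exec1 a f) else True.

(* At least 1 on jumps, and at least the bound of the state: a small [rest_cost]
   makes both the total duration of the jumps and the norms during them small. *)
Definition rest_bound a : R :=
  match a.2 with Jump _ B => (1 + B) `^ s | Shear _ _ _ _ _ => 0 end.

Definition rest_cost P : R := \sum_(a <- P) a.1 * rest_bound a.

Definition amplitudes P : R :=
  \sum_(a <- P) match a.2 with Jump J _ => `|amp J| | Shear _ _ _ _ _ => 0 end.

Definition jump_count P : nat :=
  count (fun a => match a.2 with Jump _ _ => true | Shear _ _ _ _ _ => false end) P.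

Definition fill1 (delta B : R) a : step :=
  match a.2 with Jump J _ => (delta, Jump J B) | Shear _ _ _ _ _ => a end.

Definition fill (delta B : R) P := map (fill1 delta B) P.

Lemma valid_wf P f : valid P f -> wf P.
Proof. by elim: P f => [//|a P IH] f [[wa _] /IH]. Qed.

Lemma valid_cons a P f : valid (a :: P) f <-> valid1 a f /\ valid P (exec1 a f).
Proof. by []. Qed.

Lemma valid_cat P1 P2 f : valid (P1 ++ P2) f <-> valid P1 f /\ valid P2 (exec P1 f).
Proof.
elim: P1 f => [|a P1 IH] f /=; first by split => // -[].
by rewrite IH; split => [[? []]|[[]]].
Qed.

Lemma exec1_fill delta B a f : exec1 (fill1 delta B a) f = exec1 a f.
Proof. by case: a => t [J B'|//]; rewrite /fill1/= !exec1_jump. Qed.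

Lemma exec_fill delta B P f : exec (fill delta B P) f = exec P f.
Proof.
elim: P f => [//|a P IH] f.
by rewrite /fill map_cons !exec_cons exec1_fill -/(fill delta B P) IH.
Qed.

Lemma flux_fill delta B P : flux p (fill delta B P) = flux p P.
Proof. by rewrite /flux big_map; apply: eq_bigr => -[t []]. Qed.

Lemma cost_fill delta B P : cost (fill delta B P) = cost P.
Proof. by rewrite /cost big_map; apply: eq_bigr => -[t []]. Qed.

Lemma duration_fill delta B P :
  duration (fill delta B P) = shear_time P + (jump_count P)%:R * delta.
Proof.
elim: P => [|[t [J B'|i c r h Q]] P IH]; rewrite /fill/= -?/(fill delta B P).
- by rewrite /duration /shear_time !big_nil mul0r addr0.
- rewrite duration_cons IH /shear_time big_cons /jump_count/= natrD.
  by ring.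
- by rewrite duration_cons IH /shear_time big_cons /jump_count/= add0n; ring.
Qed.

Lemma rest_cost_fill delta B P :
  rest_cost (fill delta B P) = (jump_count P)%:R * (delta * (1 + B) `^ s).
Proof.
elim: P => [|[t [J B'|i c r h Q]] P IH]; rewrite /fill/= -?/(fill delta B P).
- by rewrite /rest_cost big_nil mul0r.
- by rewrite /rest_cost big_cons -/(rest_cost _) IH /jump_count/= natrD mulrDl mul1r.
- by rewrite /rest_cost big_cons -/(rest_cost _) IH /jump_count/= add0n mulr0 add0r.
Qed.

Lemma amplitudes_ge0 P : 0 <= amplitudes P.
Proof. by apply: sumr_ge0 => -[t []]. Qed.

(** Shears preserve a supremum bound and each jump adds at most [|amp J|], so [M + amplitudes P]
    bounds the state throughout. *)
Lemma valid_fill delta B P f M : 0 < delta -> 0 <= M -> M + amplitudes P <= B ->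
  (forall x, `|f x| <= M) -> prevalid p q s st K P f -> valid (fill delta B P) f.
Proof.
move=> delta0; elim: P f M => [//|[t [J B'|i c r h Q]] P IH] f M M0 MB fM [vf vP].
  rewrite /amplitudes big_cons/= -/(amplitudes P) in MB.
  have A0 := amplitudes_ge0 P; have J0 : 0 <= `|amp J| by [].
  have fJ x : `|f x + slot_fun J x| <= M + `|amp J|.
    by rewrite (le_trans (ler_normD _ _))// lerD// slot_fun_le.
  split; last first.
    rewrite exec1_fill; apply: (IH _ (M + `|amp J|)) => //.
    - by rewrite addr_ge0.
    - by rewrite -addrA.
    - by move=> x; rewrite exec1_jump.
  split => [|x]; first by split => //=; lra.
  by split; [apply: le_trans (fM x) _ | apply: le_trans (fJ x) _]; lra.
rewrite /amplitudes big_cons/= add0r -/(amplitudes P) in MB.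
have [wa na] := vf; split; first by split.
apply: (IH _ M) => // x; rewrite exec1_shear ?fM//.
by case: wa => t0 _; rewrite gt_eqF.
Qed.

Hypotheses (p1 : 1 < p) (q1 : 1 <= q) (s1 : 1 <= s).
Hypothesis K0 : 0 <= K.
Hypothesis realization : forall J : @slot R d,
  realizes p q s st K (slot_fun J) (weight p J / 2) (2 * K * weight p J).

(** A shear of size 0 is a pause that refinement leaves alone, unlike the rest after a jump;
    [(1 + B)^s] is the price of holding a state bounded by [B]. *)
Lemma valid_idle (i : 'I_d) (t B : R) f : 0 < t -> 0 <= B -> state f ->
  (forall x, `|f x| <= B) ->
  valid [:: (t, Shear i 0 (1 / 8) 0 ((1 + B) `^ s))] f.
Proof.
move=> t0 B0 [[mf _] _] fB; have s0 : 0 < s by exact: lt_le_trans ltr01 s1.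
have z0 (r : R) (g : 'rV[R]_d -> R) (C : R) : 0 < r -> 0 <= C -> (forall x, g x = 0) ->
    (Lnorm tor r%:E (fun x => (g x)%:E) <= C%:E)%E.
  move=> r0 C0 g0; rewrite (_ : g = fun=> 0); last exact/funext.
  by apply: Lnorm_le_cst => // x; rewrite normr0.
have q0 : 0 < q by exact: lt_le_trans ltr01 q1.
have pc0 : 0 < p / (p - 1) by rewrite divr_gt0 ?subr_gt0// (lt_trans ltr01).
split => //; split.
  by split => //=; split; [lra|exact: lexx|exact: powR_ge0].
split.
- have -> : ((1 + B) `^ s) `^ s^-1 = 1 + B.
    by rewrite -powRrM divff ?gt_eqF// powRr1// addr_ge0.
  apply: Lnorm_le_cst => //; first exact: lt_trans ltr01 p1.
    by rewrite addr_ge0.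
  by move=> x; rewrite (le_trans (fB x))// lerDr.
- apply: z0 => //; first by rewrite mulr_ge0// powR_ge0.
  by move=> x; rewrite /speed/= !mul0r.
- apply: z0 => //; first by rewrite powR_ge0.
  by move=> x; rewrite /speed/= !mul0r.
- move=> k l; apply: z0 => //; first by rewrite powR_ge0.
  by move=> x; rewrite /dvel1/= !mul0r; case: ifP.
Qed.

Lemma exec_idle (i : 'I_d) (t r Q : R) c f : t != 0 ->
  exec [:: (t, Shear i c r 0 Q)] f = f.
Proof.
move=> t0; rewrite exec_cons exec1_shear//; apply/funext => x.
by rewrite /exec/= mul0r scale0r subr0.
Qed.

(** The shears take at most half of [delta], the rests after the new jumps at most a quarter, and
    the time left over is spent idle. The idle time costs no more than the rest of the old jump
    did. *)
Lemma refine_jump (delta B eps : R) (J : slot) : 0 < delta -> 0 <= B -> 0 < eps ->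
  exists P,
  [/\ forall f, state f -> (forall x, `|f x| <= B /\ `|f x + slot_fun J x| <= B) ->
        exec P f = exec1 (delta, Jump J B) f /\ valid P f,
      duration P = delta,
      flux p P <= weight p J / 2,
      cost P <= 2 * K * weight p J + delta * (1 + B) `^ s & rest_cost P <= eps].
Proof.
move=> delta0 B0 eps0; have d2 : 0 < delta / 2 by rewrite divr_gt0.
have [P0 [P0F P0A P0c P0t]] := realization J B _ B0 d2.
pose B' := B + amplitudes P0; pose N : R := (jump_count P0)%:R.
have N0 : 0 <= N by exact: ler0n.
have B'0 : 0 <= B' by rewrite addr_ge0// amplitudes_ge0.
have b0 : 0 < (1 + B') `^ s by rewrite powR_gt0// ltr_pwDl.
(* The two terms of the minimum control the total time of the rests and their cost; [N + 1] in place
   of [N] allows for a program without jumps. *)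
pose eta := Num.min (delta / 4) (eps / (1 + B') `^ s) / (N + 1).
have N1 : 0 < N + 1 by rewrite ltr_wpDl.
have mn0 : 0 < Num.min (delta / 4) (eps / (1 + B') `^ s).
  by rewrite lt_min !divr_gt0.
have eta0 : 0 < eta by rewrite divr_gt0.
have Neta : N * eta <= Num.min (delta / 4) (eps / (1 + B') `^ s).
  rewrite /eta mulrCA ger_pMr// ler_pdivrMr// mul1r; lra.
pose D := duration (fill eta B' P0).
have DE : D = shear_time P0 + N * eta by exact: duration_fill.
have Dd : D < delta.
  have : N * eta <= delta / 4 by rewrite (le_trans Neta)// ge_min lexx.
  by rewrite DE; lra.
have idle0 : 0 < delta - D by rewrite subr_gt0.
(* The duration does not depend on the state, so well-formedness may be read off from the zero
   state. *)
have D0 : 0 <= D.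
  have sz : state (fun _ : 'rV[R]_d => 0 : R) by split => //; exact: bounded_measurable_cst.
  have zB (x : 'rV[R]_d) : `|0 : R| <= B by rewrite normr0.
  have [_ v0] := P0F _ sz zB.
  have := valid_fill eta B' P0 _ B eta0 B0 (lexx _) zB v0.
  by move/valid_wf; exact: duration_ge0.
exists (fill eta B' P0 ++ [:: (delta - D, Shear (dir J) 0 (1 / 8) 0 ((1 + B) `^ s))]); split.
- move=> f sf fB; have [E0 v0] := P0F f sf (fun x => (fB x).1).
  have E1 : exec (fill eta B' P0) f = fun x => f x + slot_fun J x.
    by rewrite exec_fill.
  split; first by rewrite exec_cat E1 exec_idle ?gt_eqF// exec1_jump.
  apply/valid_cat; split.
    by apply: (valid_fill _ _ _ _ B) => // x; case: (fB x).
  rewrite E1; apply: valid_idle => // [|x]; last by case: (fB x).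
  have [bf pf] := sf; have [bj pj] := state_slot_fun J.
  by split; [exact: bounded_measurableD | move=> x k; rewrite pf pj].
- by rewrite duration_cat /duration big_seq1/= -/(duration _) -/D addrC subrK.
- rewrite flux_cat flux_fill /flux big_seq1 /jump_flux/= addr0.
  exact: P0A.
- rewrite cost_cat cost_fill lerD// /cost big_seq1/= ler_wpM2r ?powR_ge0//.
  by rewrite gerBl.
- rewrite /rest_cost big_cat/= -/(rest_cost _) rest_cost_fill -/N big_seq1/= mulr0 addr0.
  have : N * eta <= eps / (1 + B') `^ s by rewrite (le_trans Neta)// ge_min lexx orbT.
  by rewrite ler_pdivlMr// mulrA.
Qed.

End refinement.

Section refinement_step.
Context {R : realType} {d : nat} (p q s st K : R).
Implicit Types (f : 'rV[R]_d -> R) (a : @step R d) (P : seq (@step R d)).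
Hypotheses (p1 : 1 < p) (q1 : 1 <= q) (s1 : 1 <= s).
Hypothesis K0 : 0 <= K.
Hypothesis realization : forall J : @slot R d,
  realizes p q s st K (slot_fun J) (weight p J / 2) (2 * K * weight p J).

(** A jump is replaced by a program with the same duration and the same effect, so all later steps
    start at the same times from the same states. Outside the rests of [P] nothing changes, for any
    [h]. *)
Lemma refine_program P f (eps : R) : state f -> valid p q s st K P f -> 0 < eps ->
  exists P',
  [/\ duration P' = duration P, exec P' f = exec P f /\ valid p q s st K P' f,
      flux p P' <= flux p P / 2,
      cost P' <= cost P + 2 * K * flux p P + rest_cost s P &
      rest_cost s P' <= eps /\
      forall h t x, 0 <= t -> piece rest1 P f t 0 = 0 ->
        piece h P' f t x = piece h P f t x].
Proof.
elim: P f eps => [|a P IH] f eps sf.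
  move=> _ eps0; exists [::]; split => //.
  - by rewrite /flux big_nil mul0r.
  - by rewrite /flux /cost /rest_cost !big_nil mulr0 !addr0.
  - by split => //; rewrite /rest_cost big_nil ltW.
move=> /valid_cons[va vP] eps0; have wa : wf1 a by case: va.
have e2 : 0 < eps / 2 by rewrite divr_gt0.
have [P' [dP' [eP' vP'] fP' cP' [rP' aP']]] := IH _ _ (state_exec1 _ _ wa sf) vP e2.
case: a va wa vP eP' vP' aP' => t [J B|i c r h Q] va wa vP eP' vP' aP'.
  have [t0 B0] := wa; have [_ fB] := va.
  have [L [LF dL fL cL rL]] := refine_jump p q s st K p1 q1 s1 K0 realization t B _ J t0 B0 e2.
  have [eL vL] := LF f sf fB.
  have wL := valid_wf _ _ _ _ _ _ _ vL.
  exists (L ++ P'); split.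
  - by rewrite duration_cat dL dP' duration_cons.
  - by split; [rewrite exec_cat eL eP' exec_cons | apply/valid_cat; rewrite eL].
  - rewrite flux_cat [in leRHS]/flux big_cons -/(flux _ _) mulrDl lerD//.
  - rewrite cost_cat /cost /flux /rest_cost !big_cons/= -!/(cost _) -!/(flux _ _) -!/(rest_cost _ _).
    by move: cL cP'; rewrite /jump_flux /rest_bound /weight/=; lra.
  - split.
      rewrite /rest_cost big_cat/= -!/(rest_cost _ _); lra.
    move=> h u x u0 /=; case: ltP => [ut|tu].
      by rewrite /rest1/= => /eqP; rewrite oner_eq0.
    move=> H; rewrite piece_cat// dL ltNge tu/= eL aP' ?subr_ge0//.
exists ((t, Shear i c r h Q) :: P'); split.
- by rewrite !duration_cons dP'.
- by split; [rewrite !exec_cons | apply/valid_cons].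
- by rewrite /flux !big_cons /jump_flux/= !add0r.
- have c1 L : cost ((t, Shear i c r h Q) :: L) = t * Q + cost L by rewrite /cost big_cons.
  have f1 L : flux p ((t, Shear i c r h Q) :: L) = flux p L by rewrite /flux big_cons add0r.
  have r1 L : rest_cost s ((t, Shear i c r h Q) :: L) = rest_cost s L.
    by rewrite /rest_cost big_cons/= mulr0 add0r.
  by rewrite !c1 f1 r1 -!addrA lerD2l addrA.
- split.
    by rewrite /rest_cost big_cons/= /rest_bound/= mulr0 add0r -/(rest_cost _ _); lra.
  move=> h' u x u0 /=; case: ltP => // tu H.
  by rewrite aP'// subr_ge0.
Qed.

Lemma program_sequence P0 f : state f -> valid p q s st K P0 f ->
  exists Ps : nat -> seq (@step R d), Ps 0%N = P0 /\ forall n,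
  [/\ duration (Ps n) = duration P0,
      exec (Ps n) f = exec P0 f /\ valid p q s st K (Ps n) f,
      flux p (Ps n) <= flux p P0 / 2 ^+ n,
      cost (Ps n.+1) <= cost (Ps n) + 2 * K * flux p (Ps n) + rest_cost s (Ps n) &
      rest_cost s (Ps n.+1) <= (2^-1) ^+ n /\
      forall h t x, 0 <= t -> piece rest1 (Ps n) f t 0 = 0 ->
        piece h (Ps n.+1) f t x = piece h (Ps n) f t x].
Proof.
move=> sf v0.
(* The index is part of the argument of the choice function, so that the tolerance [2^-n] can depend
   on it. *)
have next (z : nat * seq (@step R d)) : exists P', valid p q s st K z.2 f ->
  [/\ duration P' = duration z.2, exec P' f = exec z.2 f /\ valid p q s st K P' f,
      flux p P' <= flux p z.2 / 2,
      cost P' <= cost z.2 + 2 * K * flux p z.2 + rest_cost s z.2 &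
      rest_cost s P' <= 2^-1 ^+ z.1 /\
      forall h t x, 0 <= t -> piece rest1 z.2 f t 0 = 0 ->
        piece h P' f t x = piece h z.2 f t x].
  have [v|v] := pselect (valid p q s st K z.2 f); last by exists [::].
  have e0 : (0 : R) < 2^-1 ^+ z.1 by rewrite exprn_gt0// invr_gt0.
  by have [P' H] := refine_program z.2 f _ sf v e0; exists P'.
have [nx nxP] := choice next.
pose Ps := fix Ps n := if n is k.+1 then nx (k, Ps k) else P0.
have vPs n : valid p q s st K (Ps n) f.
  by elim: n => [//|n IH]; have [_ [_ ?]] := nxP (n, Ps n) IH.
exists Ps; split => // n; have [_ _ _ cn rn] := nxP (n, Ps n) (vPs n).
have : [/\ duration (Ps n) = duration P0, exec (Ps n) f = exec P0 f &
    flux p (Ps n) <= flux p P0 / 2 ^+ n].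
  elim: n {cn rn} => [|n [dn en fn]]; first by rewrite expr0 divr1.
  have [dS [eS _] fS _ _] := nxP (n, Ps n) (vPs n); rewrite /= in dS eS fS *.
  split; [by rewrite dS|by rewrite eS|].
  apply: le_trans fS _; rewrite exprSr invfM mulrA ler_wpM2r// invr_ge0//.
by move=> [dn en fn]; split.
Qed.

End refinement_step.

Section piece_integrals.
Context {R : realType} {d : nat}.
Local Notation leb := (@lebesgue_measure R).
Implicit Types (f : 'rV[R]_d -> R) (a : @step R d) (P : seq (@step R d)).

(** Both the cost and the rest cost of a program are time integrals of this kind. *)
Lemma integral_piece_constant (g : @step R d -> R) P f (t0 : R) :
  wf P -> (forall a, 0 <= g a) ->
  (\int[leb]_(t in `[t0, (t0 + duration P)%R[) (piece (fun a _ _ _ => g a) P f (t - t0) 0)%:E =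
   (\sum_(a <- P) a.1 * g a)%:E)%E.
Proof.
move=> + g0; elim: P f t0 => [|a P IH] f t0.
  by move=> _; rewrite /duration !big_nil addr0 set_itvco0 integral_set0.
move=> [[a0 _] wP]; have D0 := duration_ge0 _ wP.
have t01 : t0 <= t0 + a.1 by rewrite lerDl ltW.
have U1 : `[t0, (t0 + a.1 + duration P)%R[%classic =
    `[t0, t0 + a.1[%classic `|` `[t0 + a.1, (t0 + a.1 + duration P)%R[%classic.
  by rewrite -itv_bndbnd_setU// bnd_simp// lerDl.
have E1 t : t \in `[t0, t0 + a.1[%classic ->
    piece (fun a _ _ _ => g a) (a :: P) f (t - t0) 0 = g a.
  by rewrite inE/= in_itv/= => /andP[_ tt]; rewrite ltrBlDl tt.
have E2 t : t \in `[t0 + a.1, (t0 + a.1 + duration P)%R[%classic ->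
    piece (fun a _ _ _ => g a) (a :: P) f (t - t0) 0 =
    piece (fun a _ _ _ => g a) P (exec1 a f) (t - (t0 + a.1)) 0.
  rewrite inE/= in_itv/= => /andP[tt _].
  by rewrite ltNge lerBrDl tt/= opprD addrA.
rewrite duration_cons addrA U1.
have mP Q f' u0 : measurable_fun setT (fun t : measurableTypeR R =>
    (piece (fun a _ _ _ => g a) Q f' (t - u0) 0)%:E).
  apply/measurable_EFinP; elim: Q f' u0 {E1 E2 U1 D0 wP IH} => [|b Q IH] f' u0 /=.
    exact: measurable_cst.
  apply: measurable_fun_ifT.
  - by apply: measurable_fun_ltr => //; exact: measurable_funB.
  - exact: measurable_cst.
  - by under eq_fun do rewrite -addrA -opprD; exact: IH.
have pos Q f' u : 0 <= piece (fun a _ _ _ => g a) Q f' u 0.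
  by elim: Q f' u {E1 E2 U1 D0 wP IH} => //= b Q IH f' u; case: ifP.
rewrite ge0_integral_setU//=; first last.
- apply/disj_setPS => x /=; rewrite !in_itv/= => -[/andP[_ xb] /andP[bx _]].
  by move: (lt_le_trans xb bx); rewrite ltxx.
- by move=> t _; rewrite lee_fin; exact: (pos (a :: P)).
- by apply: measurable_funTS; exact: (mP (a :: P)).
rewrite big_cons EFinD; congr (_ + _)%E.
  transitivity (\int[leb]_(t in `[t0, (t0 + a.1)%R[) (g a)%:E)%E.
    by apply: eq_integral => t /E1 /= ->.
  rewrite integral_cst//= lebesgue_measure_itv/= lte_fin ltrDl a0 -EFinB.
  by rewrite [t0 + _]addrC addrK muleC.
rewrite -(IH (exec1 a f) (t0 + a.1) wP).
by apply: eq_integral => t /E2 /= ->.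
Qed.

End piece_integrals.

(** * The limit *)

Section slices.
Context {R : realType} {d : nat} (p q s st K : R).
Local Notation tor := (@torus R d).
Local Notation N_ p f := (Lnorm tor p%:E (fun x => (f x)%:E)).
Implicit Types (f : 'rV[R]_d -> R) (a : @step R d) (P : seq (@step R d)).
Let pc := p / (p - 1).
Hypotheses (p1 : 1 < p) (q1 : 1 <= q) (s1 : 1 <= s) (st1 : 1 <= st) (K0 : 0 <= K).

(* The powers of [Q] are those for which a bound on the time integral of [Q] gives
   [rho] in L^s(L^p), [v] in L^s'(L^p') and [v], [dv] in L^st(L^q). *)
Definition slice_ok (rho : 'rV[R]_d -> R) (v : 'I_d -> 'rV[R]_d -> R)
    (dv : 'I_d -> 'I_d -> 'rV[R]_d -> R) (Q : R) : Prop :=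
  [/\ [/\ state rho, forall k, bounded_measurable (v k) & 0 <= Q],
      (N_ p rho <= (Q `^ s^-1)%:E)%E,
      forall k, (N_ pc (v k) <= (K * Q `^ (1 - s^-1))%:E)%E,
      (forall k, (N_ q (v k) <= (Q `^ st^-1)%:E)%E) /\
        forall k l, (N_ q (dv k l) <= (Q `^ st^-1)%:E)%E &
      (forall k l, weak_partial l (v k) (dv k l)) /\ forall k x, dv k k x = 0].

Lemma Lnorm_zero (r C : R) : 0 < r -> 0 <= C -> (N_ r (fun=> 0%R) <= C%:E)%E.
Proof. by move=> r0 C0; apply: Lnorm_le_cst => // x; rewrite normr0. Qed.

Let pc0 : 0 < pc.
Proof. by rewrite /pc divr_gt0 ?subr_gt0// (lt_trans ltr01). Qed.

Lemma weak_partial_zero (l : 'I_d) : weak_partial l (fun=> 0%R : R) (fun=> 0%R).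
Proof.
move=> phi _; under eq_Rintegral do rewrite mul0r.
under [in RHS]eq_Rintegral do rewrite mul0r.
by rewrite Rintegral_cst// mul0r oppr0.
Qed.

Lemma slice_zero : slice_ok (fun=> 0) (fun _ _ => 0) (fun _ _ _ => 0) 0.
Proof.
have p0 : 0 < p by exact: lt_trans ltr01 p1.
have q0 : 0 < q by exact: lt_le_trans ltr01 q1.
split.
- by split => // [|k]; [split => //|]; exact: bounded_measurable_cst.
- by apply: Lnorm_zero => //; exact: powR_ge0.
- by move=> k; apply: Lnorm_zero => //; rewrite mulr_ge0 ?powR_ge0.
- by split => [k|k l]; apply: Lnorm_zero => //; exact: powR_ge0.
- by split => // k l; exact: weak_partial_zero.
Qed.

(** Shears preserve measure, so the norm recorded at the start of a shear persists during it. *)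
Lemma Lnorm_rho1 a f (r t : R) : wf1 a -> state f -> (forall x, kick a f x = f x) ->
  N_ r (rho1 a f t) = N_ r f.
Proof.
move=> wa [[mf _] pf] kf; have [[mv _] pv gv] := speed_spec a wa.
rewrite unlock; congr (_ `^ _)%E.
have := ge0_integral_torus_shear d (direction a) (fun x => - (t * speed a x))
  (fun x => `|(f x)%:E| `^ r)%E.
have -> : (\int[tor]_x `|(rho1 a f t x)%:E| `^ r =
   \int[tor]_x (fun y => `|(f y)%:E| `^ r) (x + - (t * speed a x) *: basis_vec (direction a))%R)%E.
  by apply: eq_integral => x _; rewrite /rho1 kf scaleNr.
apply.
- by apply: measurableT_comp => //; exact: measurable_funM.
- by move=> u x; rewrite gv.
- apply/measurable_EFinP; apply: (measurableT_comp (measurable_powR r)).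
  exact: measurableT_comp.
- by move=> x; exact: poweR_ge0.
- by move=> x k; rewrite pf.
Qed.

Lemma weak_partialZ (l : 'I_d) (c : R) f g : bounded_measurable f -> bounded_measurable g ->
  weak_partial l f g -> weak_partial l (fun x => c * f x) (fun x => c * g x).
Proof.
move=> bf bg fg phi tphi.
have [sp pp] := tphi.
have bp : bounded_measurable phi.
  by apply: bounded_measurable_periodic => //; exact: smooth_continuous.
have bdp : bounded_measurable (partial l phi).
  apply: bounded_measurable_periodic; first exact: smooth_derive_continuous.
  exact: partial_periodic.
under eq_Rintegral do rewrite -mulrA; under [in RHS]eq_Rintegral do rewrite -mulrA.
rewrite !RintegralZl//; try by apply: bounded_measurable_integrable; exact: bounded_measurableM.
by rewrite (fg _ tphi) mulrN.
Qed.

Lemma slice_shear t i c r h Q f u : state f ->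
  valid1 p q s st K (t, Shear i c r h Q) f ->
  let a := (t, Shear i c r h Q) in
  slice_ok (rho1 a f u) (fun k => vel1 k a f u) (fun k l => dvel1 k l a f u) Q.
Proof.
move=> sf [wa [n1 n2 n3 n4]] a; have [t0 [r0 r8 Q0]] := wa.
have q0 : 0 < q by exact: lt_le_trans ltr01 q1.
have [bv pv gv] := speed_spec _ wa.
split.
- split => // [|k]; first exact: state_rho1.
  by rewrite /vel1; case: eqP => _ //; exact: bounded_measurable_cst.
- by rewrite Lnorm_rho1.
- move=> k; rewrite /vel1; case: eqP => _ //.
  by apply: Lnorm_zero => //; rewrite mulr_ge0 ?powR_ge0.
- split => [k|k l]; last exact: n4.
  by rewrite /vel1; case: eqP => _ //; apply: Lnorm_zero => //; exact: powR_ge0.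
- split => [k l|k x]; last first.
    by rewrite /dvel1/=; case: eqP => // ->; rewrite dpsi_dir mulr0.
  rewrite /vel1 /dvel1 /direction/=; case: eqP => _; last exact: weak_partial_zero.
  apply: weak_partialZ; [exact: bounded_measurable_psi|exact: bounded_measurable_dpsi|].
  exact: weak_partial_psi.
Qed.

Lemma piece_active P f t : valid p q s st K P f -> state f -> 0 <= t -> t < duration P ->
  exists a g u, [/\ valid1 p q s st K a g, state g, 0 <= u &
    forall h x, piece h P f t x = h a g u x].
Proof.
elim: P f t => [|a P IH] f t.
  by rewrite /duration big_nil => _ _ t0 /(le_lt_trans t0); rewrite ltxx.
move=> [va vP] sf t0 tD; have [ta|ta] := ltP t a.1.
  by exists a, f, t; split => // h x /=; rewrite ta.
have wa : wf1 a by case: va.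
have [||b [g [u [vb sg u0 E]]]] := IH _ (t - a.1) vP (state_exec1 _ _ wa sf).
- by rewrite subr_ge0.
- by rewrite ltrBlDl -duration_cons.
by exists b, g, u; split => // h x; rewrite /= ltNge ta/= E.
Qed.

Lemma slice_good P f t : valid p q s st K P f -> state f -> 0 <= t -> t < duration P ->
  piece rest1 P f t 0 = 0 ->
  slice_ok (piece rho1 P f t) (fun k => piece (vel1 k) P f t)
    (fun k l => piece (dvel1 k l) P f t) (piece bound1 P f t 0).
Proof.
move=> vP sf t0 tD; have [a [g [u [va sg u0 E]]]] := piece_active _ _ _ vP sf t0 tD.
rewrite !E; case: a va E => w [J B|i c r h Q] va E.
  by rewrite /rest1/= => /eqP; rewrite oner_eq0.
move=> _; rewrite (_ : piece rho1 P f t = rho1 (w, Shear i c r h Q) g u); last exact/funext.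
rewrite (_ : (fun k => piece (vel1 k) P f t) = fun k => vel1 k (w, Shear i c r h Q) g u); last first.
  by apply/funext => k; apply/funext => x.
rewrite (_ : (fun k l => piece (dvel1 k l) P f t) = fun k l => dvel1 k l (w, Shear i c r h Q) g u); last first.
  by apply/funext => k; apply/funext => l; apply/funext => x.
exact: slice_shear.
Qed.

Lemma norm_Rintegral_le (f g : 'rV[R]_d -> R) (A C : R) : bounded_measurable f ->
  bounded_measurable g -> (forall x, `|g x| <= A * `|f x|) -> 0 <= A ->
  (\int[tor]_x `|(f x)%:E| <= C%:E)%E -> `|\int[tor]_x g x| <= A * C.
Proof.
move=> bf bg gf A0 fC.
have bnf : bounded_measurable (fun x => `|f x|).
  by have [mf [M HM]] := bf; split; [exact: measurableT_comp|exists M => x; rewrite normr_id].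
apply: le_trans (le_normr_Rintegral _ _) _ => //; first exact: bounded_measurable_integrable.
apply: (@le_trans _ _ (\int[tor]_x (A * `|f x|))).
  apply: le_Rintegral => //.
  - apply: bounded_measurable_integrable.
    by have [mg [M HM]] := bg; split; [exact: measurableT_comp|exists M => x; rewrite normr_id].
  - apply: bounded_measurable_integrable; apply: bounded_measurableM => //.
    exact: bounded_measurable_cst.
rewrite RintegralZl//; last exact: bounded_measurable_integrable.
apply: ler_wpM2l => //; rewrite -lee_fin /Rintegral fineK//.
exact/integrable_fin_num/bounded_measurable_integrable.
Qed.

Lemma Rintegral_sum_bounded (f : 'I_d -> 'rV[R]_d -> R) :
  (forall k, bounded_measurable (f k)) ->
  \int[tor]_x (\sum_(k < d) f k x) = \sum_(k < d) \int[tor]_x f k x.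
Proof.
move=> bf; elim: (index_enum _) => [|k r IH].
  rewrite big_nil; under eq_Rintegral do rewrite big_nil.
  by rewrite Rintegral_cst// mul0r.
rewrite big_cons -IH; under eq_Rintegral do rewrite big_cons.
rewrite RintegralD//; first exact: bounded_measurable_integrable.
by apply: bounded_measurable_integrable; exact: bounded_measurable_sum.
Qed.

(** By Hoelder the integral of [|rho v|] is at most [Q^(1/s) * K Q^(1 - 1/s) = K Q]. The time
    density is thus dominated by a multiple of [1 + Q], which is integrable in time. *)
Lemma slice_rate rho v dv Q (A : R) (D0 : 'rV[R]_d -> R) (D : 'I_d -> 'rV[R]_d -> R) :
  slice_ok rho v dv Q -> 0 <= A -> bounded_measurable D0 ->
  (forall k, bounded_measurable (D k)) -> (forall x, `|D0 x| <= A) ->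
  (forall k x, `|D k x| <= A) ->
  `|\int[tor]_x (rho x * (D0 x + \sum_(k < d) v k x * D k x))| <=
  A * (1 + d%:R * K) * (1 + Q).
Proof.
move=> [[[brho prho] bv Q0] nrho nv _ _] A0 bD0 bD D0A DA.
have p0 : 0 < p by exact: lt_trans ltr01 p1.
have s0 : 0 < s by exact: lt_le_trans ltr01 s1.
have conj1 : p^-1 + pc^-1 = 1.
  by rewrite /pc invf_div mulrBl mul1r divff ?gt_eqF// addrC subrK.
have [mrho _] := brho.
have Qs : Q `^ s^-1 <= 1 + Q.
  have [Q1|Q1] := lerP Q 1.
    apply: (@le_trans _ _ 1); last by rewrite lerDl.
    have -> : 1 = 1 `^ s^-1 :> R by rewrite powR1.
    by apply: ge0_ler_powR; rewrite ?nnegrE ?invr_ge0 ?ler01// ltW.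
  apply: (@le_trans _ _ Q); last by rewrite lerDr.
  by apply: ler1_powR; [exact: ltW|rewrite invf_le1].
have I0 : `|\int[tor]_x (rho x * D0 x)| <= A * (1 + Q).
  apply: (norm_Rintegral_le rho) => //; first exact: bounded_measurableM.
    by move=> x; rewrite normrM mulrC ler_wpM2r.
  have := hoelder tor mrho (measurable_cst (1 : R)) p0 pc0 conj1.
  rewrite Lnorm1.
  have -> : (\int[tor]_x `|(EFin \o (rho \* cst 1)%R) x| = \int[tor]_x `|(rho x)%:E|)%E.
    by apply: eq_integral => x _; rewrite /= mulr1.
  have -> : (Lnorm tor pc%:E (EFin \o cst (1%R : R)) = 1)%E.
    have -> : EFin \o cst (1 : R) = cst 1%E :> ('rV[R]_d -> \bar R) by [].
    rewrite (Lnorm_cst1 tor); apply: etrans (poweR1r pc^-1).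
    by congr (_ `^ _)%E; exact: (probability_setT tor).
  rewrite mule1 => /le_trans; apply; apply: le_trans nrho _.
  by rewrite lee_fin.
have Ik k : `|\int[tor]_x (rho x * (v k x * D k x))| <= A * (K * Q).
  have bvk := bv k; have [mvk _] := bvk.
  apply: (norm_Rintegral_le (fun x => rho x * v k x)) => //.
  - exact: bounded_measurableM.
  - by apply: bounded_measurableM => //; exact: bounded_measurableM.
  - by move=> x; rewrite mulrA normrM mulrC ler_wpM2r.
  have H := hoelder tor mrho mvk p0 pc0 conj1; rewrite Lnorm1 in H.
  apply: le_trans H _.
  have -> : (K * Q)%:E = ((Q `^ s^-1)%:E * (K * Q `^ (1 - s^-1))%:E)%E.
    rewrite -EFinM mulrCA -powRD; last by rewrite addrC subrK oner_eq0.
    by rewrite addrC subrK powRr1.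
  apply: lee_pmul; [exact: Lnorm_ge0|exact: Lnorm_ge0|exact: nrho|exact: nv].
have bk k : bounded_measurable (fun x => rho x * (v k x * D k x)).
  by apply: bounded_measurableM => //; exact: bounded_measurableM.
have -> : \int[tor]_x (rho x * (D0 x + \sum_(k < d) v k x * D k x)) =
    \int[tor]_x (rho x * D0 x) + \sum_(k < d) \int[tor]_x (rho x * (v k x * D k x)).
  under eq_Rintegral do rewrite mulrDr mulr_sumr.
  rewrite RintegralD//; first last.
  - by apply: bounded_measurable_integrable; exact: bounded_measurable_sum.
  - by apply: bounded_measurable_integrable; exact: bounded_measurableM.
  by rewrite Rintegral_sum_bounded.
apply: le_trans (ler_normD _ _) _.
have S : `|\sum_(k < d) \int[tor]_x (rho x * (v k x * D k x))| <= d%:R * (A * (K * Q)).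
  apply: le_trans (ler_norm_sum _ _ _) _.
  apply: (@le_trans _ _ (\sum_(k < d) A * (K * Q))); first exact: ler_sum.
  by rewrite sumr_const card_ord mulr_natl.
apply: le_trans (lerD I0 S) _.
have : 0 <= d%:R * (A * K) by rewrite !mulr_ge0.
by lra.
Qed.

(** During a rest the velocity is 0 and the state is at most [B], hence at most [(1 + B)^s]. *)
Lemma piece_rest_rate P f t (A : R) (D0 : 'rV[R]_d -> R) (D : 'I_d -> 'rV[R]_d -> R) :
  valid p q s st K P f -> state f -> 0 <= t -> t < duration P ->
  piece rest1 P f t 0 != 0 -> 0 <= A -> bounded_measurable D0 ->
  (forall k, bounded_measurable (D k)) -> (forall x, `|D0 x| <= A) ->
  `|\int[tor]_x (piece rho1 P f t x * (D0 x + \sum_(k < d) piece (vel1 k) P f t x * D k x))| <=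
  A * piece (fun a _ _ _ => rest_bound s a) P f t 0.
Proof.
move=> vP sf t0 tD; have [a [g [u [va sg u0 E]]]] := piece_active _ _ _ vP sf t0 tD.
case: a va E => w [J B|i c r h Q] va E; last by rewrite E eqxx.
rewrite !E.
move=> _ A0 bD0 bD D0A; have [wa gB] := va; have [w0 B0] := wa.
have vz k x : vel1 k (w, Jump J B) g u x = 0 by rewrite /vel1 /speed/=; case: ifP.
rewrite (_ : Rintegral _ _ _ = \int[tor]_x (rho1 (w, Jump J B) g u x * D0 x)); last first.
  apply: eq_Rintegral => x _; rewrite E big1 ?addr0// => k _.
  by rewrite E vz mul0r.
have [brho _] := state_rho1 _ _ u wa sg.
apply: (@le_trans _ _ (A * B * 1)); last first.
  rewrite mulr1 ler_wpM2l//= /rest_bound/= (@le_trans _ _ (1 + B))// ?lerDr//.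
  by apply: le1r_powR => //; rewrite lerDl.
apply: (norm_Rintegral_le (cst 1)).
- exact: bounded_measurable_cst.
- exact: bounded_measurableM.
- move=> x; rewrite normr1 mulr1 normrM mulrC; apply: ler_pM => //.
  by rewrite /rho1 /kick/=; case: (gB (x - (u * speed (w, Jump J B) x) *: basis_vec (direction (w, Jump J B)))).
- by rewrite mulr_ge0.
- have -> : (\int[tor]_x `|(cst (1%R : R) x)%:E| = \int[tor]_x (cst 1%E x))%E.
    by apply: eq_integral => x _; rewrite /= normr1.
  rewrite integral_cst// mul1e (le_eqVlt _ 1%E); apply/orP; left; exact/eqP/(probability_setT tor).
Qed.

End slices.

(** * Integrals and norms in time *)

Section time_restriction.
Context {R : realType} (T : R).
Local Notation leb := (@lebesgue_measure R).

(** [lebT] lives on the open interval, while programs run on half-open ones; the difference is the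
    null set {0}. *)
Lemma ge0_integral_lebT (f : measurableTypeR R -> \bar R) : measurable_fun setT f ->
  (forall t, 0 <= f t)%E ->
  (\int[lebT T]_t f t = \int[leb]_(t in `[0%R, T[) f t)%E.
Proof.
move=> mf f0; pose D : set (measurableTypeR R) := `]0, T[%classic.
have mD : measurable D by exact: measurable_itv.
have e0 : (\int[lebT T]_t f t = \int[lebT T]_(t in setT `\` ~` D) f t)%E.
  apply: ge0_negligible_integral => //; first exact: measurableC.
  by rewrite /lebT/= /mrestr setICl measure0.
rewrite e0 setDE setCK setTI.
transitivity (\int[leb]_(t in D) f t)%E.
  by apply: eq_measure_integral => A mA AD; rewrite /lebT/= /mrestr setIidl.
have -> : D = `[0%R, T[%classic `\` [set 0%R : measurableTypeR R].
  apply/seteqP; split => t; rewrite /D/= !in_itv/=.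
    by move=> /andP[t0 tT]; split; [rewrite ltW|apply/eqP; rewrite gt_eqF].
  by move=> [/andP[t0 tT] /eqP t1]; rewrite lt_neqAle eq_sym t1 t0.
rewrite -ge0_negligible_integral => //.
- exact: measurable_funTS.
- exact: lebesgue_measure_set1.
Qed.

Lemma integral_lebT (f : measurableTypeR R -> \bar R) : measurable_fun setT f ->
  (\int[lebT T]_t f t = \int[leb]_(t in `[0%R, T[) f t)%E.
Proof.
move=> mf; rewrite integralE [RHS]integralE.
by rewrite !ge0_integral_lebT//; [exact: measurable_funeneg|exact: measurable_funepos].
Qed.

End time_restriction.

Section fiber_integrals.
Context {R : realType} {d : nat}.
Local Notation tor := (@torus R d).
Implicit Types (H : measurableTypeR R * 'rV[R]_d -> R).

Lemma measurable_Lnorm_fiber H (r : R) : measurable_fun setT H ->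
  measurable_fun setT (fun t : measurableTypeR R => Lnorm tor r%:E (fun x => (H (t, x))%:E)).
Proof.
move=> mH; rewrite unlock; apply: (measurableT_comp (measurable_poweR r^-1)).
have := @measurable_fun_fubini_tonelli_F _ _ _ _ R tor
  (fun z : measurableTypeR R * 'rV[R]_d => (`|(H z)%:E| `^ r)%E).
apply; last by move=> z; exact: poweR_ge0.
apply/measurable_EFinP; apply: (measurableT_comp (measurable_powR r)).
exact: measurableT_comp.
Qed.

Lemma measurable_Rintegral_fiber H : measurable_fun setT H ->
  measurable_fun setT (fun t : measurableTypeR R => \int[tor]_x H (t, x)).
Proof.
move=> mH; apply: measurableT_comp => //.
have mEH : measurable_fun setT (EFin \o H) by exact/measurable_EFinP.
have -> : (fun t : measurableTypeR R => \int[tor]_x (H (t, x))%:E)%E = fun t =>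
    (fubini_F tor (EFin \o H)^\+%E t - fubini_F tor (EFin \o H)^\-%E t)%E.
  apply/funext => t; rewrite integralE /fubini_F; congr (_ - _)%E.
    by apply: eq_integral => x _; rewrite !funeposE.
  by apply: eq_integral => x _; rewrite !funenegE.
apply: emeasurable_funB; apply: measurable_fun_fubini_tonelli_F => //.
  exact: measurable_funepos.
exact: measurable_funeneg.
Qed.

End fiber_integrals.

Section mixed_norms.
Context {R : realType} {d : nat} (T : R).
Local Notation tor := (@torus R d).
Implicit Types (H : measurableTypeR R * 'rV[R]_d -> R) (Q : measurableTypeR R -> R).

Lemma Lnorm_time_fin (N : measurableTypeR R -> \bar R) Q (e C : R) : 0 < e -> 0 <= C ->
  measurable_fun setT N -> measurable_fun setT Q -> (forall t, 0 <= Q t) ->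
  (\int[lebT T]_t (Q t)%:E < +oo)%E ->
  (forall t, 0 <= N t <= (C * Q t `^ e^-1)%:E)%E ->
  (Lnorm (lebT T) e%:E N < +oo)%E.
Proof.
move=> e0 C0 mN mQ Q0 iQ NQ; rewrite unlock; apply: poweR_lty.
have mEQ : measurable_fun setT (fun t => (Q t)%:E) by exact/measurable_EFinP.
apply: (@le_lt_trans _ _ (\int[lebT T]_t ((C `^ e)%:E * (Q t)%:E))%E).
  apply: ge0_le_integral => //.
  - by move=> t _; exact: poweR_ge0.
  - apply: (measurableT_comp (measurable_poweR e)).
    exact: measurableT_comp.
  - by apply: emeasurable_funM => //; exact: measurable_cst.
  - move=> t _; have /andP[N0 NC] := NQ t; rewrite gee0_abs//.
    have -> : ((C `^ e)%:E * (Q t)%:E = (C * Q t `^ e^-1)%:E `^ e)%E.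
      rewrite poweR_EFin (powRM _ C0 (powR_ge0 _ _)) -powRrM mulVf ?gt_eqF//.
      by rewrite powRr1.
    apply: gt0_ler_poweR; rewrite ?(ltW e0)// in_itv/= leey andbT//.
    by rewrite lee_fin mulr_ge0 ?powR_ge0.
rewrite ge0_integralZl//.
- by apply: lte_mul_pinfty => //; rewrite lee_fin powR_ge0.
- by move=> t _; rewrite lee_fin.
- by rewrite lee_fin powR_ge0.
Qed.

Lemma mixed_norm_fin H Q (e r C : R) : 0 < e -> 0 <= C ->
  measurable_fun setT H -> measurable_fun setT Q -> (forall t, 0 <= Q t) ->
  (\int[lebT T]_t (Q t)%:E < +oo)%E ->
  (forall t, (Lnorm tor r%:E (fun x => (H (t, x))%:E) <= (C * Q t `^ e^-1)%:E)%E) ->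
  (mixed_norm T e%:E r%:E H < +oo)%E.
Proof.
move=> e0 C0 mH mQ Q0 iQ HQ; apply: (Lnorm_time_fin _ Q e C) => //.
  exact: measurable_Lnorm_fiber.
by move=> t; rewrite HQ andbT; exact: Lnorm_ge0.
Qed.

Lemma Lnorm_time_fin_infty (N : measurableTypeR R -> \bar R) (C : R) :
  (forall t, 0 <= N t <= C%:E)%E -> (Lnorm (lebT T) +oo N < +oo)%E.
Proof.
move=> NC; rewrite unlock; case: ifP => // _.
apply: (@le_lt_trans _ _ C%:E); last exact: ltry.
apply/ess_supP; apply: nearW => t /=.
by have /andP[N0 ?] := NC t; rewrite gee0_abs.
Qed.

End mixed_norms.

Section spacetime_tests.
Context {R : realType} {d : nat} (phi : R * 'rV[R]_d -> R).
Hypotheses (sphi : smooth phi) (pphi : forall t, periodic (fun x => phi (t, x))).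

Lemma measurable_derive v :
  measurable_fun setT ('D_v phi : measurableTypeR R * 'rV[R]_d -> R).
Proof. by apply: continuous_measurable_RrV; exact: smooth_derive_continuous. Qed.

Lemma bounded_measurable_derive v t : bounded_measurable (fun x => 'D_v phi (t, x)).
Proof.
split.
  exact: (measurableT_comp (measurable_derive v) (measurable_pair1 (t : measurableTypeR R))).
have [A _ HA] := continuous_periodic_bounded _ _ t t
  (smooth_derive_continuous _ v sphi) (spacetime_periodic _ pphi v).
by exists A => x; apply: HA; rewrite lexx.
Qed.

Lemma derive_bound (a b : R) : exists2 A : R, 0 <= A & forall t x, a <= t <= b ->
  `|time_derive phi (t, x)| <= A /\ forall k, `|space_derive k phi (t, x)| <= A.
Proof.
have B v := continuous_periodic_bounded _ _ a b
  (smooth_derive_continuous _ v sphi) (spacetime_periodic _ pphi v).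
have [A0 A00 HA0] := B (1, 0).
have /choice[A HA] k : exists M : R, 0 <= M /\
    forall t x, a <= t <= b -> `|space_derive k phi (t, x)| <= M.
  by have [M M0 HM] := B (0, basis_vec k); exists M.
have S0 : 0 <= \sum_k A k by apply: sumr_ge0 => k _; case: (HA k).
exists (A0 + \sum_k A k) => [|t x tab]; first exact: addr_ge0.
split => [|k]; first by rewrite (le_trans (HA0 _ _ tab))// lerDl.
have [_ HAk] := HA k; apply: le_trans (HAk _ x tab) _.
rewrite (bigD1 k)//= addrCA lerDl addr_ge0//.
by apply: sumr_ge0 => j _; case: (HA j).
Qed.

End spacetime_tests.

(** * Gluing the programs *)

Section glue.
Context {R : realType} {d : nat} (p q s st K T : R).
Local Notation leb := (@lebesgue_measure R).
Local Notation tor := (@torus R d).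
Context (Ps : nat -> seq (@step R d)) (f0 : 'rV[R]_d -> R).
Implicit Types (h : @step R d -> ('rV[R]_d -> R) -> R -> 'rV[R]_d -> R).

(* At a good time no jump is active, so all later programs agree with [Ps n]. *)
Definition good n (t : measurableTypeR R) : bool :=
  [&& 0 <= t, t < T & piece rest1 (Ps n) f0 t 0 == 0].

Definition stage t : nat := xget 0%N [set n | good n t].

(** At times that never become good, state, velocity and bound are all 0, so that the slice bounds
    hold at every time. All good stages give the same value. *)
Definition glued h (t : R) (x : 'rV[R]_d) : R :=
  if good (stage t) t then piece h (Ps (stage t)) f0 t x else 0.

(** The approximation of [glued h] by a single program; at each time it is eventually equal to
    [glued h], which yields measurability and the limits of integrals. *)
Definition masked h n (t : R) (x : 'rV[R]_d) : R :=
  if good n t then piece h (Ps n) f0 t x else 0.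

Hypotheses (p1 : 1 < p) (q1 : 1 <= q) (s1 : 1 <= s) (st1 : 1 <= st) (K0 : 0 <= K).
Hypothesis sf : state f0.
Hypothesis dPs : forall n, duration (Ps n) = T.
Hypothesis vPs : forall n, valid p q s st K (Ps n) f0.
Hypothesis agree : forall n h t x, 0 <= t -> piece rest1 (Ps n) f0 t 0 = 0 ->
  piece h (Ps n.+1) f0 t x = piece h (Ps n) f0 t x.

Let wPs n : wf (Ps n). Proof. exact: valid_wf (vPs n). Qed.

Lemma good_stage n t : good n t -> good (stage t) t.
Proof. by move=> gn; exact: (xgetPex 0%N (ex_intro (fun m => good m t) n gn)). Qed.

Lemma good_later n k t : good n t ->
  good (n + k)%N t /\ forall h x, piece h (Ps (n + k)%N) f0 t x = piece h (Ps n) f0 t x.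
Proof.
move=> gn; elim: k => [|k [gk E]]; first by rewrite addn0.
have /and3P[t0 tT /eqP rt] := gk.
rewrite addnS; split => [|h x]; last by rewrite agree.
by rewrite /good t0 tT agree// rt eqxx.
Qed.

Lemma gluedE n t h x : good n t -> glued h t x = piece h (Ps n) f0 t x.
Proof.
move=> gn; have gs := good_stage _ _ gn; rewrite /glued gs.
have [_ <-] := good_later _ n _ gs; have [_ <-] := good_later _ (stage t) _ gn.
by rewrite addnC.
Qed.

Lemma good_eventually t : exists N, forall n, (N <= n)%N -> good n t = good (stage t) t.
Proof.
case: (boolP (good (stage t) t)) => [gs|ns].
  by exists (stage t) => n /subnKC <-; have [-> _] := good_later _ (n - stage t) _ gs.
exists 0%N => n _; apply/negbTE; apply: contra ns; exact: good_stage.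
Qed.

Lemma maskedE h n t x : masked h n t x = if good n t then glued h t x else 0.
Proof. by rewrite /masked; case: ifP => // gn; rewrite (gluedE n). Qed.

Lemma cvg_good (y : R) t : (good (stage t) t = false -> y = 0) ->
  (if good n t then y else 0) @[n --> \oo] --> y.
Proof.
move=> y0; apply: cvg_near_cst; have [N HN] := good_eventually t.
exists N => // n /= Nn; rewrite HN//; case: ifP => // ns; exact/esym/y0.
Qed.

Lemma glued0 h t x : good (stage t) t = false -> glued h t x = 0.
Proof. by rewrite /glued => ->. Qed.

Lemma measurable_good n : measurable_fun setT (good n).
Proof.
apply: measurable_and; first by apply: measurable_fun_ler.
apply: measurable_and; first by apply: measurable_fun_ltr.
apply: measurable_fun_eqr => //.
have mr := measurable_piece rest1 (Ps n) f0 (wPs n) sf.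
have H : measurable_fun setT (fun t : measurableTypeR R => (t, 0 : 'rV[R]_d)).
  by apply/measurable_fun_pairP; split; [exact: measurable_id|exact: measurable_cst].
apply: (measurableT_comp (mr _) H) => a g _ _; rewrite /rest1.
by case: a.2 => *; exact: measurable_cst.
Qed.

Lemma measurable_glued h : (forall a g, wf1 a -> state g ->
     measurable_fun setT (fun z : measurableTypeR R * 'rV[R]_d => h a g z.1 z.2)) ->
  measurable_fun setT (fun z : measurableTypeR R * 'rV[R]_d => glued h z.1 z.2).
Proof.
move=> mh; apply: (@measurable_fun_cvg _ _ _ _ (fun n z => masked h n z.1 z.2)) => [n|z _].
  apply: measurable_fun_ifT.
  - exact: (measurableT_comp (measurable_good n) measurable_fst).
  - exact: measurable_piece.
  - exact: measurable_cst.
under eq_fun do rewrite maskedE; apply: cvg_good; exact: glued0.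
Qed.

Lemma periodic_glued h t : (forall a g u, wf1 a -> state g -> periodic (h a g u)) ->
  periodic (glued h t).
Proof.
by move=> ph x k; rewrite /glued; case: ifP => // _; exact: periodic_piece.
Qed.

Lemma slice_glued t : slice_ok p q s st K (glued rho1 t) (fun k => glued (vel1 k) t)
  (fun k l => glued (dvel1 k l) t) (glued bound1 t 0).
Proof.
case: (boolP (good (stage t) t)) => [gs|/negbTE ns].
  have E h : glued h t = piece h (Ps (stage t)) f0 t.
    by apply/funext => x; exact: gluedE.
  rewrite (E rho1) (E bound1) (_ : (fun k => glued (vel1 k) t) =
      fun k => piece (vel1 k) (Ps (stage t)) f0 t); last exact/funext.
  rewrite (_ : (fun k l => glued (dvel1 k l) t) =
      fun k l => piece (dvel1 k l) (Ps (stage t)) f0 t); last first.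
    by apply/funext => k; apply/funext => l.
  by have /and3P[t0 tT /eqP rt] := gs; apply: slice_good; rewrite // dPs.
have E h : glued h t = fun=> 0 by apply/funext => x; exact: glued0.
rewrite (E rho1) (E bound1) (_ : (fun k => glued (vel1 k) t) = fun _ _ => 0); last exact/funext.
rewrite (_ : (fun k l => glued (dvel1 k l) t) = fun _ _ _ => 0); last first.
  by apply/funext => k; apply/funext => l.
exact: slice_zero.
Qed.

Lemma glued_bound_ge0 t : 0 <= glued bound1 t 0.
Proof. by have [[_ _ ?] _ _ _ _] := slice_glued t. Qed.

Lemma measurable_bound1 a g : measurable_fun setT
  (fun z : measurableTypeR R * 'rV[R]_d => bound1 a g z.1 z.2).
Proof. by rewrite /bound1; case: a.2 => *; exact: measurable_cst. Qed.

Lemma measurable_glued_bound :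
  measurable_fun setT (fun t : measurableTypeR R => glued bound1 t 0).
Proof.
have H : measurable_fun setT (fun t : measurableTypeR R => (t, 0 : 'rV[R]_d)).
  by apply/measurable_fun_pairP; split; [exact: measurable_id|exact: measurable_cst].
by apply: (measurableT_comp (measurable_glued bound1 _) H) => a g _ _; exact: measurable_bound1.
Qed.

Lemma integral_masked_bound n :
  (\int[leb]_(t in `[0%R, T[) (masked bound1 n t 0)%:E <= (cost (Ps n))%:E)%E.
Proof.
(* The absolute value makes [g] nonnegative on all steps; on a well-formed program it changes
   nothing. *)
pose g (a : @step R d) := match a.2 with Jump _ _ => 0 | Shear _ _ _ _ Q => `|Q| end.
have g0 a : 0 <= g a by rewrite /g; case: a.2.
have -> : cost (Ps n) = \sum_(a <- Ps n) a.1 * g a.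
  rewrite /cost; elim: (Ps n) (wPs n) => [|a P IH] /=; first by rewrite !big_nil.
  move=> [wa wP]; rewrite !big_cons (IH wP); congr (_ + _).
  case: a wa => w [J B|i c r h Q] [w0 wQ]; rewrite /g/= ?mulr0//.
  by have [_ _ Q0] := wQ; rewrite ger0_norm.
have := integral_piece_constant g (Ps n) f0 0 (wPs n) g0.
rewrite dPs add0r => <-; apply: ge0_le_integral => //.
- by move=> t _; rewrite maskedE lee_fin; case: ifP => // _; exact: glued_bound_ge0.
- apply: measurable_funTS; apply/measurable_EFinP.
  under eq_fun do rewrite maskedE; apply: measurable_fun_ifT.
  + exact: measurable_good.
  + exact: measurable_glued_bound.
  + exact: measurable_cst.
- apply: measurable_funTS; apply/measurable_EFinP; under eq_fun do rewrite subr0.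
  have H : measurable_fun setT (fun t : measurableTypeR R => (t, 0 : 'rV[R]_d)).
    by apply/measurable_fun_pairP; split; [exact: measurable_id|exact: measurable_cst].
  apply: (measurableT_comp (measurable_piece _ _ f0 (wPs n) sf _) H) => a g' _ _.
  exact: measurable_cst.
- move=> t _; rewrite lee_fin subr0 /masked; case: ifP => _.
    elim: (Ps n) f0 t => //= a P IH f t; case: ifP => // _.
    by rewrite /bound1 /g; case: a.2 => // i c r h Q; exact: ler_norm.
  elim: (Ps n) f0 t => //= a P IH f t; case: ifP => // _.
Qed.

(** Good times stay good and values there no longer change, so the masked bounds increase and
    monotone convergence passes the cost bound to the limit. *)
Lemma integral_glued_bound (C : R) : (forall n, cost (Ps n) <= C) ->
  (\int[leb]_(t in `[0%R, T[) (glued bound1 t 0)%:E <= C%:E)%E.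
Proof.
move=> HC; have E t : limn (fun n => (masked bound1 n t 0)%:E) = (glued bound1 t 0)%:E.
  apply/cvg_lim => //; apply: cvg_EFin; first exact: nearW.
  under eq_fun do rewrite /= maskedE; apply: cvg_good; exact: glued0.
under eq_integral do rewrite -E.
have m0 n t : 0 <= masked bound1 n t 0.
  by rewrite maskedE; case: ifP => // _; exact: glued_bound_ge0.
have mm n : measurable_fun setT (fun t : measurableTypeR R => (masked bound1 n t 0)%:E).
  apply/measurable_EFinP.
  under eq_fun do rewrite maskedE; apply: measurable_fun_ifT.
  + exact: measurable_good.
  + exact: measurable_glued_bound.
  + exact: measurable_cst.
have nd t : nondecreasing_seq (fun n => (masked bound1 n t 0)%:E).
  apply/nondecreasing_seqP => n; rewrite lee_fin /masked; case: ifP => [gn|_].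
    by have [] := good_later _ 1%N _ gn; rewrite addn1 => -> ->.
  exact: m0.
rewrite monotone_convergence//; first last.
- by move=> n t _; rewrite lee_fin.
- by move=> n; exact: measurable_funTS.
apply: lime_le.
  apply: ereal_nondecreasing_is_cvgn => m n mn; apply: ge0_le_integral => //.
  - by move=> t _; rewrite lee_fin.
  - exact: measurable_funTS.
  - exact: measurable_funTS.
  - by move=> t _; exact: nd.
by apply: nearW => n; apply: le_trans (integral_masked_bound n) _; rewrite lee_fin.
Qed.

End glue.

(** * The weak formulation in the limit *)

Section glued_transport.
Context {R : realType} {d : nat} (p q s st K T F C : R).
Local Notation leb := (@lebesgue_measure R).
Local Notation tor := (@torus R d).
Context (Ps : nat -> seq (@step R d)).
Let f0 : 'rV[R]_d -> R := fun=> 0.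
Local Notation glued := (glued T Ps f0).
Local Notation good := (good T Ps f0).

Hypotheses (p1 : 1 < p) (q1 : 1 <= q) (s1 : 1 <= s) (st1 : 1 <= st) (K0 : 0 <= K).
Hypothesis dPs : forall n, duration (Ps n) = T.
Hypothesis vPs : forall n, valid p q s st K (Ps n) f0.
Hypothesis agree : forall n h t x, 0 <= t -> piece rest1 (Ps n) f0 t 0 = 0 ->
  piece h (Ps n.+1) f0 t x = piece h (Ps n) f0 t x.
Hypothesis costC : forall n, cost (Ps n) <= C.
Hypothesis fluxF : forall n, flux p (Ps n) <= F / 2 ^+ n.
Hypothesis restP : forall n, rest_cost s (Ps n.+1) <= 2^-1 ^+ n.

Let sf : state f0. Proof. by split => //; exact: bounded_measurable_cst. Qed.
Let wPs n : wf (Ps n). Proof. exact: valid_wf (vPs n). Qed.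

Let D : set (measurableTypeR R) := `[0, T[%classic.
Let mD : measurable D. Proof. exact: measurable_itv. Qed.

Lemma measurable_glued_rate phi : spacetime_test T phi ->
  measurable_fun setT (fun z : measurableTypeR R * 'rV[R]_d =>
    glued rho1 z.1 z.2 * (time_derive phi z +
      \sum_(k < d) glued (vel1 k) z.1 z.2 * space_derive k phi z)).
Proof.
move=> [sphi pphi _].
have mg h : (forall a g, wf1 a -> state g ->
     measurable_fun setT (fun z : measurableTypeR R * 'rV[R]_d => h a g z.1 z.2)) ->
  measurable_fun setT (fun z : measurableTypeR R * 'rV[R]_d => glued h z.1 z.2).
  by apply: (measurable_glued p q s st K).
apply: measurable_funM; first by apply: mg; exact: measurable_rho1.
apply: measurable_funD; first exact: measurable_derive.
apply: measurable_sum => k; apply: measurable_funM.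
  by apply: mg; exact: measurable_vel1.
exact: measurable_derive.
Qed.

(** The weak formulation for [Ps n] fails by at most a multiple of its flux, and discarding the
    rests alters the time integral by a multiple of the rest cost. Both tend to 0, while the
    densities at good times converge to that of the limit under the dominating function [W]. *)
Lemma glued_transport phi : spacetime_test T phi ->
  \int[leb]_(t in `[0, T[) \int[tor]_x (glued rho1 t x * (time_derive phi (t, x) +
     \sum_(k < d) glued (vel1 k) t x * space_derive k phi (t, x))) = 0.
Proof.
move=> tphi; have [sphi pphi [T' T'T phiT]] := tphi.
have [A A0 HA] := derive_bound phi sphi pphi 0 T.
have phiC (k : 'I_d) t x : 0 <= t <= T -> `|space_derive k phi (t, x)| <= A.
  by move=> tT; have [_] := HA t x tT; exact.
pose G (t : measurableTypeR R) := \int[tor]_x (glued rho1 t x * (time_derive phi (t, x) +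
     \sum_(k < d) glued (vel1 k) t x * space_derive k phi (t, x))).
have mG : measurable_fun setT G.
  exact: (measurable_Rintegral_fiber _ (measurable_glued_rate phi tphi)).
pose Gn n (t : measurableTypeR R) := rate phi (Ps n) f0 0 t.
pose RB n (t : measurableTypeR R) := piece (fun a _ _ _ => rest_bound s a) (Ps n) f0 (t - 0) 0.
have RB0 n t : 0 <= RB n t.
  rewrite /RB; elim: (Ps n) f0 (t - 0) => //= a P IH f u; case: ifP => // _.
  by rewrite /rest_bound; case: a.2 => // J B; exact: powR_ge0.
have slice t := slice_glued p q s st K T Ps f0 p1 q1 K0 sf dPs vPs agree t.
have TD (t : measurableTypeR R) : D t -> 0 <= t /\ t < T.
  by rewrite /D/= in_itv/= => /andP[].
have bd v t : bounded_measurable (fun x => 'D_v phi (t, x)).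
  exact: bounded_measurable_derive.
have GQ t : D t -> `|G t| <= A * (1 + d%:R * K) * (1 + glued bound1 t 0).
  move=> /TD[t0 tT]; have tT' : 0 <= t <= T by rewrite t0 ltW.
  apply: (slice_rate p q s st K p1 s1 K0 _ _ _ _ A (fun x => time_derive phi (t, x))
    (fun k x => space_derive k phi (t, x)) (slice t)) => //.
  - exact: bd.
  - by move=> k; exact: bd.
  - by move=> x; case: (HA t x tT').
  - by move=> k x; exact: phiC.
have G0 t : good (stage T Ps f0 t) t = false -> G t = 0.
  move=> ns; rewrite /G; transitivity (\int[tor]_x (0 : R)).
    by apply: eq_Rintegral => x _; rewrite glued0// mul0r.
  by rewrite Rintegral_cst// mul0r.
pose mGn n t := if good n t then G t else 0.
have mmGn n : measurable_fun setT (mGn n).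
  by apply: measurable_fun_ifT => //; exact: (measurable_good p q s st K).
have near n t : D t -> `|Gn n t - mGn n t| <= A * RB n t.
  move=> /TD[t0 tT]; have tT' : 0 <= t <= T by rewrite t0 ltW.
  rewrite /mGn; case: ifPn => [gn|ng].
    rewrite (_ : Gn n t = G t); first by rewrite subrr normr0 mulr_ge0.
    apply: eq_Rintegral => x _; rewrite subr0.
    rewrite (gluedE T Ps f0 agree n)//; congr (_ * (_ + _)).
    by apply: eq_bigr => k _; rewrite (gluedE T Ps f0 agree n).
  rewrite subr0 /Gn /rate /RB subr0.
  apply: (piece_rest_rate p q s st K) => //.
  - by rewrite dPs.
  - by move: ng; rewrite /good t0 tT.
  - exact: bd.
  - by move=> k; exact: bd.
  - by move=> x; case: (HA t x tT').
have mRB n : measurable_fun setT (RB n).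
  have H : measurable_fun setT (fun t : measurableTypeR R => (t - 0, 0 : 'rV[R]_d)).
    apply/measurable_fun_pairP; split; last exact: measurable_cst.
    by apply: measurable_funB => //; exact: measurable_id.
  apply: (measurableT_comp (measurable_piece _ _ f0 (wPs n) sf _) H) => a g' _ _.
  exact: measurable_cst.
have iRB n : (\int[leb]_(t in D) (RB n t)%:E = (rest_cost s (Ps n))%:E)%E.
  have rb0 (a : @step R d) : 0 <= rest_bound s a.
    by rewrite /rest_bound; case: a.2 => // J B; exact: powR_ge0.
  by have := integral_piece_constant _ (Ps n) f0 0 (wPs n) rb0; rewrite dPs add0r.
have mQ : measurable_fun setT (fun t : measurableTypeR R => glued bound1 t 0).
  exact: (measurable_glued_bound p q s st K).
have iQ : (\int[leb]_(t in D) (glued bound1 t 0)%:E <= C%:E)%E.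
  exact: (integral_glued_bound p q s st K).
have Q0 t : 0 <= glued bound1 t 0.
  exact: (glued_bound_ge0 p q s st K).
pose W t := A * (1 + d%:R * K) * (1 + glued bound1 t 0).
have intRB n : leb.-integrable D (EFin \o RB n).
  apply/integrableP; split; first by apply/measurable_EFinP; exact: measurable_funTS.
  under eq_integral => t _ do rewrite gee0_abs ?lee_fin//.
  by rewrite iRB ltry.
have intW : leb.-integrable D (EFin \o W).
  rewrite (_ : EFin \o W = (fun t => (A * (1 + d%:R * K))%:E * (1%:E + (glued bound1 t 0)%:E))%E).
    apply: integrableZl => //; apply: integrableD => //.
      apply/integrableP; split; first exact: measurable_cst.
      under eq_integral do rewrite abse1.
      have Dfin : (leb D < +oo)%E.
        by rewrite /D lebesgue_measure_itv/=; case: ifP => _; rewrite ?ltry// -EFinB ltry.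
      by rewrite integral_cst// mul1e.
    apply/integrableP; split; first by apply/measurable_EFinP; exact: measurable_funTS.
    under eq_integral => t _ do rewrite gee0_abs ?lee_fin//.
    exact: le_lt_trans iQ (ltry _).
  by apply/funext => t; rewrite /W /= EFinM EFinD.
have mGnW n t : D t -> (`|(mGn n t)%:E| <= (W t)%:E)%E.
  move=> Dt; rewrite lee_fin /mGn; case: ifP => _; first exact: GQ.
  by rewrite normr0 !mulr_ge0// addr_ge0// mulr_ge0.
have cvmG t : D t -> (mGn n t)%:E @[n --> \oo] --> (G t)%:E.
  move=> _; apply: cvg_EFin; first exact: nearW.
  exact: (cvg_good T Ps f0 agree (G t) t (G0 t)).
have mEmGn n : measurable_fun D (EFin \o mGn n).
  by apply/measurable_EFinP; exact: measurable_funTS.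
have intmG n : leb.-integrable D (EFin \o mGn n).
  by apply: le_integrable intW => // t Dt; rewrite (le_trans (mGnW n t Dt))//= lee_fin ler_norm.
have Wfin t : D t -> (EFin \o W) t \is a fin_num by [].
have dct := dominated_cvg mD mEmGn cvmG Wfin intW mGnW.
(* The rest cost is bounded from index 1 on, hence the shift. The boundary terms vanish because
   [phi] is 0 at time [T] and the state is 0 at time 0. *)
have small n : `|\int[leb]_(t in D) mGn n.+1 t| <= A * (F + 1) * 2^-1 ^+ n.
  have := rate_estimate phi A T sphi pphi phiC p (Ps n.+1) f0 0 (ltW p1) A0 (wPs _) sf (lexx _).
  rewrite add0r dPs => /(_ (lexx _))[iGn].
  have z1 : \int[tor]_x (exec (Ps n.+1) f0 x * phi (T, x)) = 0.
    transitivity (\int[tor]_x (0 : R)); last by rewrite Rintegral_cst// mul0r.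
    by apply: eq_Rintegral => x _; rewrite phiT ?mulr0// ltW.
  have z2 : \int[tor]_x (f0 x * phi (0, x)) = 0.
    transitivity (\int[tor]_x (0 : R)); last by rewrite Rintegral_cst// mul0r.
    by apply: eq_Rintegral => x _; rewrite mul0r.
  rewrite z1 z2 subrr subr0 -/D => eGn.
  have iG : leb.-integrable D (EFin \o Gn n.+1) by exact: iGn.
  have dif : `|\int[leb]_(t in D) (Gn n.+1 t - mGn n.+1 t)| <= A * 2^-1 ^+ n.
    have iB : leb.-integrable D (EFin \o (fun t => Gn n.+1 t - mGn n.+1 t)).
      move: iG (intmG n.+1) => + iM.
      move: (Gn n.+1) (mGn n.+1) iM {eGn} => g1 g2 i2 i1.
      have := integrableB mD i1 i2.
      by under eq_fun do rewrite /= -EFinB.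
    apply: le_trans (le_normr_Rintegral mD iB) _.
    apply: (@le_trans _ _ (\int[leb]_(t in D) (A * RB n.+1 t))).
      apply: le_Rintegral => //.
      - exact: (integrable_abse iB).
      - rewrite (_ : EFin \o _ = (fun t => A%:E * (EFin \o RB n.+1) t)%E).
          exact: integrableZl.
        by apply/funext => t; rewrite /= EFinM.
      - by move=> t Dt; exact: near.
    rewrite RintegralZl//; apply: ler_wpM2l => //.
    by rewrite /Rintegral iRB; exact: restP.
  have -> : \int[leb]_(t in D) mGn n.+1 t = \int[leb]_(t in D) Gn n.+1 t -
      \int[leb]_(t in D) (Gn n.+1 t - mGn n.+1 t).
    move: iG (intmG n.+1) => + iM; move: (Gn n.+1) (mGn n.+1) iM => g1 g2 i2 i1.
    by rewrite (RintegralB mD i1 i2) opprB addrCA subrr addr0.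
  apply: le_trans (ler_normB _ _) _; rewrite mulrDr mulr1 mulrDl lerD//.
  apply: le_trans eGn _; rewrite -mulrA ler_wpM2l//.
  have F0 : 0 <= F.
    have := fluxF 0%N; rewrite expr0 divr1; apply: le_trans.
    by apply: sumr_ge0 => a _; exact: jump_flux_ge0.
  apply: le_trans (fluxF n.+1) _; rewrite ler_wpM2l// -exprVn exprS ler_piMl ?exprn_ge0 ?invr_ge0//.
  by rewrite invf_le1// ler1n.
have cI : (\int[leb]_(t in D) mGn n t) @[n --> \oo] --> \int[leb]_(t in D) G t.
  apply: fine_cvg; rewrite fineK; first exact: dct.
  apply: integrable_fin_num => //; apply: le_integrable intW => //.
    by apply/measurable_EFinP; exact: measurable_funTS.
  by move=> t Dt; rewrite /= lee_fin (le_trans (GQ t Dt))// ler_norm.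
have cS : (\int[leb]_(t in D) mGn n.+1 t) @[n --> \oo] --> \int[leb]_(t in D) G t.
  by rewrite -(cvg_shiftS (fun n => \int[leb]_(t in D) mGn n t)) in cI.
have cg : A * (F + 1) * 2^-1 ^+ n @[n --> \oo] --> (0 : R).
  by apply: cvg_geometric; rewrite ger0_norm ?invr_ge0// invf_lt1// ltr1n.
apply: (cvg_unique _ cS) => //; apply/cvgr0Pnorm_le => e e0.
near=> n; apply: le_trans (small n) _.
apply: le_trans (ler_norm _) _; near: n.
by move/cvgr0Pnorm_le : cg; apply.
Unshelve. all: by end_near.
Qed.

End glued_transport.

(** * Two solutions for one field *)

Section nonuniqueness.
Context {R : realType} {d : nat} (p q s st K T : R) (i : 'I_d).
Local Notation leb := (@lebesgue_measure R).
Local Notation tor := (@torus R d).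
Let f0 : 'rV[R]_d -> R := fun=> 0.
Let J : @slot R d := Slot 1 0 (fun=> 1%N) i.

Hypotheses (p1 : 1 < p) (q1 : 1 <= q) (s1 : 1 <= s) (st1 : 1 <= st) (K0 : 0 <= K).
Hypothesis T0 : 0 < T.
Hypothesis realization : forall S : @slot R d,
  realizes p q s st K (slot_fun S) (weight p S / 2) (2 * K * weight p S).

Let side2 l : side (lev J) l = 2^-1 :> R. Proof. by rewrite /side expr1. Qed.

(** The sides are 1/2, so the translated box covers the other half of the circle in direction [i]
    and nothing cancels on the original box. *)
Lemma slot_fun_neq0 x : inbox 0 (side (lev J)) x -> slot_fun J x != 0.
Proof.
move=> xin; rewrite /slot_fun/= {2}/ib xin mul1r subr_eq0 /ib.
have /negbTE -> : ~~ inbox 0 (side (lev J)) (x - len J *: basis_vec i).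
  apply/forallPn; exists i; have /forallP/(_ i) := xin.
  rewrite /len !side2 !mxE !eqxx mulr1 !subr0; have /andP[z0 z1] := fracp_itv (x 0 i).
  move=> z2; rewrite -leNgt.
  have -> : x 0 i - 2^-1 = fracp (x 0 i) + 2^-1 + (Num.floor (x 0 i) - 1)%:~R.
    by rewrite /fracp intrD; lra.
  rewrite fracpDz fracp_id; first lra.
  by move: z2 => /= z2; lra.
by rewrite eq_sym oner_neq0.
Qed.

(** The final idle shear makes all times after [T / 2] good from the outset, so that no refinement
    alters the state there; only the rest in the first half is ever replaced. *)
Let P0 : seq (@step R d) :=
  [:: (T / 2, Jump J 1); (T / 2, Shear i 0 (1 / 8) 0 ((1 + 1) `^ s))].

Let sf : state f0. Proof. by split => //; exact: bounded_measurable_cst. Qed.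

Let valid0 : valid p q s st K P0 f0.
Proof.
have T2 : 0 < T / 2 by rewrite divr_gt0.
have J1 x : `|slot_fun J x| <= 1 by rewrite (le_trans (slot_fun_le _ _))// normr1.
apply/valid_cons; split.
  split; first by split; [exact: T2|exact: ler01].
  by move=> x; rewrite /f0 add0r normr0.
rewrite exec1_jump; apply: valid_idle => //.
  have [bj pj] := state_slot_fun J.
  by split; [apply: bounded_measurableD => //; case: sf | move=> x k; rewrite pj].
by move=> x; rewrite add0r.
Qed.

Let D0 : duration P0 = T.
Proof. by rewrite /P0 !duration_cons /duration big_nil/= addr0 -splitr. Qed.

Lemma nonuniqueness : exists u : R * 'rV[R]_d -> 'rV[R]_d,
  [/\ divergence_free T u,
      forall k, L_W1q T st%:E q%:E (component u k),
      forall k, L_Lp T (hoelder_conjugate s%:E) (hoelder_conjugate p%:E) (component u k)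
    & uniqueness_fails T u (L_Lp T s%:E p%:E)].
Proof.
have [Ps [Ps0 PsP]] := program_sequence p q s st K p1 q1 s1 K0 realization P0 f0 sf valid0.
have dPs n : duration (Ps n) = T by have [-> _ _ _ _] := PsP n.
have vPs n : valid p q s st K (Ps n) f0 by case: (PsP n) => _ [].
have agree n h t x : 0 <= t -> piece rest1 (Ps n) f0 t 0 = 0 ->
  piece h (Ps n.+1) f0 t x = piece h (Ps n) f0 t x.
  by case: (PsP n) => _ _ _ _ [_]; exact.
pose F := flux p P0; pose A := 2 * K * F.
have fluxF n : flux p (Ps n) <= F / 2 ^+ n by case: (PsP n).
have restP n : rest_cost s (Ps n.+1) <= 2^-1 ^+ n by case: (PsP n) => _ _ _ _ [].
have F0 : 0 <= F by apply: sumr_ge0 => a _; exact: jump_flux_ge0.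
have A0 : 0 <= A by rewrite !mulr_ge0.
have fluxA n : 2 * K * flux p (Ps n) <= A * 2^-1 ^+ n.
  by rewrite /A -[in leRHS]mulrA; apply: ler_wpM2l; [rewrite mulr_ge0|rewrite exprVn].
(* The increments of the cost from fluxes add up to [2 A] and those from later rests to 2. The
   induction [costS] works because [A 2^-(n+1) + 2^-n] is exactly the decrease of [(A + 2) 2^-n]. *)
pose C := cost P0 + rest_cost s P0 + 2 * A + 2.
have R0 : 0 <= rest_cost s P0.
  rewrite /rest_cost /P0 !big_cons big_nil /rest_bound/= mulr0 !addr0.
  by rewrite mulr_ge0 ?powR_ge0// divr_ge0// ltW.
have costS n : cost (Ps n.+1) <= C - (A + 2) * 2^-1 ^+ n.
  elim: n => [|n IH].
    have [_ _ _ + _] := PsP 0%N; have := fluxA 0%N.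
    by rewrite Ps0 expr0 !mulr1 /C; lra.
  have [_ _ _ + _] := PsP n.+1; have := fluxA n.+1; have := restP n.
  have e0 : 0 <= 2^-1 ^+ n :> R by rewrite exprn_ge0// invr_ge0.
  by rewrite exprS; set e := 2^-1 ^+ n in e0 IH *; nra.
have costC n : cost (Ps n) <= C.
  case: n => [|n]; first by rewrite Ps0 /C; lra.
  apply: le_trans (costS n) _; rewrite gerBl mulr_ge0 ?exprn_ge0 ?invr_ge0//; lra.
pose gl := glued T Ps f0.
have slice t : slice_ok p q s st K (gl rho1 t) (fun k => gl (vel1 k) t)
    (fun k l => gl (dvel1 k l) t) (gl bound1 t 0) by exact: slice_glued.
have mgl h : (forall a g, wf1 a -> state g ->
     measurable_fun setT (fun z : measurableTypeR R * 'rV[R]_d => h a g z.1 z.2)) ->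
  measurable_fun setT (fun z : measurableTypeR R * 'rV[R]_d => gl h z.1 z.2).
  by apply: (measurable_glued p q s st K).
have pgl h t : (forall a g u, wf1 a -> state g -> periodic (h a g u)) -> periodic (gl h t).
  by apply: (periodic_glued p q s st K).
have mQ : measurable_fun setT (fun t : measurableTypeR R => gl bound1 t 0).
  exact: (measurable_glued_bound p q s st K).
have Q0 t : 0 <= gl bound1 t 0 by exact: (glued_bound_ge0 p q s st K).
have iQ : (\int[lebT T]_t (gl bound1 t 0)%:E < +oo)%E.
  rewrite ge0_integral_lebT//; last exact/measurable_EFinP.
  by apply: le_lt_trans (integral_glued_bound p q s st K T Ps f0 p1 q1 K0 sf dPs vPs agree C costC) (ltry _).
have s0 : 0 < s by exact: lt_le_trans ltr01 s1.
have st0 : 0 < st by exact: lt_le_trans ltr01 st1.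
have mnorm h (e r c : R) : 0 < e -> 0 <= c ->
  (forall a g, wf1 a -> state g ->
     measurable_fun setT (fun z : measurableTypeR R * 'rV[R]_d => h a g z.1 z.2)) ->
  (forall a g u, wf1 a -> state g -> periodic (h a g u)) ->
  (forall t, (Lnorm tor r%:E (fun x => (gl h t x)%:E) <= (c * gl bound1 t 0 `^ e^-1)%:E)%E) ->
  L_Lp T e%:E r%:E (fun z => gl h z.1 z.2).
  move=> e0 c0 mh ph H; split.
  - exact: measurable_funTS (mgl _ mh).
  - by move=> t; exact: pgl.
  - by apply: (mixed_norm_fin T _ (fun t => gl bound1 t 0) e r c) => //; exact: mgl.
pose u z : 'rV[R]_d := \row_k gl (vel1 k) z.1 z.2.
have uE k : component u k = fun z => gl (vel1 k) z.1 z.2.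
  by apply/funext => z; rewrite /component mxE.
exists u; split.
(* Each component is constant along its own direction, so every diagonal weak derivative is 0. *)
- apply: aeW => t /= psi tpsi; have [[_ bv _] _ _ _ [wv dv0]] := slice t.
  have [spsi ppsi] := tpsi.
  transitivity (\int[tor]_x (\sum_(k < d) gl (vel1 k) t x * partial k psi x)).
    by apply: eq_Rintegral => x _; apply: eq_bigr => k _; rewrite mxE.
  rewrite Rintegral_sum_bounded => [|k].
    apply: big1 => k _; rewrite (wv k k psi tpsi).
    under eq_Rintegral do rewrite dv0 mul0r.
    by rewrite Rintegral_cst// mul0r oppr0.
  apply: bounded_measurableM => //; apply: bounded_measurable_periodic.
    exact: smooth_derive_continuous.
  exact: partial_periodic.
- move=> k; rewrite uE; split.
    apply: (mnorm _ _ _ 1) => //.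
    + exact: measurable_vel1.
    + by move=> a g v wa _; exact: periodic_vel1.
    + by move=> t; have [_ _ _ [nv _] _] := slice t; rewrite mul1r.
  move=> l; exists (fun z => gl (dvel1 k l) z.1 z.2).
    apply: (mnorm _ _ _ 1) => //.
    + exact: measurable_dvel1.
    + by move=> a g v wa _; exact: periodic_dvel1.
    + by move=> t; have [_ _ _ [_ nv] _] := slice t; rewrite mul1r.
  by apply: aeW => t /=; have [_ _ _ _ [wv _]] := slice t.
- move=> k; rewrite uE.
  have -> : hoelder_conjugate p%:E = (p / (p - 1))%:E.
    rewrite /hoelder_conjugate/= gt_eqF ?lte_fin ?(lt_trans ltr01)//.
    by rewrite inver subr_eq0 gt_eqF// -EFinM.
  (* For [s = 1] the power of [Q] is 0 and the bound is uniform in time. *)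
  move: s1; rewrite le_eqVlt => /predU1P[s11|s11].
    rewrite -s11 hoelder_conjugate1; split.
    + by apply: measurable_funTS; apply: mgl; exact: measurable_vel1.
    + by move=> t; apply: pgl => a g v wa _; exact: periodic_vel1.
    + apply: (Lnorm_time_fin_infty T _ K) => t; rewrite Lnorm_ge0/=.
      have [_ _ nv _ _] := slice t; apply: le_trans (nv k) _.
      by rewrite -s11 invr1 subrr powRr0 mulr1.
  have -> : hoelder_conjugate s%:E = (s / (s - 1))%:E.
    rewrite /hoelder_conjugate/= gt_eqF ?lte_fin//.
    by rewrite inver subr_eq0 gt_eqF// -EFinM.
  apply: (mnorm _ _ _ K) => //.
  + by rewrite divr_gt0// subr_gt0.
  + exact: measurable_vel1.
  + by move=> a g v wa _; exact: periodic_vel1.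
  + move=> t; have [_ _ nv _ _] := slice t; apply: le_trans (nv k) _.
    by rewrite invf_div mulrBl mul1r divff ?gt_eqF.
have gls t x : T / 2 < t -> t < T -> gl rho1 t x = slot_fun J x.
  move=> Tt tT; have t1 : (t < T / 2) = false by apply/negbTE; rewrite -leNgt ltW.
  have t2 : t - T / 2 < T / 2 by rewrite ltrBlDl -splitr.
  have g0 : good T Ps f0 0%N t.
    rewrite /good tT Ps0 /P0/= t1 t2 /rest1/= eqxx !andbT.
    by rewrite (le_trans _ (ltW Tt))// divr_ge0// ltW.
  rewrite /gl (gluedE T Ps f0 agree 0%N)// Ps0 /P0.
  transitivity (rho1 (T / 2, Shear i 0 (1 / 8) 0 ((1 + 1) `^ s))
    (exec1 (T / 2, Jump J 1) f0) (t - T / 2) x).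
    by move: t1 t2; rewrite /= => -> ->.
  rewrite exec1_jump /rho1 /speed/= !mul0r mulr0 scale0r subr0 /kick/=.
  by rewrite add0r.
exists (fun=> 0), (fun z => gl rho1 z.1 z.2), (fun=> 0); split.
- split => //; apply: bounded_measurable_integrable; exact: bounded_measurable_cst.
- split.
    apply: (mnorm _ _ _ 1) => //.
    + exact: measurable_rho1.
    + by move=> a g v wa sg; case: (state_rho1 _ _ v wa sg).
    + by move=> t; have [_ nr _ _ _] := slice t; rewrite mul1r.
  move=> phi tphi.
  under [in RHS]eq_Rintegral do rewrite mul0r.
  rewrite Rintegral_cst// mul0r oppr0.
  have uG t : \int[tor]_x (gl rho1 (t, x).1 (t, x).2 * (time_derive phi (t, x) +
      \sum_(k < d) u (t, x) 0 k * space_derive k phi (t, x))) =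
    \int[tor]_x (gl rho1 t x * (time_derive phi (t, x) +
      \sum_(k < d) gl (vel1 k) t x * space_derive k phi (t, x))).
    apply: eq_Rintegral => x _; congr (_ * (_ + _)).
    by apply: eq_bigr => k _; rewrite mxE.
  have mG := measurable_Rintegral_fiber _
    (measurable_glued_rate p q s st K T Ps vPs agree phi tphi).
  apply: etrans (glued_transport p q s st K T F C Ps p1 q1 s1 K0 dPs vPs agree costC
    fluxF restP phi tphi).
  transitivity (\int[lebT T]_t \int[tor]_x (gl rho1 t x * (time_derive phi (t, x) +
      \sum_(k < d) gl (vel1 k) t x * space_derive k phi (t, x)))).
    by apply: eq_Rintegral => t _; exact: uG.
  congr (fine _); apply: integral_lebT; exact/measurable_EFinP.
- split.
    split.
    + exact: measurable_cst.
    + by [].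
    + apply: (mixed_norm_fin T _ (fun t => gl bound1 t 0) s p 0) => // t.
      by rewrite mul0r; apply: Lnorm_zero => //; exact: lt_trans ltr01 p1.
  move=> phi tphi.
  under [in RHS]eq_Rintegral do rewrite mul0r.
  rewrite Rintegral_cst// mul0r oppr0.
  transitivity (\int[lebT T]_t (0 : R)); last by rewrite /Rintegral integral0_eq.
  apply: eq_Rintegral => t _; transitivity (\int[tor]_x (0 : R)).
    by apply: eq_Rintegral => x _; rewrite mul0r.
  by rewrite /Rintegral integral0_eq.
move=> [N [mN N0 HN]].
(* On [B1] times [B2], the second half of the time and the source box, the two solutions differ; its
   measure is positive. *)
pose B1 : set (measurableTypeR R) := `]T / 2, T[%classic.
pose B2 : set 'rV[R]_d := ib 0 (side (lev J)) @^-1` [set 1].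
have mB1 : measurable B1 by exact: measurable_itv.
have mB2 : measurable B2.
  have [mi _] := bounded_measurable_ib (0 : 'rV[R]_d) (side (lev J)).
  by rewrite -[B2]setTI; exact: mi.
have BN : B1 `*` B2 `<=` N.
  move=> [t x] [/=]; rewrite /B1/= in_itv/= => /andP[Tt tT] xB; apply: HN => /=.
  apply/eqP; rewrite gls// slot_fun_neq0//.
  by move: xB; rewrite /B2/= /ib; case: inbox => // /esym/eqP; rewrite oner_eq0.
have : ((lebT T \x tor) (B1 `*` B2) <= (lebT T \x tor) N)%E.
  by apply: le_measure; rewrite ?inE//; exact: measurableX.
rewrite N0 product_measure1E// /lebT/= /mrestr.
have -> : B1 `&` `]0, T[%classic = B1.
  apply/setIidl => t; rewrite /B1/= !in_itv/= => /andP[Tt ->].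
  by rewrite (lt_trans _ Tt)// divr_gt0.
have -> : tor B2 = (vol (lev J))%:E.
  rewrite /vol -(integral_ib (0 : 'rV[R]_d) _ (side01 _)).
  transitivity (\int[tor]_x (\1_B2 x)%:E)%E; first by rewrite integral_indic// setIT.
  apply: eq_integral => x _; congr EFin; rewrite indicE.
  case: (boolP (inbox 0 (side (lev J)) x)) => xin.
    by rewrite mem_set /B2/= /ib xin.
  by rewrite memNset /B2/= /ib (negbTE xin)// => /esym/eqP; rewrite oner_eq0.
rewrite lebesgue_measure_itv/= lte_fin.
have TT : T / 2 < T by have T0' := T0; lra.
by rewrite TT -EFinB -EFinM lee_fin leNgt mulr_gt0 ?vol_gt0// subr_gt0.
Qed.

End nonuniqueness.

(** * Exponents *)

(* Here [m = d - 1] and [y = 1 / q], so that [m * eps] is the [beta] of the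
   theorem and [1 - p^-1] is the inverse of the conjugate exponent of [p]. *)
Lemma exponent_inequality (R : realType) (m p y : R) (eps := (p - 1) / (4 * (p + 1) * p))
  (theta := (1 + 2 * (m * eps)) / (1 + 4 * (m * eps))) :
  1 < p -> 2 <= m -> 1 - eps - p^-1 < y ->
  0 < m * y - m * (1 - p^-1) - 1 + theta * (p^-1 + m * (1 - p^-1)).
Proof.
move=> p1 m2 yeps; have p0 : 0 < p by exact: lt_trans ltr01 p1.
have e0 : 0 < eps by rewrite divr_gt0 ?subr_gt0// !mulr_gt0// addr_gt0.
have ae : 1 - p^-1 = 4 * (p + 1) * eps.
  by rewrite /eps; field; apply/andP; split; rewrite gt_eqF// addr_gt0.
have ip : p^-1 = 1 - 4 * (p + 1) * eps by rewrite -ae; ring.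
have amgm : 2 <= p + p^-1.
  rewrite -subr_ge0 (_ : _ - 2 = (p - 1) ^+ 2 / p); last by field; rewrite gt_eqF.
  by rewrite divr_ge0 ?sqr_ge0// ltW.
have m0 : 0 < m by exact: lt_le_trans m2.
have b0 : 0 < 1 + 4 * (m * eps) by rewrite addr_gt0// mulr_gt0// mulr_gt0.
have key : 1 + m * eps <= theta * (p^-1 + m * (1 - p^-1)).
  rewrite /theta mulrAC ler_pdivlMr// -subr_ge0 ae.
  rewrite (_ : _ - _ = eps * (4 * (p + 1) * (m - 1) + 2 * m * p^-1 - 5 * m +
      m * (m * eps) * (8 * p + 4))); last first.
    by rewrite ip; ring.
  have m0' := ltW m0; have e0' := ltW e0.
  (* The factor of [eps] equals [h1 + 2 h2 + 2 h3 + m], where [h1], [h2], [h3] stand for the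
     quantities bounded below here. *)
  have h1 : 0 <= m * (m * eps) * (8 * p + 4) by rewrite (mulr_ge0 (mulr_ge0 m0' (mulr_ge0 m0' e0')))//; lra.
  have h2 : 0 <= m * (p + p^-1 - 2) by rewrite mulr_ge0//; lra.
  have h3 : 0 <= (p + 1) * (m - 2) by rewrite mulr_ge0//; lra.
  have h4 : 0 <= m * (p - 1) by rewrite mulr_ge0//; lra.
  by apply: mulr_ge0; [exact: ltW|lra].
have : m * (1 - eps - p^-1) < m * y by rewrite ltr_pM2l//; lra.
by lra.
Qed.

Lemma fine_div_hoelder_conjugate (R : realType) (s : R) : 1 <= s ->
  fine (s%:E / hoelder_conjugate s%:E)%E = s - 1.
Proof.
rewrite le_eqVlt => /predU1P[<-|s1].
  by rewrite hoelder_conjugate1 invey mule0 subrr.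
have s0 : 0 < s by exact: lt_trans ltr01 s1.
rewrite /hoelder_conjugate/= gt_eqF ?lte_fin//.
rewrite inver subr_eq0 gt_eqF// -EFinM inver gt_eqF ?divr_gt0 ?subr_gt0//=.
by field; rewrite ?gt_eqF ?subr_gt0.
Qed.

Theorem theorem1p1 (R : realType) (T : R) (d : nat) (p q s st : R)
  (p' := hoelder_conjugate p%:E) (s' := hoelder_conjugate s%:E)
  (beta := (p - 1) * (d%:R - 1) / (4 * p * (p + 1))) :
  0 < T -> (3 <= d)%N ->
  1 <= p -> 1 <= q -> 1 <= s -> 1 <= st ->
  1 < p ->
  p^-1 + q^-1 > 1 - (p - 1) / (4 * (p + 1) * p) ->
  st <= s / (fine (s%:E / s')%E + (1 + 2 * beta) / (1 + 4 * beta)) ->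
  exists u : R * 'rV[R]_d -> 'rV[R]_d,
    [/\ divergence_free T u,
        forall i, L_W1q T st%:E q%:E (component u i),
        forall i, L_Lp T s' p' (component u i)
      & uniqueness_fails T u (L_Lp T s%:E p%:E)].
Proof.
move=> T0 d3 _ q1 s1 st1 p1 pq hst.
have p0 : 0 < p by exact: lt_trans ltr01 p1.
have s0 : 0 < s by exact: lt_le_trans ltr01 s1.
have st0 : 0 < st by exact: lt_le_trans ltr01 st1.
have dpos : (0 < d)%N by exact: leq_trans d3.
pose m : R := d.-1%:R; pose eps := (p - 1) / (4 * (p + 1) * p).
have mE : d%:R - 1 = m by rewrite /m -[X in X%:R - 1](prednK dpos) -natr1 addrK.
have m2 : 2 <= m by rewrite /m ler_nat -ltnS prednK.
have bE : beta = m * eps by rewrite /beta mE /eps; field; apply/andP; split; rewrite gt_eqF// addr_gt0.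
have e0 : 0 < eps by rewrite divr_gt0 ?subr_gt0// !mulr_gt0// addr_gt0.
have b0 : 0 < beta by rewrite bE mulr_gt0//; lra.
pose theta := (1 + 2 * beta) / (1 + 4 * beta).
have th0 : 0 < theta by rewrite divr_gt0; lra.
(* As [s/s' = s - 1], the bound on [st] says [s - 1 + theta <= s / st]. *)
have sth : theta <= 1 - (s - s / st).
  move: hst; rewrite fine_div_hoelder_conjugate// -/theta.
  have S0 : 0 < s - 1 + theta by lra.
  rewrite ler_pdivlMr// mulrC -ler_pdivlMr//; lra.
have sst : s / st <= s by rewrite ler_pdivrMr// ler_peMr// ltW.
have ipc : (p / (p - 1))^-1 = 1 - p^-1 by rewrite invf_div mulrBl divff ?gt_eqF// mul1r.
pose L := m * q^-1 - m * (1 - p^-1) - 1 + theta * (p^-1 + m * (1 - p^-1)).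
have L0 : 0 < L.
  by rewrite /L /theta bE; apply: exponent_inequality => //; rewrite -/eps in pq *; lra.
have ip0 : 0 < p^-1 by rewrite invr_gt0.
have ip1 : 0 < 1 - p^-1 by rewrite subr_gt0 invf_lt1.
(* [gam] will be [p^-1 - delta]: below [1/p], not negative, and so close to [1/p] that the loss, at
   most [delta], leaves the exponent [L] positive. *)
pose delta := Num.min (L / 2) (p^-1 / 2).
have dL : delta <= L / 2 by rewrite ge_min lexx.
have dp : delta <= p^-1 / 2 by rewrite ge_min lexx orbT.
have d0 : 0 < delta by rewrite lt_min !divr_gt0.
pose K : R := 3 `^ s * 3 ^+ d.-1.
have K0 : 0 <= K by rewrite mulr_ge0 ?powR_ge0 ?exprn_ge0.
have d1 : (1 < d)%N by exact: ltnW.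
apply: (nonuniqueness p q s st K T (Ordinal (ltnW d1))) => //.
apply: (slot_realizes p q s st K (p^-1 - delta)) => //; rewrite ?ipc -?/m; try lra.
set sg := 1 - (s - s / st) in sth *.
have sg1 : sg <= 1 by rewrite /sg; lra.
rewrite (addrAC p^-1) (mulrBr sg); apply: (@lt_le_trans _ _ (L - delta)); first lra.
rewrite /L -[leLHS]addrA lerD2l; apply: lerB; last by rewrite ler_piMl// ltW.
by apply: ler_wpM2r => //; rewrite addr_ge0 ?mulr_ge0 ?ltW//; lra.
Qed.
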